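(* Let $K$ be a field which is large and simple, with $\operatorname{Char}(K)\neq 2$, and let $C$ be a conic over $K$. Then $C$ has a $K$-point, and hence $C(K)$ is infinite.
   Context: A field $K$ is large if every irreducible algebraic curve over $K$ with a smooth (nonsingular) $K$-point has infinitely many $K$-points. A field is simple if its complete first-order theory in the language of rings is simple (in the model-theoretic sense). A conic over $K$ is a smooth irreducible projective $K$-curve of genus $0$. *)

(* Defs.v *)
From HB Require Import structures.
From mathcomp Require Import all_boot all_order all_algebra.
From mathcomp.multinomials Require Import mpoly.

Set Implicit Arguments.
Unset Strict Implicit.
Unset Printing Implicit Defensive.
Import Order.TTheory GRing.Theory Num.Theory.
Local Open Scope ring_scope.

Definition infinite (T : eqType) (X : T -> Prop) : Prop :=
  forall s : seq T, exists x, X x /\ x \notin s.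

(** * First-order logic in the language of rings

    [GRing.formula R] has a constant for every element of [R] and a symbol for
    the inverse, so it cannot be used to compare the theories of two fields in
    the language of rings alone. *)

Inductive rterm (n : nat) : Type :=
| RVar of 'I_n
| RZero
| ROne
| RAdd of rterm n & rterm n
| ROpp of rterm n
| RMul of rterm n & rterm n.

(* The free variables of [f : rformula n] are among 0, ..., n - 1; [RExists]
   binds variable 0 of its body and shifts the others. *)
Inductive rformula : nat -> Type :=
| REq n of rterm n & rterm n : rformula n
| RNot n of rformula n : rformula n
| RAnd n of rformula n & rformula n : rformula n
| RExists n of rformula n.+1 : rformula n.

Fixpoint reval (M : fieldType) n (e : n.-tuple M) (t : rterm n) : M :=
  match t with
  | RVar i => tnth e i
  | RZero => 0
  | ROne => 1
  | RAdd t1 t2 => reval e t1 + reval e t2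
  | ROpp t1 => - reval e t1
  | RMul t1 t2 => reval e t1 * reval e t2
  end.

Fixpoint rholds (M : fieldType) n (f : rformula n) : n.-tuple M -> Prop :=
  match f in rformula n return n.-tuple M -> Prop with
  | REq _ t1 t2 => fun e => reval e t1 = reval e t2
  | RNot _ f1 => fun e => ~ rholds f1 e
  | RAnd _ f1 f2 => fun e => rholds f1 e /\ rholds f2 e
  | RExists _ f1 => fun e => exists a : M, rholds f1 [tuple of a :: e]
  end.

Definition elem_equiv (K M : fieldType) : Prop :=
  forall f : rformula 0,
    rholds f ([tuple] : 0.-tuple K) <-> rholds f ([tuple] : 0.-tuple M).

(* The formula phi(x, y), with |x| = m and |y| = l, has the tree property in M:
   there are k >= 2 and a tree of parameters b_s, s a finite sequence of natural
   numbers, such that for every s the family (phi(x, b_(s^i)))_i is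
   k-inconsistent, whereas phi is consistent (that is, finitely satisfiable in
   M) along every infinite branch sigma. *)
Definition tree_property (M : fieldType) m l (phi : rformula (m + l)) : Prop :=
  exists (k : nat) (b : seq nat -> l.-tuple M),
    [/\ (1 < k)%N,
        forall (s : seq nat) (I : seq nat), uniq I -> size I = k ->
          ~ exists a : m.-tuple M,
              forall i, i \in I -> rholds phi [tuple of a ++ b (rcons s i)]
      & forall (sigma : nat -> nat) (N : nat),
          exists a : m.-tuple M, forall i, (i < N)%N ->
            rholds phi [tuple of a ++ b (mkseq sigma i.+1)]].

(* No formula has the tree property in a model of the complete theory of K;
   these models are exactly the fields elementarily equivalent to K. *)
Definition simple_field (K : fieldType) : Prop :=
  forall M : fieldType, elem_equiv K M ->
  forall m l (phi : rformula (m + l)), ~ tree_property M phi.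

(** * Ideals of K[X_0, ..., X_n] and projective varieties *)

Section Ideals.
Variables (K : fieldType) (n : nat).
Implicit Types (I J P : {mpoly K[n.+1]} -> Prop) (s : seq {mpoly K[n.+1]}).

Definition ideal_gen s : {mpoly K[n.+1]} -> Prop := fun p =>
  exists c : 'I_(size s) -> {mpoly K[n.+1]}, p = \sum_(i < size s) c i * s`_i.

Definition is_ideal I : Prop :=
  [/\ I 0, forall p q, I p -> I q -> I (p + q) & forall p q, I q -> I (p * q)].

Definition is_prime P : Prop :=
  [/\ is_ideal P, ~ P 1 & forall p q, P (p * q) -> P p \/ P q].

Definition is_homog_ideal I : Prop :=
  forall p d, I p -> I (pihomog mdeg d p).

(* The points of Proj K[X_0, ..., X_n], i.e. the irreducible closed subsets of
   P^n_K. *)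
Definition proj_prime P : Prop :=
  [/\ is_prime P, is_homog_ideal P & exists i : 'I_n.+1, ~ P 'X_i].

Definition ideal_ssub I J : Prop :=
  (forall p, I p -> J p) /\ exists p, J p /\ ~ I p.

Fixpoint proj_chain (r : nat) P : Prop :=
  if r is r'.+1 then
    exists Q, [/\ proj_prime Q, ideal_ssub P Q & proj_chain r' Q]
  else True.

(* The topological dimension of the closed set V_+(P), for P in Proj. *)
Definition has_proj_dim P (r : nat) : Prop :=
  proj_chain r P /\ ~ proj_chain r.+1 P.

(* [h] is the dimension of the degree d part of K[X_0, ..., X_n] / I. *)
Definition hilbert_fun I (d h : nat) : Prop :=
  exists U : {vspace dhomog n.+1 K d},
    (forall p : dhomog n.+1 K d, p \in U <-> I p) /\
    h = (\dim {: dhomog n.+1 K d} - \dim U)%N.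

Definition hilbert_poly I (hp : {poly rat}) : Prop :=
  exists N : nat, forall d : nat, (N <= d)%N ->
    exists h : nat, hilbert_fun I d h /\ hp.[d%:R] = h%:R.

(* p_a = (-1)^r (hp(0) - 1), where r is the dimension and hp the Hilbert
   polynomial. *)
Definition has_arith_genus I (g : int) : Prop :=
  exists (r : nat) (hp : {poly rat}),
    [/\ has_proj_dim I r, hilbert_poly I hp
      & g%:~R = (-1) ^+ r * (hp.[0] - 1) :> rat].

End Ideals.

Definition zero_at (L : fieldType) n (s : seq {mpoly L[n.+1]})
    (x : 'rV[L]_n.+1) : Prop :=
  forall p, p \in s -> p.@[x 0] = 0.

Definition jacobian (L : fieldType) n (s : seq {mpoly L[n.+1]})
    (x : 'rV[L]_n.+1) : 'M[L]_(size s, n.+1) :=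
  \matrix_(i < size s, j < n.+1) (s`_i)^`M(j).@[x 0].

(** * Curves *)

(* Irreducible (and reduced) closed curves in P^n_K. *)
Record proj_curve (K : fieldType) : Type := ProjCurve {
  pc_n : nat;
  pc_eqns : seq {mpoly K[pc_n.+1]};
  pc_homog : forall p, p \in pc_eqns -> p \is homog mdeg;
  pc_prime : proj_prime (ideal_gen pc_eqns);
  pc_dim1 : has_proj_dim (ideal_gen pc_eqns) 1
}.

Section Curves.
Variables (K : fieldType) (C : proj_curve K).

(* The equations of C over an extension field. *)
Definition pc_ext (L : fieldType) (iota : {rmorphism K -> L}) :
    seq {mpoly L[(pc_n C).+1]} :=
  [seq map_mpoly iota p | p <- pc_eqns C].

(* Jacobian criterion: the rank is n - 1, the codimension of C. *)
Definition smooth_at (L : fieldType) (iota : {rmorphism K -> L})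
    (x : 'rV[L]_(pc_n C).+1) : Prop :=
  (\rank (jacobian (pc_ext iota) x)).+1 = pc_n C.

Definition smooth_curve : Prop :=
  forall (L : fieldType) (iota : {rmorphism K -> L}) (x : 'rV[L]_(pc_n C).+1),
    x != 0 -> zero_at (pc_ext iota) x -> smooth_at iota x.

(* A K-point of P^n is a line of K^(n+1), spanned by its vectors of homogeneous
   coordinates. *)
Definition curve_point (P : {vspace 'rV[K]_(pc_n C).+1}) : Prop :=
  exists x : 'rV[K]_(pc_n C).+1,
    [/\ x != 0, zero_at (pc_eqns C) x & P = <[x]>%VS].

(* The genus of C is its arithmetic genus 1 - chi(O_C). A smooth curve of
   arithmetic genus 0 is geometrically irreducible: in particular P^1 over a
   proper separable extension of K, seen as a curve over K, is excluded, although
   h^1(O) = 0 for it. *)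
Definition conic : Prop :=
  smooth_curve /\ has_arith_genus (ideal_gen (pc_eqns C)) 0.

(* The K-points of the open subset of C where the homogeneous polynomials in s
   do not all vanish, and the smooth ones among them. *)
Definition open_point (s : seq {mpoly K[(pc_n C).+1]})
    (P : {vspace 'rV[K]_(pc_n C).+1}) : Prop :=
  exists x : 'rV[K]_(pc_n C).+1,
    [/\ x != 0, zero_at (pc_eqns C) x, ~ zero_at s x & P = <[x]>%VS].

Definition smooth_open_point (s : seq {mpoly K[(pc_n C).+1]})
    (P : {vspace 'rV[K]_(pc_n C).+1}) : Prop :=
  exists x : 'rV[K]_(pc_n C).+1,
    [/\ x != 0, zero_at (pc_eqns C) x, ~ zero_at s x,
        smooth_at idfun x & P = <[x]>%VS].

End Curves.

Arguments curve_point {K} C P.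
Arguments open_point {K} C s P.
Arguments smooth_open_point {K} C s P.

(* Every algebraic curve is quasi-projective, so the irreducible curves over K
   are the open subsets of the curves in [proj_curve K]. *)
Definition large_field (K : fieldType) : Prop :=
  forall (C : proj_curve K) (s : seq {mpoly K[(pc_n C).+1]}),
    (forall p, p \in s -> p \is homog mdeg) ->
    (exists P, smooth_open_point C s P) ->
    infinite (open_point C s).

(* Main.v *)
(** Two squares. Over a large field a finite system of conditions "1 + e_k t^2 is a nonzero
    square" has a solution t <> 0, because the curve z_k^2 = w^2 + e_k t^2 has a smooth
    rational point at t = 0. If a x^2 + b y^2 = 1 had no solution, the sets of all x such
    that x - c is a times a nonzero square and d - x is b times a nonzero square could
    therefore be arranged in a tree which contradicts simplicity. So a x^2 + b y^2 = 1 is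
    solvable whenever a and b are nonzero, and every ternary quadratic form over K is
    isotropic.

    Conics. The dimension of the degree d part of the homogeneous coordinate ring of a
    smooth curve of arithmetic genus 0 is D d + 1 for large d. A finite extension of the
    constants inside the function field would divide this number for all large d, so C stays
    integral over the finite extensions L of K; choose L such that C has an L-point y. The
    functions of degree d realize all orders of vanishing at y up to D d, which identifies
    the functions of degree k d with the polynomials in one variable t over L of degree at
    most k D d. The infinitesimal automorphisms of this graded ring are the solutions of a
    linear system over K; hence there are three of them over K, the corresponding quadratic
    polynomials in t satisfy a quadratic relation over K, and an isotropic vector of this
    relation is a point of the projective line over L at which evaluation is K-rational up to
    a scalar. This is a K-point of C. It is smooth, so C(K) is infinite. *)
Require Import Defs.
From HB Require Import structures.
From mathcomp Require Import all_boot all_order all_algebra.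
From mathcomp Require Import generic_quotient ring_quotient.
From mathcomp.multinomials Require Import mpoly.
From mathcomp Require Import zify ring.
From Stdlib Require Import Classical ClassicalEpsilon.
From Stdlib Require Import FunctionalExtensionality PropExtensionality.

Set Implicit Arguments.
Unset Strict Implicit.
Unset Printing Implicit Defensive.
Import GRing.Theory Num.Theory.
Local Open Scope ring_scope.

(** * Linear independence modulo a submodule and fraction fields of quotients *)

(** Genus 0 enters only through the exact values D d + 1 of the Hilbert function: closed points,
    constants and orders of vanishing are all controlled by counting dimensions, without cohomology.
    No line bundle of degree 1 over K is at hand, since D may be even, so the coordinate t cannot be
    expected over K. The bundle that descends is the tangent bundle: it has degree 2, its sections
    are (a + b t + c t^2) d/dt, and it embeds the curve as a plane conic, whose equation is the
    quadratic relation. Descent of linear systems replaces Galois theory, as L may be inseparable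
    over K. Sections of the tangent bundle become comparable with forms on C after multiplication by
    a Wronskian. For the tree, a point x is moved to x + u r^2, which multiplies each x - c by 1 + u
    r^2 / (x - c); hence the shape of the conditions on squares. *)

Definition asb (P : Prop) : bool := if excluded_middle_informative P then true else false.
Lemma asbP (P : Prop) : reflect P (asb P).
Proof. by rewrite /asb; case: excluded_middle_informative => h; constructor. Qed.

Section LinearIndependenceModulo.
Variables (k : fieldType) (M : lmodType k).
Implicit Types (Z : M -> Prop).

Definition submodule Z :=
  [/\ Z 0, forall x y, Z x -> Z y -> Z (x + y) & forall c x, Z x -> Z (c *: x)].

(** Independence in M/Z, without forming the quotient, so that one family can be compared modulo
    several submodules. *)
Definition indep Z (T : finType) (f : T -> M) :=
  forall c : T -> k, Z (\sum_i c i *: f i) -> forall i, c i = 0.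

Definition spanned Z (T : finType) (f : T -> M) (x : M) :=
  exists c : T -> k, Z (x - \sum_i c i *: f i).

Lemma sum_unit (F : unit -> M) : \sum_i F i = F tt.
Proof. by rewrite (bigD1 tt) //= big1 ?addr0 //; case. Qed.

Lemma submod_sum Z (T : finType) (f : T -> M) : submodule Z ->
  (forall i, Z (f i)) -> Z (\sum_i f i).
Proof. by case=> h0 hD _ hf; elim/big_ind: _. Qed.

Lemma submodN Z x : submodule Z -> Z x -> Z (- x).
Proof. by case=> _ _ hZ hx; rewrite -scaleN1r; apply: hZ. Qed.

Lemma submodB Z x y : submodule Z -> Z x -> Z y -> Z (x - y).
Proof. by move=> hZ hx hy; have [_ hD _] := hZ; apply: hD => //; apply: submodN. Qed.

Lemma indep_leq Z (T U : finType) (f : T -> M) (g : U -> M) : submodule Z ->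
  indep Z f -> (forall i, spanned Z g (f i)) -> (#|T| <= #|U|)%N.
Proof.
move=> hZ hf /(fun h => choice _ h) [a ha]; have [h0 hD hS] := hZ.
pose A : 'M[k]_(#|T|, #|U|) := \matrix_(i, j) a (enum_val i) (enum_val j).
rewrite leqNgt; apply/negP => lt.
have : kermx A != 0.
  rewrite -mxrank_eq0 mxrank_ker subn_eq0 -ltnNge.
  by apply: leq_ltn_trans lt; apply: rank_leq_col.
move/rowV0Pn => [v /sub_kermxP hv /eqP]; apply.
apply/rowP => i; rewrite mxE -(enum_valK i).
set c : T -> k := fun t => v 0 (enum_rank t).
apply: (hf c); have e : \sum_i c i *: f i = \sum_i c i *: (f i - \sum_j a i j *: g j).
  have e0 : \sum_i c i *: \sum_j a i j *: g j = 0.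
    under eq_bigr do rewrite scaler_sumr.
    rewrite exchange_big big1 //= => j _.
    under eq_bigr do rewrite scalerA.
    rewrite -scaler_suml.
    suff -> : \sum_i c i * a i j = 0 by rewrite scale0r.
    move/rowP: hv => /(_ (enum_rank j)); rewrite !mxE => hv; rewrite -[RHS]hv.
    rewrite (reindex (@enum_val T T)) /=; last exact/onW_bij/enum_val_bij.
    by apply: eq_bigr => l _; rewrite /c mxE !enum_valK !enum_rankK.
  by under [RHS]eq_bigr do rewrite scalerBr; rewrite sumrB e0 subr0.
by rewrite e; apply: submod_sum => // t; apply: hS.
Qed.

Definition sumfun (T U : Type) (f : T -> M) (g : U -> M) (x : T + U) : M :=
  match x with inl a => f a | inr b => g b end.

(** Additivity of dimension along Z'/Z, M/Z, M/Z': [f] lifts independent vectors of the quotient,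
    [g] lies in the submodule. *)
Lemma indep_sum Z Z' (T U : finType) (f : T -> M) (g : U -> M) :
  submodule Z' -> (forall x, Z x -> Z' x) ->
  indep Z' f -> indep Z g -> (forall j, Z' (g j)) -> indep Z (sumfun f g).
Proof.
move=> hZ' sub hf hg hZg c; rewrite big_sumType /= => hc.
have [_ _ hS] := hZ'.
have hcf : forall i, c (inl i) = 0.
  apply: hf.
  set y := \sum_(i : U) _ in hc.
  have hy : Z' y by apply: submod_sum => // j; apply: hS.
  by have := submodB hZ' (sub _ hc) hy; rewrite addrK.
case=> i; first exact: hcf.
apply: (hg (fun j => c (inr j))); move: hc; rewrite big1 ?add0r //.
by move=> j _; rewrite hcf scale0r.
Qed.

End LinearIndependenceModulo.

Section IntegralComRing.
Variables (D : comNzRingType) (D_integral : forall x y : D, x * y = 0 -> (x == 0) || (y == 0)).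

Definition inverse_of (x y : D) := y * x = 1.
Definition has_inverse (x : D) := asb (exists y, inverse_of x y).
Definition chosen_inverse (x : D) : D :=
  if has_inverse x then epsilon (inhabits 0) (inverse_of x) else x.

Fact chosen_inverseP : {in has_inverse, left_inverse 1 chosen_inverse *%R}.
Proof.
move=> x hx; rewrite /chosen_inverse ifT //.
exact: (epsilon_spec (inhabits 0) (inverse_of x) (asbP _ hx)).
Qed.
Fact has_inverseP (x y : D) : y * x = 1 -> has_inverse x.
Proof. by move=> h; apply/asbP; exists y. Qed.
Fact chosen_inverse_out : {in [predC has_inverse], chosen_inverse =1 id}.
Proof. by move=> x; rewrite inE /chosen_inverse => h; rewrite ifN. Qed.

(** Inverses chosen classically equip the quotient by a prime ideal with the structure from which
    its fraction field is formed. *)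
Definition integral_comUnitRing : comUnitRingType :=
  HB.pack_for comUnitRingType (GRing.ComNzRing.sort D)
    (GRing.ComNzRing_hasMulInverse.Build D chosen_inverseP has_inverseP chosen_inverse_out).
Definition integral_idomain : idomainType :=
  HB.pack_for idomainType (GRing.ComUnitRing.sort integral_comUnitRing)
    (GRing.ComUnitRing_isIntegral.Build integral_comUnitRing D_integral).
End IntegralComRing.

Section PrimeIdealField.
Local Open Scope quotient_scope.
Variables (S : comNzRingType) (I : S -> Prop).
Hypotheses (I0 : I 0) (ID : forall p q, I p -> I q -> I (p + q))
  (IM : forall p q, I q -> I (p * q)) (I1 : ~ I 1)
  (Iprime : forall p q, I (p * q) -> I p \/ I q).

Definition ideal_pred : S -> bool := fun p => asb (I p).

Fact ideal_pred_closed : idealr_closed ideal_pred.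
Proof.
split; rewrite ?inE; first exact/asbP.
  by apply/asbP.
move=> a u v /asbP hu /asbP hv; apply/asbP.
by apply: ID => //; apply: IM.
Qed.
Fact ideal_pred_prime : prime_idealr_closed ideal_pred.
Proof.
move=> u v /asbP /Iprime [h|h]; apply/orP; [left|right]; exact/asbP.
Qed.

HB.instance Definition _ := isIdealr.Build S ideal_pred ideal_pred_closed.
HB.instance Definition _ := isPrimeIdealrClosed.Build S ideal_pred ideal_pred_prime.

(** The residue field of a prime ideal. Every field extension constructed below comes from it:
    function fields, residue fields of points, adjunction of roots. *)
Lemma prime_ideal_field : exists (F : fieldType) (phi : {rmorphism S -> F}),
  (forall p, phi p = 0 <-> I p) /\
  (forall z, exists a b, phi b <> 0 /\ z = phi a / phi b).
Proof.
pose Q := integral_idomain (@Quotient.rquot_IdomainAxiom S (ideal_pred : prime_idealr S)).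
pose phi0 : {rmorphism S -> Q} := \pi_(Quotient.quot (ideal_pred : prime_idealr S)).
pose phi : {rmorphism S -> {fraction Q}} := (@FracField.tofrac Q) \o phi0.
have phiE p : phi p = FracField.tofrac (phi0 p) by [].
have phi0E p : phi0 p = 0 <-> I p.
  rewrite -[0](rmorph0 phi0); split=> [/eqP|h].
    by rewrite -Quotient.idealrBE subr0 => /asbP.
  by apply/eqP; rewrite -Quotient.idealrBE subr0; apply/asbP.
have phi0S z : exists a, z = phi0 a by exists (repr z); rewrite /phi0 /= reprK.
exists {fraction Q}, phi; split=> [p|z].
  rewrite phiE -phi0E; split=> [/eqP|->]; last exact: rmorph0.
  by rewrite tofrac_eq0 => /eqP.
have [r ->] : exists r : {ratio Q}, z = \pi_(FracField.type Q) r by exists (repr z); rewrite reprK.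
have [a ha] := phi0S r.1; have [b hb] := phi0S r.2.
have b0 : r.2 != 0 by case: (r).
exists a, b; rewrite !phiE -ha -hb; split.
  by apply/eqP; rewrite tofrac_eq0.
apply: (canRL (mulfK _)); first by rewrite tofrac_eq0.
rewrite /FracField.tofrac; unlock.
rewrite -[LHS]FracField.pi_mul.
apply/eqP; rewrite FracField.equivf_def.
by rewrite /FracField.mulf !numden_Ratio ?oner_neq0 ?mulr1 // mulrC.
Qed.
End PrimeIdealField.

(** * Hilbert's basis theorem *)

Definition ring_ideal (R : comNzRingType) (I : R -> Prop) :=
  [/\ I 0, forall p q, I p -> I q -> I (p + q) & forall p q, I q -> I (p * q)].

(** The generated ideal as an intersection, so that a property of all its members is proved by
    exhibiting an ideal. *)
Definition ideal_hull (R : comNzRingType) (s : seq R) (p : R) :=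
  forall J, ring_ideal J -> (forall x, x \in s -> J x) -> J p.

Definition noetherian (R : comNzRingType) :=
  forall I : R -> Prop, ring_ideal I ->
  exists2 s, (forall x, x \in s -> I x) & forall p, I p -> ideal_hull s p.

Section Ideals.
Variable R : comNzRingType.
Implicit Types (I J : R -> Prop) (s : seq R).

Lemma ring_idealN I p : ring_ideal I -> I p -> I (- p).
Proof. by case=> _ _ hM hp; rewrite -mulN1r; apply: hM. Qed.

Lemma ring_idealB I p q : ring_ideal I -> I p -> I q -> I (p - q).
Proof. by move=> hI hp hq; have [_ hD _] := hI; apply: hD => //; apply: ring_idealN. Qed.

Lemma ring_ideal_sum I (T : Type) (r : seq T) (P : pred T) (f : T -> R) :
  ring_ideal I -> (forall i, P i -> I (f i)) -> I (\sum_(i <- r | P i) f i).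
Proof. by case=> h0 hD _ hf; elim/big_ind: _. Qed.

Lemma ideal_hull_ideal s : ring_ideal (ideal_hull s).
Proof.
split=> [J [h0 _ _] _ //|p q hp hq J hJ hs|p q hq J hJ hs].
  by have [_ hD _] := hJ; apply: hD; [apply: hp|apply: hq].
by have [_ _ hM] := hJ; apply: hM; apply: hq.
Qed.

Lemma mem_ideal_hull s x : x \in s -> ideal_hull s x.
Proof. by move=> hx J _; apply. Qed.

Lemma ideal_hullS s s' p : {subset s <= s'} -> ideal_hull s p -> ideal_hull s' p.
Proof. by move=> h hp; apply: hp (ideal_hull_ideal _) _ => x /h /mem_ideal_hull. Qed.

(* Passing to the union of a chain of ideals only uses finitely many of them. *)
Lemma chain_bound (L : nat -> R -> Prop) s :
  (forall i x, L i x -> L i.+1 x) -> (forall x, x \in s -> exists i, L i x) ->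
  exists N, forall x, x \in s -> L N x.
Proof.
move=> hL; have hL' i j x : (i <= j)%N -> L i x -> L j x.
  by move=> /subnKC <-; elim: (j - i)%N => [|m IH] h; rewrite ?addn0 // addnS; apply: hL; auto.
elim: s => [|x s IH] hs; first by exists 0.
have [N hN] : exists N, forall x, x \in s -> L N x.
  by apply: IH => y hy; apply: hs; rewrite inE hy orbT.
have [i hi] := hs x (mem_head _ _).
exists (maxn i N) => y; rewrite inE => /orP [/eqP ->|/hN hy].
  by apply: hL' hi; apply: leq_maxl.
by apply: hL' hy; apply: leq_maxr.
Qed.

Lemma chain_union (L : nat -> R -> Prop) :
  (forall i x, L i x -> L i.+1 x) -> (forall i, ring_ideal (L i)) ->
  ring_ideal (fun x => exists i, L i x).
Proof.
move=> hL hI; have hL' i j x : (i <= j)%N -> L i x -> L j x.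
  by move=> /subnKC <-; elim: (j - i)%N => [|m IH] h; rewrite ?addn0 // addnS; apply: hL; auto.
split=> [|p q [i hi] [j hj]|p q [i hi]].
- by exists 0; have [] := hI 0.
- exists (maxn i j); have [_ hD _] := hI (maxn i j).
  by apply: hD; [apply: hL' hi; apply: leq_maxl|apply: hL' hj; apply: leq_maxr].
- by exists i; have [_ _ hM] := hI i; apply: hM.
Qed.

(** Without a maximal element, choice produces a strictly increasing sequence of ideals, whose union
    is finitely generated and so equals one of its terms. *)
Lemma maximal_ideal (Phi : (R -> Prop) -> Prop) I : noetherian R ->
  ring_ideal I -> Phi I ->
  exists J, [/\ ring_ideal J, Phi J, forall p, I p -> J p &
    forall J', ring_ideal J' -> Phi J' -> (forall p, J p -> J' p) ->
      forall p, J' p -> J p].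
Proof.
move=> hR hI hPhi; apply: NNPP => hn.
pose Good J := [/\ ring_ideal J, Phi J & forall p, I p -> J p].
pose T := {J | Good J}.
have step (J : T) : exists J' : T, (forall p, sval J p -> sval J' p) /\ exists p, sval J' p /\ ~ sval J p.
  case: J => J [h1 h2 h3]; apply: NNPP => hn'; apply: hn; exists J; split=> //.
  move=> J' h1' h2' sub p hp; apply: NNPP => hnp; apply: hn'.
  have hG : Good J' by split=> // q hq; apply: sub; apply: h3.
  by exists (exist _ J' hG); split=> //; exists p.
have [f hf] := choice _ step.
have hI0 : Good I by [].
pose L i := sval (iter i f (exist _ I hI0)).
have hL i x : L i x -> L i.+1 x by apply: (hf _).1.
have hLI i : ring_ideal (L i) by rewrite /L; case: (iter _ _ _) => J [].
have [s hs hgen] := hR _ (chain_union hL hLI).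
have [N hN] := chain_bound hL hs.
have [p [hp hnp]] := (hf (iter N f (exist _ I hI0))).2.
apply: hnp; apply: (hgen p _ _ (hLI N) hN).
by exists N.+1.
Qed.

End Ideals.

Lemma noetherian_surj (A B : comNzRingType) (f : {rmorphism A -> B}) :
  (forall b, exists a, b = f a) -> noetherian A -> noetherian B.
Proof.
move=> hf hA I [h0 hD hM].
have [|s hs hgen] := hA (fun a => I (f a)).
  split=> [|p q hp hq|p q hq]; rewrite ?rmorph0 ?rmorphD ?rmorphM //; auto.
exists (map f s) => [x /mapP [a ha ->]|p hp]; first exact: hs.
have [a ea] := hf p; rewrite ea in hp *.
apply: (hgen _ hp (fun a => ideal_hull (map f s) (f a))) => [|x hx].
  have [h0' hD' hM'] := ideal_hull_ideal (map f s).
  by split=> [|p' q hp' hq|p' q hq]; rewrite ?rmorph0 ?rmorphD ?rmorphM //; auto.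
by apply: mem_ideal_hull; apply: map_f.
Qed.

Section HilbertBasis.
Variables (R : comNzRingType) (hR : noetherian R) (I : {poly R} -> Prop).
Hypothesis hI : ring_ideal I.

(** With J the whole ring these are the coefficients of X^d in the members of I of degree at most d;
    with J generated by a finite part of I, they are those which that part accounts for. The basis
    theorem compares the two. *)
Definition top_coefs (J : {poly R} -> Prop) (d : nat) (a : R) :=
  exists p, [/\ I p, J p, (size p <= d.+1)%N & p`_d = a].

Lemma top_coefs_ideal J d : ring_ideal J -> ring_ideal (top_coefs J d).
Proof.
move=> [j0 jD jM]; have [i0 iD iM] := hI.
split=> [|a b [p [h1 h1' h2 <-]] [q [h3 h3' h4 <-]]|a b [p [h1 h1' h2 <-]]].
- by exists 0; rewrite size_poly0 coef0.
- exists (p + q); split; [exact: iD|exact: jD| |exact: coefD].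
  by apply: leq_trans (size_polyD _ _) _; rewrite geq_max h2.
- exists (a%:P * p); split; [exact: iM|exact: jM| |by rewrite coefCM].
  by rewrite mul_polyC; apply: leq_trans (size_scale_leq _ _) h2.
Qed.

Lemma hilbert_basis_step :
  exists2 s, (forall x, x \in s -> I x) & forall p, I p -> ideal_hull s p.
Proof.
have [i0 iD iM] := hI.
have hT : ring_ideal (fun _ : {poly R} => True) by [].
pose L := top_coefs (fun=> True).
have hLI d : ring_ideal (L d) by exact: top_coefs_ideal.
have hL d a : L d a -> L d.+1 a.
  move=> [p [h1 _ h2 <-]]; exists ('X * p); split=> //; first exact: iM.
    by apply: leq_trans (size_polyMleq _ _) _; rewrite size_polyX.
  by rewrite coefXM.
have [sN hsN hgenN] := hR (chain_union hL hLI).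
have [N hN] := chain_bound hL hsN.
have ht d : exists t : seq {poly R}, (forall q, q \in t -> I q /\ (size q <= d.+1)%N) /\
    forall a, L d a -> ideal_hull [seq q`_d | q : {poly R} <- t] a.
  have [s hs hgen] := hR (hLI d).
  have [t [ht1 ht2]] : exists t : seq {poly R}, (forall q, q \in t -> I q /\ (size q <= d.+1)%N) /\
      {subset s <= [seq q`_d | q : {poly R} <- t]}.
    elim: s hs {hgen} => [|x s IH] hs; first by exists [::].
    have [t [ht1 ht2]] := IH (fun y hy => hs y (mem_behead (s := x :: s) hy)).
    have [p [h1 _ h2 h3]] := hs x (mem_head _ _).
    exists (p :: t); split=> [q|y]; rewrite inE => /orP [/eqP ->|] //.
    - exact: ht1.
    - by rewrite /= h3 inE eqxx.
    - by move=> /ht2 hy; rewrite /= inE hy orbT.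
  by exists t; split=> // a /hgen; apply: ideal_hullS.
have [t {}ht] := choice _ ht.
pose T := flatten [seq t d | d <- iota 0 N.+1].
have hT1 q : q \in T -> I q.
  by case/flatten_mapP=> d _ /(proj1 (ht d)) [].
exists T => //.
pose J := ideal_hull T.
have hJ : ring_ideal J by exact: ideal_hull_ideal.
have hLJ d a : (d <= N)%N -> L d a -> top_coefs J d a.
  move=> hd ha; apply: ((ht d).2 _ ha); first exact: top_coefs_ideal.
  move=> x /mapP [q hq ->]; have [h1 h2] := (ht d).1 q hq; exists q; split=> //.
  apply: mem_ideal_hull; apply/flatten_mapP; exists d => //.
  by rewrite mem_iota add0n ltnS.
have [j0 jD jM] := hJ.
have hLJ' d a : L d a -> top_coefs J d a.
  move=> ha; case: (leqP d N) => hd; first exact: hLJ.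
  (* The ideals [L d] are constant from N on, so this leading coefficient already occurs in degree
     N; a power of X restores the degree. *)
  have [r [h1 h2 h3 h4]] : top_coefs J N a.
    apply: (hgenN a); [by exists d|exact: top_coefs_ideal|].
    by move=> x /hN; apply: hLJ.
  exists ('X^(d - N) * r); split; [exact: iM|exact: jM| |].
    apply: leq_trans (size_polyMleq _ _) _; rewrite size_polyXn /=.
    by rewrite -[in leqRHS](subnK (ltnW hd)) -addnS leq_add2l.
  by rewrite coefXnM ltnNge leq_subr /= subKn // ltnW.
move=> p; move: {2}(size p) (leqnn (size p)) => m; elim: m p => [|m IH] p hm hp.
  by have -> : p = 0 by apply/eqP; rewrite -size_poly_leq0.
have [r [h1 h2 h3 h4]] : top_coefs J m (p`_m) by apply: hLJ'; exists p.
rewrite -(subrK r p); apply: (jD) => //; apply: IH; last exact: ring_idealB.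
apply/leq_sizeP => j hj; rewrite coefB.
move: hj; rewrite leq_eqVlt => /orP [/eqP <-|hj]; first by rewrite h4 subrr.
by rewrite !nth_default ?subrr //; apply: leq_trans hj.
Qed.
End HilbertBasis.

Lemma noetherian_poly (R : comNzRingType) : noetherian R -> noetherian {poly R}.
Proof. by move=> hR I hI; apply: hilbert_basis_step. Qed.

Lemma noetherian_field (k : fieldType) : noetherian k.
Proof.
move=> I [h0 hD hM]; case: (classic (exists2 x, I x & x != 0)) => [[x hx x0]|hn].
  exists [:: x] => [y|p hp]; first by rewrite inE => /eqP ->.
  have [_ _ hM'] := ideal_hull_ideal [:: x].
  by rewrite -(mulfVK x0 p); apply: hM'; apply: mem_ideal_hull; rewrite inE.
exists [::] => // p hp; have -> : p = 0.
  by apply/eqP; apply: contra_notT hn => p0; exists p.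
by have [] := ideal_hull_ideal ([::] : seq k).
Qed.

Definition mpoly_of_poly (k : fieldType) n :
    {rmorphism {poly {mpoly k[n]}} -> {mpoly k[n.+1]}} :=
  horner_eval ('X_ord_max : {mpoly k[n.+1]}) \o map_poly (@mwiden n k).

Lemma mpoly_of_poly_surj (k : fieldType) n (b : {mpoly k[n.+1]}) :
  exists a, b = mpoly_of_poly k n a.
Proof.
set f := mpoly_of_poly k n.
rewrite (mpolyE b); elim: (msupp b) => [|m s [a ha]].
  by exists 0; rewrite big_nil rmorph0.
rewrite big_cons ha.
suff [c ->] : exists c, b@_m *: 'X_[m] = f c by exists (c + a); rewrite rmorphD.
have [c ->] : exists c, 'X_[m] = f c; last first.
  exists ((b@_m)%:MP%:P * c); rewrite rmorphM /= map_polyC /horner_eval /= hornerC.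
  by rewrite mwidenC mul_mpolyC.
rewrite mpolyXE_id; elim/big_ind: _ => [|_ _ [u ->] [v ->]|i _].
- by exists 1; rewrite rmorph1.
- by exists (u * v); rewrite rmorphM.
have [c ->] : exists c, 'X_i = f c; last by exists (c ^+ m i); rewrite rmorphXn.
case: (unliftP ord_max i) => [j|] ->.
  exists ('X_j)%:P; rewrite /f /= map_polyC /horner_eval hornerC /= mwidenX.
  rewrite mnmwiden1.
  by have -> : lift ord_max j = widen_ord (leqnSn n) j
    by apply/val_inj; rewrite /= /bump leqNgt ltn_ord.
by exists 'X; rewrite /f /= map_polyX /horner_eval hornerX.
Qed.

Lemma noetherian_mpoly (k : fieldType) n : noetherian {mpoly k[n]}.
Proof.
elim: n => [|n IH].
  apply: (noetherian_surj (f := @mpolyC 0 k)) (@noetherian_field k).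
  by move=> b; exists (b@_0%MM); apply: nvar0_mpolyC.
apply: (noetherian_surj (f := mpoly_of_poly k n)) (noetherian_poly IH).
exact: mpoly_of_poly_surj.
Qed.

(** * Homogeneous ideals and points of Proj *)

Lemma mpoly_rmorph_eq (k : fieldType) n (S : comNzRingType)
    (f g : {rmorphism {mpoly k[n]} -> S}) :
  (forall c, f c%:MP = g c%:MP) -> (forall i, f 'X_i = g 'X_i) -> forall p, f p = g p.
Proof.
move=> hC hX p; rewrite (mpolyE p) !rmorph_sum; apply: eq_bigr => m _.
rewrite -mul_mpolyC !rmorphM /= hC mpolyXE_id !rmorph_prod; congr (_ * _).
by apply: eq_bigr => i _; rewrite !rmorphXn /= hX.
Qed.

Section Evaluation.
Variables (k : fieldType) (n : nat).
Implicit Types (p q : {mpoly k[n]}).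

Lemma rmorph_mmap (S : comNzRingType) (f : {rmorphism {mpoly k[n]} -> S}) p :
  f p = mmap (f \o @mpolyC n k) (fun i => f 'X_i) p.
Proof.
apply: (mpoly_rmorph_eq (g := mmap (f \o @mpolyC n k) (fun i => f 'X_i))) => [c|i].
  by rewrite /= mmapC.
by rewrite /= mmapX mmap1U.
Qed.

Lemma rmorph_mmap_comp (S T : comNzRingType) (iota : {rmorphism k -> S})
    (j : {rmorphism S -> T}) x p :
  j (mmap iota x p) = mmap (j \o iota) (j \o x) p.
Proof.
apply: (mpoly_rmorph_eq (f := j \o mmap iota x) (g := mmap (j \o iota) (j \o x))) => [c|i] /=.
  by rewrite !mmapC.
by rewrite !mmapX !mmap1U.
Qed.

Lemma eq_mmap (S : comNzRingType) (f g : k -> S) (x y : 'I_n -> S) p :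
  f =1 g -> x =1 y -> mmap f x p = mmap g y p.
Proof.
move=> fg xy; rewrite /mmap; apply: eq_bigr => m _; rewrite fg; congr (_ * _).
by apply: eq_bigr => i _; rewrite xy.
Qed.

Lemma mcoeff_pihomog d p m : (pihomog mdeg d p)@_m = if mdeg m == d then p@_m else 0.
Proof.
rewrite /pihomog big_mkcond raddf_sum /=.
have e m' : mcoeff m (if mdeg m' == d then p@_m' *: 'X_[m'] else 0) =
    if m' == m then if mdeg m == d then p@_m else 0 else 0.
  case: (eqVneq m' m) => [->|ne]; case: ifP; rewrite ?mcoeff0 // mcoeffZ mcoeffX.
    by rewrite eqxx mulr1.
  by rewrite (negbTE ne) mulr0.
under eq_bigr do rewrite e.
case: (boolP (m \in msupp p)) => hm.
  rewrite (bigD1_seq m) ?msupp_uniq //= eqxx big1 ?addr0 // => i /negbTE ->.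
  by [].
rewrite big_seq big1 => [|i hi]; first by rewrite (memN_msupp_eq0 hm); case: ifP.
by case: eqP => // im; rewrite -im hi in hm.
Qed.

Lemma pihomogM d e p q : q \is e.-homog ->
  pihomog mdeg (d + e)%N (p * q) = pihomog mdeg d p * q.
Proof.
move=> hq; rewrite {1}(pihomog_partitionE (k := maxn (msize p) d.+1) (mf := mdeg) (p := p)) ?leq_maxl //.
rewrite mulr_suml raddf_sum /= (bigD1 (Ordinal (leq_maxr (msize p) d.+1))) //=.
rewrite big1 ?addr0 => [|i hi].
  by rewrite pihomog_dE // dhomogM // pihomogP.
apply: (@pihomog_ne0 _ _ _ (i + e)%N); last by rewrite dhomogM // pihomogP.
by rewrite eqn_add2r; apply: contra_neq hi => e'; apply/val_inj.
Qed.

Lemma pihomogM_lt d e p q : q \is e.-homog -> (d < e)%N ->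
  pihomog mdeg d (p * q) = 0.
Proof.
move=> hq lt; rewrite (pihomog_partitionE (k := msize p) (mf := mdeg) (p := p)) //.
rewrite mulr_suml raddf_sum /= big1 // => i _.
apply: (@pihomog_ne0 _ _ _ (i + e)%N); last by rewrite dhomogM // pihomogP.
by rewrite gtn_eqF // (leq_trans lt) // leq_addl.
Qed.

Lemma mmap_scale (S : comNzRingType) (iota : {rmorphism k -> S}) (x : 'I_n -> S) c d p :
  p \is d.-homog -> mmap iota (fun i => c * x i) p = c ^+ d * mmap iota x p.
Proof.
move=> hp; rewrite /mmap mulr_sumr; apply: eq_big_seq => m hm.
rewrite mulrCA; congr (_ * _); rewrite /mmap1.
under eq_bigr do rewrite exprMn.
rewrite big_split /= -expr_sum -mdegE.
by rewrite (dhomog_mf hp hm).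
Qed.

Definition homogenize (i : 'I_n) d p : {mpoly k[n]} :=
  \sum_(e < d.+1) 'X_i ^+ (d - e)%N * pihomog mdeg e p.

Lemma homogenize_homog i d p : homogenize i d p \is d.-homog.
Proof.
apply: rpred_sum => e _.
have : ('X_i : {mpoly k[n]}) \is 1.-homog by rewrite dhomogX /= mdeg1.
move/(dhomogMn (d - e)%N); rewrite mul1n => h.
by have := dhomogM h (pihomogP mdeg e p); rewrite subnK // -ltnS.
Qed.

Lemma mmap_homogenize (S : comNzRingType) (iota : {rmorphism k -> S}) (x : 'I_n -> S) i d p :
  x i = 1 -> (msize p <= d.+1)%N -> mmap iota x (homogenize i d p) = mmap iota x p.
Proof.
move=> xi hd; rewrite [in RHS](pihomog_partitionE (k := d.+1) (mf := mdeg) (p := p)) //.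
rewrite !rmorph_sum /=; apply: eq_bigr => e _.
by rewrite rmorphM rmorphXn /= mmapX mmap1U xi expr1n mul1r.
Qed.

End Evaluation.

Section PointIdeal.
Variables (k F : fieldType) (iota : {rmorphism k -> F}) (n : nat) (x : 'I_n.+1 -> F).
Implicit Types (p q : {mpoly k[n.+1]}).

Definition point_ideal p := forall d, mmap iota x (pihomog mdeg d p) = 0.

(** Substituting x_j T for X_j puts the value of the component of degree d in front of T^d. Hence
    [point_ideal] is the kernel of a morphism to a domain, and so prime. *)
Definition cone_eval : {rmorphism {mpoly k[n.+1]} -> {poly F}} :=
  mmap (polyC \o iota) (fun i => (x i) *: 'X).

Lemma coef_cone_eval p d : (cone_eval p)`_d = mmap iota x (pihomog mdeg d p).
Proof.
elim/mpolyind: p => [|c m p _ _ IH]; first by rewrite rmorph0 coef0 pihomog0 mmap0.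
rewrite rmorphD coefD pihomogD mmapD IH; congr (_ + _).
rewrite linearZ /= !mmapZ mmapX pihomogX.
rewrite /mmap1; under eq_bigr do rewrite exprZn.
rewrite scaler_prod prodrXr -mdegE.
rewrite /= mul_polyC scalerA coefZ coefXn eq_sym.
by case: eqP => _; rewrite ?mulr1 ?mmapX // mmap0 !mulr0.
Qed.

Lemma point_idealP p : point_ideal p <-> cone_eval p = 0.
Proof.
split=> [h|h d]; last by rewrite -coef_cone_eval h coef0.
by apply/polyP => d; rewrite coef_cone_eval h coef0.
Qed.

Lemma point_ideal_homog d p : p \is d.-homog -> point_ideal p <-> mmap iota x p = 0.
Proof.
move=> hp; split=> [/(_ d)|h e]; first by rewrite pihomog_dE.
case: (eqVneq d e) => [<-|ne]; first by rewrite pihomog_dE.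
by rewrite (pihomog_ne0 ne hp) mmap0.
Qed.

Lemma point_ideal_prime : (exists i, x i != 0) -> proj_prime point_ideal.
Proof.
move=> [i xi]; split.
- split.
  + split=> [|p q /point_idealP hp /point_idealP hq|p q /point_idealP hq].
    * by apply/point_idealP; rewrite rmorph0.
    * by apply/point_idealP; rewrite rmorphD hp hq addr0.
    * by apply/point_idealP; rewrite rmorphM hq mulr0.
  + by move/point_idealP/eqP; rewrite rmorph1 oner_eq0.
  + move=> p q /point_idealP/eqP; rewrite rmorphM mulf_eq0 => /orP [] /eqP h;
    [left|right]; exact/point_idealP.
- move=> p d hp e; case: (eqVneq d e) => [<-|ne]; first by rewrite pihomog_id.
  by rewrite (pihomog_ne0 ne (pihomogP _ _ _)) mmap0.
- exists i => /(_ 1%N); rewrite pihomog_dE; last by rewrite dhomogX /= mdeg1.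
  by rewrite mmapX mmap1U; apply/eqP.
Qed.

End PointIdeal.

Lemma mpolyC_iota (k F : fieldType) n (phi : {rmorphism {mpoly k[n]} -> F}) :
  exists iota : {rmorphism k -> F}, forall p, phi p = mmap iota (fun i => phi 'X_i) p.
Proof. by exists (phi \o @mpolyC n k) => p; apply: rmorph_mmap. Qed.

(** The residue field F0 of Q is the function field of the affine cone and thus too large.
    Evaluation at the ratios X_j / X_i, followed by the residue field of its kernel, gives the
    residue field of the point itself, in which every element is a quotient of values. *)
Lemma proj_prime_point (k : fieldType) n (Q : {mpoly k[n.+1]} -> Prop) i :
  proj_prime Q -> ~ Q 'X_i ->
  exists (F : fieldType) (iota : {rmorphism k -> F}) (y : 'I_n.+1 -> F),
    [/\ y i = 1, forall p, Q p <-> point_ideal iota y p &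
      forall z, exists p q, mmap iota y q != 0 /\ z = mmap iota y p / mmap iota y q].
Proof.
move=> [[[Q0 QD QM] Q1 Qprime] Qhom _] hi.
have [F0 [phi0 [ker0 _]]] := prime_ideal_field Q0 QD QM Q1 Qprime.
have xi0 : phi0 'X_i != 0 by apply/eqP => /ker0.
have [iota0 phi0E] := mpolyC_iota phi0.
pose y0 j := phi0 'X_j / phi0 'X_i.
have yi : y0 i = 1 by rewrite /y0 divff.
pose P p := mmap iota0 y0 p = 0.
have hP p d : p \is d.-homog -> Q p <-> P p.
  move=> hp; rewrite -ker0 /P phi0E.
  have -> : mmap iota0 y0 p = (phi0 'X_i)^-1 ^+ d * mmap iota0 (fun j => phi0 'X_j) p.
    by rewrite -(mmap_scale _ _ _ hp); apply: eq_mmap => // j; rewrite mulrC.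
  split=> [->|/eqP]; first by rewrite mulr0.
  by rewrite mulf_eq0 expf_eq0 invr_eq0 (negbTE xi0) andbF => /eqP.
have [|||||F [phi [ker gen]]] := @prime_ideal_field _ P; rewrite /P ?mmap0 //.
- by move=> p q hp hq; rewrite mmapD hp hq addr0.
- by move=> p q hq; rewrite rmorphM /= hq mulr0.
- by move/eqP; rewrite rmorph1 oner_eq0.
- by move=> p q /eqP; rewrite rmorphM mulf_eq0 => /orP [] /eqP; auto.
have [iota phiE] := mpolyC_iota phi.
exists F, iota, (fun j => phi 'X_j); split.
- apply/eqP; rewrite -subr_eq0 -[1](rmorph1 phi) -rmorphB; apply/eqP/ker.
  by rewrite /P mmapB rmorph1 mmapX mmap1U yi subrr.
- move=> p; split=> [hp d|h].
    by rewrite -phiE; apply/ker/(hP _ d); [exact: pihomogP|apply: Qhom].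
  rewrite (pihomog_partitionE (k := msize p) (mf := mdeg) (p := p)) //.
  elim/big_ind: _ => // d _; apply/(hP _ d); first exact: pihomogP.
  by apply/ker; rewrite phiE; apply: h.
- move=> z; have [a [b [hb ->]]] := gen z; exists a, b; rewrite -!phiE.
  by split=> //; apply/eqP.
Qed.

Section HomogeneousIdeals.
Variables (k : fieldType) (n : nat).
Local Notation S := {mpoly k[n.+1]}.
Implicit Types (I J Q : S -> Prop) (p q a b : S).

Lemma ideal_submodule I : ring_ideal I -> submodule I.
Proof. by case=> h0 hD hM; split=> // c x hx; rewrite -mul_mpolyC; apply: hM. Qed.

Lemma pihomog_ge d p : (msize p <= d)%N -> pihomog mdeg d p = 0.
Proof.
move=> h; apply/mpolyP => m; rewrite mcoeff_pihomog mcoeff0; case: eqP => // e.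
by apply: memN_msupp_eq0; apply: msize_mdeg_ge; rewrite e.
Qed.

Lemma homog_X i : ('X_i : S) \is 1.-homog.
Proof. by rewrite dhomogX /= mdeg1. Qed.

Lemma homog_Xn i e : ('X_i ^+ e : S) \is e.-homog.
Proof. by have := dhomogMn e (homog_X i); rewrite mul1n. Qed.

Lemma homog_ind (P : S -> Prop) p : P 0 -> (forall x y, P x -> P y -> P (x + y)) ->
  (forall d, P (pihomog mdeg d p)) -> P p.
Proof.
move=> h0 hD hp; rewrite (pihomog_partitionE (k := msize p) (mf := mdeg) (p := p)) //.
by elim/big_ind: _.
Qed.

Definition adjoin Q a p := exists r, Q (p - r * a).

Lemma adjoin_ideal Q a : ring_ideal Q -> ring_ideal (adjoin Q a).
Proof.
move=> [Q0 QD QM]; split=> [|p q [r hr] [s hs]|p q [s hs]].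
- by exists 0; rewrite mul0r subr0.
- exists (r + s); have -> : p + q - (r + s) * a = (p - r * a) + (q - s * a) by ring.
  exact: QD.
- by exists (p * s); rewrite -mulrA -mulrBr; apply: QM.
Qed.

Lemma adjoin_mem Q a : ring_ideal Q -> adjoin Q a a.
Proof. by case=> Q0 _ _; exists 1; rewrite mul1r subrr. Qed.

Lemma adjoin_sub Q a p : Q p -> adjoin Q a p.
Proof. by exists 0; rewrite mul0r subr0. Qed.

Lemma adjoin_component Q a e d p : is_homog_ideal Q -> a \is e.-homog ->
  p \is d.-homog -> adjoin Q a p ->
  (d < e)%N /\ Q p \/ exists2 r, r \is (d - e)%N.-homog & (e <= d)%N /\ Q (p - r * a).
Proof.
move=> hQ ha hp [r hr]; have := hQ _ d hr; rewrite raddfB /= (pihomog_dE hp).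
case: (ltnP d e) => hd; first by rewrite (pihomogM_lt _ ha hd) subr0; left.
rewrite -[X in pihomog mdeg X (r * a)](subnK hd) (pihomogM _ _ ha) => h; right.
by exists (pihomog mdeg (d - e)%N r); first exact: pihomogP.
Qed.

Lemma adjoin_homog Q a e : ring_ideal Q -> is_homog_ideal Q -> a \is e.-homog ->
  is_homog_ideal (adjoin Q a).
Proof.
move=> [Q0 _ _] hQ ha p d [r hr]; have := hQ _ d hr; rewrite raddfB /=.
case: (ltnP d e) => hd.
  by rewrite (pihomogM_lt _ ha hd) => h; exists 0; rewrite mul0r.
rewrite -[X in pihomog mdeg X (r * a)](subnK hd) (pihomogM _ _ ha) => h.
by exists (pihomog mdeg (d - e)%N r).
Qed.

(** Induction on the sizes: a top component that lies in Q can be removed; if neither does, their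
    product is the top component of p q, which lies in Q. *)
Lemma homog_prime Q : ring_ideal Q -> is_homog_ideal Q ->
  (forall a b d e, a \is d.-homog -> b \is e.-homog -> Q (a * b) -> Q a \/ Q b) ->
  forall p q, Q (p * q) -> Q p \/ Q q.
Proof.
move=> hI hQ hprime p q; have [Q0 QD QM] := hI.
have [m hm] := ubnP (msize p + msize q); elim: m p q hm => // m IH p q hm hpq.
case: (eqVneq p 0) => [->|p0]; first by left.
case: (eqVneq q 0) => [->|q0]; first by right.
have ep := mpolySpred mdeg p0; have eq := mpolySpred mdeg q0.
set d := (msize p).-1 in ep; set e := (msize q).-1 in eq.
have lt (x : S) c : msize x = c.+1 -> (msize (x - pihomog mdeg c x) <= c)%N.
  move=> hx; apply/bigmax_leqP_seq => mm hmm _; rewrite ltnNge; apply/negP => hc.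
  move: hmm; rewrite mcoeff_msupp mcoeffB mcoeff_pihomog.
  case: (mdeg mm =P c) => [_|ne]; first by rewrite subrr eqxx.
  rewrite subr0 -mcoeff_msupp => /msize_mdeg_lt; rewrite hx ltnS => h.
  by case: ne; apply/eqP; rewrite eqn_leq h.
case: (classic (Q (pihomog mdeg d p))) => hp.
  have [||h|h] := IH (p - pihomog mdeg d p) q; last by right.
  - by have := lt _ _ ep; lia.
  - by rewrite mulrBl; apply: ring_idealB => //; rewrite mulrC; apply: QM.
  - by left; rewrite -(subrK (pihomog mdeg d p) p); apply: QD.
case: (classic (Q (pihomog mdeg e q))) => hq.
  have [||h|h] := IH p (q - pihomog mdeg e q); first 1 last.
  - by rewrite mulrBr; apply: ring_idealB => //; apply: QM.
  - by left.
  - by right; rewrite -(subrK (pihomog mdeg e q) q); apply: QD.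
  - by have := lt _ _ eq; lia.
case: (hprime _ _ d e (pihomogP _ _ p) (pihomogP _ _ q)) => //.
have := hQ _ (d + e)%N hpq.
rewrite -{1}(subrK (pihomog mdeg e q) q) mulrDr raddfD /=.
rewrite (pihomogM d p (pihomogP mdeg e q)).
rewrite [pihomog _ _ (p * (q - _))]pihomog_ge ?add0r //.
case: (eqVneq (q - pihomog mdeg e q) 0) => [->|r0]; first by rewrite mulr0 mmeasure0.
by rewrite msizeM // ep addSn leq_add2l; apply: lt.
Qed.

Lemma irrelevant_sub J d0 : ring_ideal J ->
  (forall p, p \is d0.-homog -> J p) -> forall d p, (d0 <= d)%N -> p \is d.-homog -> J p.
Proof.
move=> hJ h d; have [J0 JD JM] := hJ.
move=> p /subnKC <-; elim: (d - d0)%N p => {d} [|c IH] p hp.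
  by apply: h; rewrite addn0 in hp.
rewrite (mpolyE p) big_seq; apply: ring_ideal_sum => // m hm.
have dm := dhomog_mf hp hm.
have [i hi] : exists i, (0 < m i)%N.
  apply: NNPP => hn; have : mdeg m = 0%N; last by rewrite dm; lia.
  rewrite mdegE big1 // => i _; apply/eqP; rewrite -leqn0 leqNgt.
  by apply/negP => hi; apply: hn; exists i.
have um : (U_(i) <= m)%MM by rewrite lep1mP -lt0n.
rewrite -(submK um) mpolyXD scalerAl mulrC; apply: (JM); rewrite -mul_mpolyC; apply: (JM).
apply: IH; rewrite dhomogX /=; apply/eqP.
have := congr1 mdeg (submK um); rewrite mdegD mdeg1 dm; lia.
Qed.

Lemma all_vars_sub J d p : ring_ideal J -> (forall i, J 'X_i) -> (0 < d)%N ->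
  p \is d.-homog -> J p.
Proof.
move=> hJ hX; apply: (@irrelevant_sub J 1 hJ) => q hq.
rewrite (mpolyE q) big_seq; apply: ring_ideal_sum => // m hm.
have /eqP/mdeg1P [i /eqP ->] := dhomog_mf hq hm.
by have [_ _ JM] := hJ; rewrite -mul_mpolyC; apply: JM.
Qed.

Section Maximal.
Variable small : (S -> Prop) -> Prop.
Hypotheses
  (small_irrelevant : forall J, ring_ideal J -> (forall i, J 'X_i) -> small J)
  (small_prod : forall Q a b d e, ring_ideal Q -> is_homog_ideal Q ->
     a \is d.-homog -> b \is e.-homog -> Q (a * b) ->
     small (adjoin Q a) -> small (adjoin Q b) -> small Q).

(** An ideal maximal among the homogeneous ideals that are not small is prime, because Q + (a) and Q
    + (b) are small for forms a and b outside Q. Being small will mean having no point, and then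
    having a bounded Hilbert function. *)
Lemma large_homog_prime J : ring_ideal J -> is_homog_ideal J -> ~ small J ->
  exists Q, [/\ proj_prime Q, forall p, J p -> Q p & ~ small Q].
Proof.
move=> hJ hJh hns.
have [Q [hQ [hQh hQs] sub hmax]] :=
  @maximal_ideal _ (fun Q => is_homog_ideal Q /\ ~ small Q) J
    (@noetherian_mpoly k n.+1) hJ (conj hJh hns).
have [Q0 QD QM] := hQ.
exists Q; split=> //; split=> //.
- split=> //.
    by move=> Q1; apply: hQs; apply: small_irrelevant => // i; rewrite -['X_i]mulr1; apply: QM.
  apply: homog_prime => // a b d e ha hb hab.
  apply: NNPP => hn2; have [na nb] := not_or_and _ _ hn2; apply: (hQs).
  have sm c f : c \is f.-homog -> ~ Q c -> small (adjoin Q c).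
    move=> hc nc; apply: NNPP => ns; apply: nc; apply: (hmax (adjoin Q c)).
    - exact: adjoin_ideal.
    - by split=> //; apply: adjoin_homog hc.
    - by move=> p; apply: adjoin_sub.
    - exact: adjoin_mem.
  exact: (small_prod hQ hQh ha hb hab (sm _ _ ha na) (sm _ _ hb nb)).
- apply: NNPP => hn; apply: hQs; apply: small_irrelevant => // i.
  by apply: NNPP => hi; apply: hn; exists i.
Qed.
End Maximal.

(** By [irrelevant_sub] all forms of larger degree lie in J too: V_+(J) is empty. *)
Definition negligible J := exists d, forall p, p \is d.-homog -> J p.

(** A form of large degree is r a modulo Q, then r is s b modulo Q, and a b lies in Q; hence Q is
    negligible as soon as Q + (a) and Q + (b) are. *)
Lemma exists_proj_prime J : ring_ideal J -> is_homog_ideal J -> ~ negligible J ->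
  exists Q, proj_prime Q /\ forall p, J p -> Q p.
Proof.
move=> hJ hJh hn; have [||Q [h1 h2 _]] := large_homog_prime _ _ hJ hJh hn; last by exists Q.
- by move=> J' hJ' hX; exists 1%N => p hp; apply: all_vars_sub hp.
- move=> Q a b d e hQ hQh ha hb hab [d1 h1] [d2 h2]; have [Q0 QD QM] := hQ.
  exists (maxn d1 (d2 + d)) => p hp.
  have : adjoin Q a p.
    by apply: (irrelevant_sub (adjoin_ideal a hQ) h1 (leq_maxl _ _) hp).
  case/(adjoin_component hQh ha hp) => [[]|[r hr [hd hra]]]; first by lia.
  have [|s hs] := irrelevant_sub (adjoin_ideal b hQ) h2 _ hr; first by lia.
  rewrite -(subrK (r * a) p); apply: (QD) => //.
  have -> : r * a = a * (r - s * b) + s * (a * b) by ring.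
  by apply: (QD); apply: (QM).
Qed.

Definition bounded J := exists c d0, forall d, (d0 <= d)%N ->
  exists (T : finType) (g : T -> S), [/\ (#|T| <= c)%N, forall t, g t \is d.-homog &
    forall p, p \is d.-homog -> spanned J g p].

(** When a b lies in Q, multiplication by a maps S/(Q + (b)) onto the kernel of S/Q -> S/(Q + (a)),
    so the two bounds add up, with a shift by the degree of a. *)
Lemma exists_unbounded_prime J : ring_ideal J -> is_homog_ideal J -> ~ bounded J ->
  exists Q, [/\ proj_prime Q, forall p, J p -> Q p & ~ bounded Q].
Proof.
apply: large_homog_prime => [J' hJ' hX|Q a b i j hQ hQh ha hb hab].
  exists 0%N, 1%N => d hd; exists void, (fun=> 0); split; [by rewrite card_void|by case|].
  move=> p hp; exists (fun=> 0); rewrite big1 ?subr0; last by case.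
  exact: all_vars_sub hp.
move=> [c1 [d1 h1]] [c2 [d2 h2]]; have [Q0 QD QM] := hQ.
exists (c1 + c2)%N, (maxn d1 (d2 + i)) => d hd.
have [|T1 [g1 [hc1 hg1 sp1]]] := h1 d; first by lia.
have [|T2 [g2 [hc2 hg2 sp2]]] := h2 (d - i)%N; first by lia.
exists (T1 + T2)%type, (sumfun g1 (fun t => a * g2 t)); split.
- by rewrite card_sum leq_add.
- case=> t //=; have -> : d = (i + (d - i))%N by lia.
  exact: dhomogM.
move=> p hp; have [x hx] := sp1 p hp.
set p1 := p - _ in hx; have hp1 : p1 \is d.-homog.
  by apply: rpredB => //; apply: rpred_sum => t _; apply: rpredZ.
case: (adjoin_component hQh ha hp1 hx) => [[]|[r hr [_ hra]]]; first by lia.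
have [y [s hs]] := sp2 r hr.
exists (fun t => match t with inl t => x t | inr t => y t end).
rewrite big_sumType /= opprD addrA -/p1.
have -> : \sum_i y i *: (a * g2 i) = a * \sum_i y i *: g2 i.
  by rewrite mulr_sumr; apply: eq_bigr => t _; rewrite scalerAr.
rewrite -(subrK (r * a) p1) -addrA; apply: (QD) => //.
set z := \sum_i _ in hs *.
have -> : r * a - a * z = a * (r - z - s * b) + s * (a * b) by ring.
by apply: (QD); apply: (QM).
Qed.

(** If X_i has no zero on V_+(Q), every form of degree above d0 is a multiple of X_i modulo Q, and
    X_i^(d - d0) times the monomials of degree d0 span degree d. The index type also contains
    monomials of smaller degree, which are sent to 0. *)
Lemma bounded_of_adjoin Q i : proj_prime Q -> negligible (adjoin Q 'X_i) -> bounded Q.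
Proof.
move=> [[hQ Q1 _] hQh _] [d0 hd0]; have [Q0 QD QM] := hQ.
exists #|{: 'X_{1..n.+1 < d0.+1}}|, d0 => d hd.
exists 'X_{1..n.+1 < d0.+1},
  (fun m : 'X_{1..n.+1 < d0.+1} => (if mdeg m == d0 then 'X_i ^+ (d - d0) * 'X_[m] else 0) : S).
split=> // [m|].
  case: eqP => [e|_]; last exact: rpred0.
  have hm : ('X_[m] : S) \is d0.-homog by rewrite dhomogX /= e.
  by have := dhomogM (homog_Xn i (d - d0)) hm; rewrite subnK.
rewrite -{1}(subnK hd); elim: (d - d0)%N => {d hd} [|c IH] p hp.
  rewrite add0n in hp; exists (fun m : 'X_{1..n.+1 < d0.+1} => p@_m); rewrite {1}(mpolywE (k := d0.+1) (p := p)).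
    rewrite -sumrB; apply: (@ring_ideal_sum S Q _ _ _ _ hQ) => m _; case: (mdeg m =P d0) => h.
      by rewrite mul1r subrr.
    by rewrite (dhomog_nemf_coeff hp) ?scale0r ?subrr //; apply/eqP.
  by apply/bigmax_leqP_seq => m hm _; rewrite (dhomog_mf hp hm).
have ap : adjoin Q 'X_i p.
  by apply: (irrelevant_sub (adjoin_ideal _ hQ) hd0 _ hp); lia.
case: (adjoin_component hQh (homog_X i) hp ap) => [[h hq]|[r hr [_ hra]]]; first by lia.
have [|x hx] := IH r; first by rewrite addSn subn1 in hr.
exists x; have -> : \sum_(m : 'X_{1..n.+1 < d0.+1}) x m *: (if mdeg m == d0 then 'X_i ^+ c.+1 * 'X_[m] else 0)
   = 'X_i * \sum_(m : 'X_{1..n.+1 < d0.+1}) x m *: (if mdeg m == d0 then 'X_i ^+ c * 'X_[m] else 0).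
  rewrite mulr_sumr; apply: eq_bigr => m _; case: eqP => _; last by rewrite !scaler0 mulr0.
  by rewrite -scalerAr mulrA -exprS.
rewrite -(subrK (r * 'X_i) p) -addrA; apply: (QD) => //.
by rewrite mulrC -mulrBr; apply: QM.
Qed.

Lemma indep_mul I (T : finType) (f : T -> S) a : is_prime I -> ~ I a ->
  indep I f -> indep I (fun t => a * f t).
Proof.
move=> [hI _ hprime] na hf c hc; apply: hf.
have [] // := hprime a (\sum_i c i *: f i).
by rewrite mulr_sumr; under eq_bigr do rewrite -scalerAr.
Qed.

Lemma prime_expr I a e : is_prime I -> ~ I a -> ~ I (a ^+ e).
Proof.
move=> [_ h1 hp] na; elim: e => [|e IH]; first by rewrite expr0.
by rewrite exprS => /hp [].
Qed.

Definition graded_basis I d h (b : 'I_h -> S) :=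
  [/\ forall i, b i \is d.-homog, indep I b & forall p, p \is d.-homog -> spanned I b p].

Lemma hilbert_fun_basis I d h : ring_ideal I -> hilbert_fun I d h ->
  exists b : 'I_h -> S, graded_basis I d b.
Proof.
move=> hI [U [hU ->]]; have [I0 ID IM] := hI; rewrite -dimv_compl.
exists (fun i => val (tnth (vbasis U^C) i)); split=> [i|c|p hp].
- exact: dhomog_is_dhomog.
- set v := \sum_i c i *: tnth (vbasis U^C) i.
  have -> : \sum_i c i *: val (tnth (vbasis U^C) i) = val v.
    by rewrite raddf_sum; apply: eq_bigr => i _.
  move/hU => vU; have vC : v \in U^C%VS.
    by apply: rpred_sum => i _; apply: rpredZ; apply: vbasis_mem; apply: mem_tnth.
  have : v \in (U :&: U^C)%VS by rewrite memv_cap vU.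
  rewrite capv_compl memv0 /v => /eqP v0 i.
  have /freeP := basis_free (vbasisP U^C); apply.
  by rewrite -[RHS]v0; apply: eq_bigr => j _; rewrite (tnth_nth 0).
- have : DHomog hp \in (U + U^C)%VS by rewrite addv_complf memvf.
  case/memv_addP => u hu [v hv e].
  exists (fun i => coord (vbasis U^C) i v).
  have ev : val v = \sum_i coord (vbasis U^C) i v *: val (tnth (vbasis U^C) i).
    rewrite {1}(coord_vbasis hv) raddf_sum /=; apply: eq_bigr => j _.
    by rewrite (tnth_nth 0).
  rewrite -ev -[p]/(val (DHomog hp)) e raddfD addrK; exact/hU.
Qed.

End HomogeneousIdeals.

(** * Hilbert functions of curves of genus 0 *)

Lemma poly_bounded_const (q : {poly rat}) (c N : nat) :
  (forall d, (N <= d)%N -> exists2 v, (v <= c)%N & q.[d%:R] = v%:R) ->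
  exists v : nat, q = v%:R%:P.
Proof.
move=> h.
pose P := \prod_(v < c.+1) (q - (v : nat)%:R%:P).
have hP : P = 0.
  apply: contraTeq isT => P0.
  pose s := [seq (N + i)%:R : rat | i <- iota 0 (size P)].
  have := @max_poly_roots _ P s P0; rewrite size_map size_iota ltnn; apply.
    apply/allP => x /mapP [i _ ->].
    have [v hv e] := h (N + i)%N (leq_addr _ _).
    rewrite /root horner_prod; apply/prodf_eq0; exists (Ordinal (hv : v < c.+1)%N) => //.
    by rewrite hornerD hornerN hornerC e subrr.
  rewrite map_inj_uniq ?iota_uniq // => i j /eqP; rewrite eqr_nat => /eqP; lia.
have /eqP/prodf_eq0 [v _ /eqP e] := hP; exists v.
by apply/eqP; rewrite -subr_eq0 e.
Qed.

(** The first difference of [hp] takes finitely many values at large integers, so it is a constant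
    D, and hp = D X + 1 because hp(0) = 1. *)
Lemma bounded_increments (hp : {poly rat}) (h : nat -> nat) (c N : nat) : hp.[0] = 1 ->
  (forall d, (N <= d)%N -> hp.[d%:R] = (h d)%:R) ->
  (forall d, (N <= d)%N -> (h d <= h d.+1 <= h d + c)%N) ->
  exists D, forall d, (N <= d)%N -> h d = (D * d + 1)%N.
Proof.
move=> h0 hh hc; pose q := hp \Po ('X + 1) - hp.
have qE x : q.[x] = hp.[x + 1] - hp.[x].
  by rewrite hornerD hornerN horner_comp hornerD hornerX hornerE.
have [|D hD] := @poly_bounded_const q c N.
  move=> d hd; have /andP [h1 h2] := hc d hd; exists (h d.+1 - h d)%N; first by lia.
  by rewrite qE natr1 hh ?hh ?natrB //; lia.
exists D => d hd; apply/eqP; rewrite -(eqr_nat rat) -hh //.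
elim: d {hd} => [|d IH]; first by rewrite h0 muln0.
have := qE d%:R; rewrite hD hornerC natr1 => e.
have -> : hp.[d.+1%:R] = D%:R + hp.[d%:R] by rewrite e subrK.
by rewrite (eqP IH) -natrD eqr_nat; lia.
Qed.

Section HilbertPolynomial.
Variables (k : fieldType) (n : nat).
Local Notation S := {mpoly k[n.+1]}.
Variables (I : S -> Prop) (hI : proj_prime I) (hdim : has_proj_dim I 1).

(** Otherwise some prime Q above I + (X_i) has an unbounded Hilbert function, so a further prime
    lies above Q: a chain of length 2 starting at I. *)
Lemma prime_bounded_adjoin i : ~ I 'X_i -> bounded (adjoin I 'X_i).
Proof.
move=> hi; have [[hid I1 _] hIh _] := hI; apply: NNPP => nb.
have [Q [hQ sub nbQ]] := exists_unbounded_prime (adjoin_ideal _ hid)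
  (adjoin_homog hid hIh (homog_X k i)) nb.
have [[hQi _ _] hQh [j hj]] := hQ.
have [|Q' [hQ' sub']] := exists_proj_prime (adjoin_ideal 'X_j hQi)
  (adjoin_homog hQi hQh (homog_X k j)).
  by move=> hn; apply: nbQ; apply: bounded_of_adjoin hn.
apply: (hdim.2); exists Q; split=> //.
  split=> [p hp|]; first by apply: sub; apply: adjoin_sub.
  by exists 'X_i; split=> //; apply: sub; apply: adjoin_mem.
exists Q'; split=> //; split=> [p hp|]; first by apply: sub'; apply: adjoin_sub.
by exists 'X_j; split=> //; apply: sub'; apply: adjoin_mem.
Qed.

Lemma homog_not_mem (Q : S -> Prop) p : ring_ideal Q -> ~ Q p -> exists d, ~ Q (pihomog mdeg d p).
Proof.
move=> [Q0 QD QM] hp; apply: NNPP => hn; apply: hp; apply: homog_ind => // d.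
by apply: NNPP => hd; apply: hn; exists d.
Qed.

(** This excludes D = 0. The two forms are X_j^d0 p and X_j^(d0 + e), with p in Q but not in I and
    X_j outside Q: the second is nonzero modulo Q, the first lies in Q and is nonzero modulo I. *)
Lemma proj_chain_indep d0 : exists d (f : 'I_2 -> S), [/\ (d0 <= d)%N,
  forall i, f i \is d.-homog & indep I f].
Proof.
have [Q [[[hQ Q1 Qp] hQh [j hj]] [sub [p [hp np]]] _]] := hdim.1.
have [[hid I1 Ip] hIh _] := hI.
have [e he] := homog_not_mem hid np.
have [I0 ID IM] := hid.
exists (d0 + e)%N, (fun i : 'I_2 => if i == 0 then 'X_j ^+ d0 * pihomog mdeg e p else 'X_j ^+ (d0 + e)).
split; first exact: leq_addr.
  move=> i; case: ifP => _; last exact: homog_Xn.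
  by apply: dhomogM; [exact: homog_Xn|exact: pihomogP].
have primeI : is_prime I by split.
have primeQ : is_prime Q by split.
move=> c; rewrite big_ord_recl big_ord1 /= => hc.
have [Q0 QD QM] := hQ.
have c1 : c (lift ord0 ord0) = 0.
  have hne := @prime_expr _ _ _ _ (d0 + e) primeQ hj.
  apply/eqP; apply: contra_notT hne => c1.
  have -> : 'X_j ^+ (d0 + e) = (c (lift ord0 ord0))^-1 *: (c (lift ord0 ord0) *: 'X_j ^+ (d0 + e)) :> S.
    by rewrite scalerA mulVf // scale1r.
  rewrite -mul_mpolyC; apply: (QM).
  move/sub: hc; set u := c ord0 *: _; move=> h.
  rewrite -[X in Q X](addKr u); apply: QD => //.
  apply: ring_idealN => //; rewrite /u -mul_mpolyC; apply: (QM); apply: (QM).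
  exact: hQh.
have c0 : c ord0 = 0.
  apply/eqP; apply: contra_notT he => c0.
  have h : I ('X_j ^+ d0 * pihomog mdeg e p).
    have -> : 'X_j ^+ d0 * pihomog mdeg e p = (c ord0)^-1 *: (c ord0 *: ('X_j ^+ d0 * pihomog mdeg e p)).
      by rewrite scalerA mulVf // scale1r.
    by rewrite -mul_mpolyC; apply: (IM); move: hc; rewrite c1 scale0r addr0.
  have [] // := Ip _ _ h => hx; case: (@prime_expr _ _ _ _ d0 primeI _ hx) => /sub.
  exact: hj.
by move=> i; case: (unliftP ord0 i) => [i'|] -> //; rewrite (ord1 i').
Qed.

(** Multiplication by a coordinate outside I is injective with cokernel of bounded dimension, so the
    Hilbert function has bounded increments. D is the degree of the curve. *)
Lemma conic_hilbert_fun hp : hilbert_poly I hp -> hp.[0] = 1 ->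
  exists D N0, (0 < D)%N /\ forall d, (N0 <= d)%N ->
    exists b : 'I_(D * d + 1) -> S, graded_basis I d b.
Proof.
move=> [N hN] hp0; have [[hid I1 Ip] hIh [i hi]] := hI.
have primeI : is_prime I by split.
have sm := ideal_submodule hid.
have ex d : exists h, (N <= d)%N -> (exists b : 'I_h -> S, graded_basis I d b) /\ hp.[d%:R] = h%:R.
  case: (leqP N d) => hd; last by exists 0%N.
  have [h [h1 h2]] := hN d hd; exists h => _; split=> //.
  exact: hilbert_fun_basis.
have [h hh] := choice _ ex.
have [c [d1 hc]] := prime_bounded_adjoin hi.
have mono d : (N <= d)%N -> (h d <= h d.+1)%N.
  move=> hd; have [[b [h1 h2 h3]] _] := hh d hd.
  have [[b' [h1' h2' h3']] _] := hh d.+1 (leqW hd).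
  have := @indep_leq _ _ I _ _ (fun t => 'X_i * b t) b' sm (indep_mul primeI hi h2).
  rewrite !card_ord; apply=> t; apply: h3'.
  by have := dhomogM (homog_X k i) (h1 t).
have incr d : (maxn N d1 <= d)%N -> (h d.+1 <= h d + c)%N.
  rewrite geq_max => /andP [hd hd1].
  have [[b [h1 h2 h3]] _] := hh d hd.
  have [[b' [h1' h2' h3']] _] := hh d.+1 (leqW hd).
  have [T [g [hT hg sp]]] := hc d.+1 (leqW hd1).
  have := @indep_leq _ _ I _ _ b' (sumfun (fun t => 'X_i * b t) g) sm h2'.
  rewrite card_sum !card_ord => le.
  suff hsp t : spanned I (sumfun (fun t => 'X_i * b t) g) (b' t).
    by apply: leq_trans (le hsp) _; rewrite leq_add2l.
   have [y hy] := sp _ (h1' t).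
  set p := b' t - _ in hy.
  have hp1 : p \is d.+1.-homog.
    apply: rpredB; first exact: h1'. apply: rpred_sum => u _; apply: dhomogZ. exact: hg.
  case: (adjoin_component hIh (homog_X k i) hp1 hy) => [[]//|[r hr [_ hra]]].
  rewrite subn1 /= in hr; have [x hx] := h3 r hr.
  exists (fun u => match u with inl u => x u | inr u => y u end).
  rewrite big_sumType /= opprD addrCA -/p addrC.
  have -> : \sum_u x u *: ('X_i * b u) = 'X_i * \sum_u x u *: b u.
    by rewrite mulr_sumr; apply: eq_bigr => u _; rewrite scalerAr.
  have [I0 ID IM] := hid.
  rewrite -(subrK (r * 'X_i) p) -addrA; apply: ID => //.
  by rewrite mulrC -mulrBr; apply: IM.
have [||D hD] := @bounded_increments hp h c (maxn N d1) hp0.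
- by move=> d; rewrite geq_max => /andP [hd _]; apply: (hh d hd).2.
- move=> d hd; rewrite incr // andbT mono //; by move: hd; rewrite geq_max => /andP [].
exists D, (maxn N d1).
have hb d : (maxn N d1 <= d)%N -> exists b : 'I_(D * d + 1) -> S, graded_basis I d b.
  by move=> hd; rewrite -hD //; apply: (hh d _).1; move: hd; rewrite geq_max => /andP [].
split=> //; rewrite lt0n; apply/eqP => D0.
have [d [f [hd hf indf]]] := proj_chain_indep (maxn N d1).
have [b [h1 h2 h3]] := hb d hd.
have := @indep_leq _ _ I _ _ f b sm indf; rewrite !card_ord => h'.
by have := h' (fun i => h3 _ (hf i)); rewrite D0.
Qed.

End HilbertPolynomial.

(** * The local ring of a curve at a smooth point *)

Section KernelGenerators.
Variables (k L : fieldType) (kappa : {rmorphism k -> L}).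

Lemma algebraic_sum (T : Type) (r : seq T) (f : T -> L) :
  (forall i, algebraicOver kappa (f i)) -> algebraicOver kappa (\sum_(i <- r) f i).
Proof.
move=> h; elim/big_ind: _ => //; first exact: algebraic0.
exact: algebraic_add.
Qed.

Lemma algebraic_mmap n (y : 'I_n -> L) p :
  (forall j, algebraicOver kappa (y j)) -> algebraicOver kappa (mmap kappa y p).
Proof.
move=> hy; apply: algebraic_sum => m; apply: algebraic_mul; first exact: algebraic_id.
rewrite /mmap1; elim/big_ind: _ => [||j _]; [exact: algebraic1|exact: algebraic_mul|].
by elim: (m j) => [|e IH]; [exact: algebraic1|rewrite exprS; apply: algebraic_mul].
Qed.

(** Divide an equation of u by a power of X until its constant term is nonzero, then solve for 1. *)
Lemma algebraic_inverse u : algebraicOver kappa u -> u != 0 ->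
  exists R : {poly k}, u * (map_poly kappa R).[u] = 1.
Proof.
move=> [P P0 hP] u0.
have {P0 hP} [Q Q0 hQ] : exists2 Q : {poly k}, Q`_0 != 0 & root (map_poly kappa Q) u.
  have [m] := ubnP (size P); elim: m P P0 hP => // m IH P P0 hP hm.
  case: (eqVneq P`_0 0) => [e|ne]; last by exists P.
  have /factor_theorem [Q eQ] : root P 0 by rewrite /root horner_coef0 e.
  rewrite subr0 in eQ.
  have Q0 : Q != 0 by apply: contraNneq P0 => Q0; rewrite eQ Q0 mul0r.
  apply: (IH Q Q0); last by move: hm; rewrite eQ size_mulX.
  by move: hP; rewrite eQ rmorphM /= map_polyX /root hornerM hornerX mulf_eq0 (negbTE u0) orbF.
exists ((- (Q`_0)^-1)%:P * (\poly_(i < (size Q).-1) Q`_i.+1)).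
have eQ : Q = (Q`_0)%:P + 'X * \poly_(i < (size Q).-1) Q`_i.+1.
  apply/polyP => [[|i]]; rewrite coefD coefC coefXM /= ?addr0 // add0r coef_poly.
  case: ltnP => // h; rewrite nth_default //; move: h; clear; lia.
move: hQ; rewrite {1}eQ rmorphD rmorphM /= map_polyC map_polyX /root hornerD hornerC hornerM hornerX.
move=> /eqP /(canRL (addKr _)); rewrite addr0 => e.
rewrite rmorphM /= map_polyC hornerM hornerC mulrCA e raddfN mulrNN /= fmorphV mulVf //.
by rewrite fmorph_eq0.
Qed.

Definition generates (A : comNzRingType) (phi : A -> L) (m : nat) :=
  exists (T : finType) (mu : T -> A), [/\ #|T| = m, forall t, phi (mu t) = 0 &
    forall a, phi a = 0 -> exists c : T -> A, a = \sum_t c t * mu t].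

Definition field_image (A : comNzRingType) (phi : A -> L) :=
  forall a, phi a != 0 -> exists b, phi (a * b) = 1.

(** Beside the generators of the kernel of [phi] one needs a monic lift G of the minimal polynomial
    of z over the image field: the remainder modulo G of a polynomial vanishing at z has all its
    coefficients in that kernel. *)
Lemma generates_poly (A : comNzRingType) (phi : {rmorphism A -> L}) m z :
  generates phi m -> field_image phi ->
  (exists P : {poly A}, map_poly phi P != 0 /\ root (map_poly phi P) z) ->
  generates (fun p => (map_poly phi p).[z]) m.+1.
Proof.
move=> [T [mu [hT hmu hgen]]] hfield [P0 [P00 hP0]].
pose deg d := asb (exists P : {poly A}, [/\ map_poly phi P != 0, root (map_poly phi P) z & size (map_poly phi P) = d]).
have exdeg : exists d, deg d by exists (size (map_poly phi P0)); apply/asbP; exists P0.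
case: (ex_minnP exdeg) => d /asbP [P [P1 hP hd]] dmin.
have d0 : (0 < d)%N by rewrite -hd lt0n size_poly_eq0.
have [b hb] : exists b, phi (P`_d.-1 * b) = 1.
  apply: hfield; rewrite -coef_map -hd -lead_coefE lead_coef_eq0 //.
pose G : {poly A} := 'X^(d.-1) + \poly_(i < d.-1) (b * P`_i).
have sG : size G = d.
  rewrite size_polyDl size_polyXn ?prednK //.
  by rewrite -{2}(prednK d0) ltnS size_poly.
have Gm : G \is monic.
  by rewrite monicE lead_coefE sG coefD coefXn eqxx coef_poly ltnn addr0.
have hG : map_poly phi G = phi b *: map_poly phi P.
  apply/polyP => i; rewrite coefZ !coef_map coefD coefXn coef_poly.
  case: (ltngtP i d.-1) => h; rewrite ?addr0 ?add0r /=.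
  - exact: rmorphM.
  - rewrite rmorph0 -coef_map nth_default ?mulr0 // hd.
    by rewrite -(prednK d0).
  - by rewrite h -rmorphM mulrC hb rmorph1.
have Gz : (map_poly phi G).[z] = 0 by rewrite hG hornerZ (rootP hP) mulr0.
exists (T + unit)%type, (fun t => match t with inl t => (mu t)%:P | inr _ => G end); split.
- by rewrite card_sum card_unit hT addn1.
- by case=> [t|_]; [rewrite map_polyC hornerC; apply: hmu|exact: Gz].
move=> p hp; have ep := Pdiv.RingMonic.rdivp_eq Gm p.
set q := Pdiv.Ring.rdivp p G in ep; set r := Pdiv.Ring.rmodp p G in ep.
have sr : (size r < d)%N by rewrite -sG; apply: Pdiv.Ring.ltn_rmodpN0; rewrite monic_neq0.
have r0 : map_poly phi r = 0.
  apply/eqP; apply: contraTT isT => rn0.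
  have := dmin (size (map_poly phi r)).
  have -> : deg (size (map_poly phi r)).
    apply/asbP; exists r; split=> //; apply/rootP.
    by move: hp; rewrite ep rmorphD rmorphM hornerD hornerM Gz mulr0 add0r.
  move/(_ isT); rewrite leqNgt; case/negP; apply: leq_ltn_trans sr.
  exact: size_poly.
have hex i : exists c : T -> A, r`_i = \sum_t c t * mu t.
  by apply: hgen; rewrite -coef_map r0 coef0.
have [c hc] := choice _ hex.
exists (fun t => match t with inl t => \poly_(i < size r) c i t | inr _ => q end).
rewrite big_sumType /=; have -> : \sum_(u : unit) q * G = q * G by rewrite big_const card_unit /= addr0.
rewrite {1}ep addrC; congr (_ + _).
apply/polyP => i; rewrite coef_sum; case: (ltnP i (size r)) => hi.
  by rewrite hc; apply: eq_bigr => t _; rewrite coefMC coef_poly hi.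
by rewrite nth_default // big1 // => t _; rewrite coefMC coef_poly ltnNge hi mul0r.
Qed.

(** One generator for each variable, since the image of the polynomials in the previous variables is
    a field. The exact number n makes the system in [local_parameter] have as many generators as
    coordinates. *)
Lemma kernel_generators n (y : 'I_n -> L) :
  (forall j, algebraicOver kappa (y j)) -> generates (mmap kappa y) n.
Proof.
elim: n y => [|n IH] y hy.
  exists void, (fun=> 0); split; [by rewrite card_void|by case|move=> p].
  rewrite (nvar0_mpolyC p) mmapC => /eqP; rewrite fmorph_eq0 => /eqP ->.
  by exists (fun=> 0); rewrite big1 ?mpolyC0 //; case.
pose y' j := y (widen_ord (leqnSn n) j).
have [|||T [mu [hT hmu hgen]]] := @generates_poly _ (mmap kappa y') n (y ord_max) (IH y' _).
- by move=> j; apply: hy.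
- move=> a ha; have [R hR] := algebraic_inverse (algebraic_mmap a (fun j => hy (widen_ord (leqnSn n) j))) ha.
  exists (map_poly (@mpolyC n k) R).[a]; rewrite rmorphM -horner_map /=.
  rewrite -map_poly_comp; rewrite -[RHS]hR; congr (_ * _.[_]).
  by apply: eq_map_poly => c /=; rewrite mmapC.
- have [P P0 hP] := hy ord_max; exists (map_poly (@mpolyC n k) P).
  rewrite -map_poly_comp; have e : map_poly (mmap kappa y' \o @mpolyC n k) P = map_poly kappa P.
    by apply: eq_map_poly => c /=; rewrite mmapC.
  by rewrite e map_poly_eq0.
pose f := mpoly_of_poly k n.
have fE a : mmap kappa y (f a) = (map_poly (mmap kappa y') a).[y ord_max].
  have wE q : mmap kappa y (mwiden q) = mmap kappa y' q.
    apply: (mpoly_rmorph_eq (f := mmap kappa y \o @mwiden n k) (g := mmap kappa y')) => [c|i] /=.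
      by rewrite mwidenC !mmapC.
    by rewrite mwidenX mnmwiden1 !mmapX !mmap1U.
  rewrite /f /= /horner_eval -horner_map /= mmapX mmap1U -map_poly_comp.
  by congr (_.[_]); apply: eq_map_poly => q /=; apply: wE.
exists T, (fun t => f (mu t)); split=> // [t|p hp]; first by rewrite fE.
have [a ea] := mpoly_of_poly_surj p; rewrite ea fE in hp.
have [c hc] := hgen a hp; exists (fun t => f (c t)).
by rewrite ea hc rmorph_sum; apply: eq_bigr => t _; rewrite rmorphM.
Qed.

End KernelGenerators.

Lemma mmap_map_mpoly (k L T : fieldType) n (f : {rmorphism k -> L}) (g : {rmorphism L -> T})
    (x : 'I_n -> T) p : mmap g x (map_mpoly f p) = mmap (g \o f) x p.
Proof.
apply: (mpoly_rmorph_eq (f := mmap g x \o map_mpoly f) (g := mmap (g \o f) x)) => [c|i] /=.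
  by rewrite map_mpolyC !mmapC.
by rewrite map_mpolyX !mmapX !mmap1U.
Qed.

Lemma mderiv_map_mpoly (k L : fieldType) n (f : {rmorphism k -> L}) i (p : {mpoly k[n]}) :
  (map_mpoly f p)^`M(i) = map_mpoly f p^`M(i).
Proof.
by apply/mpolyP => m; rewrite mcoeff_deriv !mcoeff_map_mpoly mcoeff_deriv raddfMn.
Qed.

Lemma euler_mmap (k L : fieldType) n (f : {rmorphism k -> L}) (y : 'I_n -> L) d p :
  p \is d.-homog -> \sum_j mmap f y p^`M(j) * y j = d%:R * mmap f y p.
Proof.
move=> hp.
have main m : mdeg m = d ->
    \sum_j mmap f y ('X_[m] : {mpoly k[n]})^`M(j) * y j = d%:R * mmap f y 'X_[m].
  move=> <-; rewrite mdegE natr_sum mulr_suml; apply: eq_bigr => j _.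
  rewrite mderivX mmapZ rmorph_nat.
  case: (posnP (m j)) => [->|mj]; first by rewrite !mul0r.
  have um : (U_(j) <= m)%MM by rewrite lep1mP -lt0n.
  rewrite -mulrA; congr (_ * _); rewrite -{2}(submK um) mpolyXD rmorphM /=.
  by rewrite [mmap _ _ 'X_j]mmapX mmap1U.
have e j : mmap f y p^`M(j) * y j =
    \sum_(m <- msupp p) f p@_m * (mmap f y ('X_[m] : {mpoly k[n]})^`M(j) * y j).
  rewrite {1}(mpolyE p) (raddf_sum (mderiv j)) (raddf_sum (mmap f y)) mulr_suml.
  apply: eq_bigr => m _.
  by rewrite /= mderivZ mmapZ mulrA.
under eq_bigr do rewrite e.
rewrite exchange_big [in RHS](mpolyE p) (raddf_sum (mmap f y)) mulr_sumr /=.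
apply: eq_big_seq => m hm; rewrite -mulr_sumr main ?(dhomog_mf hp) //.
by rewrite mmapZ mulrCA.
Qed.

Section LocalParameter.
Variables (k F L : fieldType) (iota : {rmorphism k -> F}) (kappa : {rmorphism k -> L}).
Variables (n : nat) (x : 'I_n.+1 -> F) (y : 'I_n.+1 -> L) (i : 'I_n.+1).
Local Notation S := {mpoly k[n.+1]}.
Variable eqs : seq S.
Hypotheses (xi : x i = 1) (yi : y i = 1)
  (specialization : forall p, mmap iota x p = 0 -> mmap kappa y p = 0)
  (yalg : forall j, algebraicOver kappa (y j))
  (eqs_homog : forall p, p \in eqs -> p \is homog mdeg)
  (eqs_x : forall p, p \in eqs -> mmap iota x p = 0)
  (eqs_smooth : (\rank (\matrix_(a < size eqs, j < n.+1) mmap kappa y (eqs`_a)^`M(j))).+1 = n).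

(* The gradients of the equations and of X_i - 1 at y span a hyperplane of the
   cotangent space, so adding one generator [theta] of the ideal of y makes the
   matrix expressing these functions through generators of that ideal invertible at y. *)
Lemma local_parameter : exists theta u : S,
  [/\ mmap kappa y theta = 0, mmap kappa y u != 0 &
    forall p, mmap kappa y p = 0 ->
      exists q, mmap iota x (u * p) = mmap iota x (theta * q)].
Proof.
have [T [mu0 [hT hmu0 hgen0]]] := kernel_generators yalg.
pose e (b : 'I_n.+1) : T := enum_val (cast_ord (esym hT) b).
have e_bij : bijective e.
  exists (fun t => cast_ord hT (enum_rank t)) => b.
    by rewrite /e enum_valK cast_ordKV.
  by rewrite /e cast_ordK enum_rankK.
pose mu b := mu0 (e b).
have hmu b : mmap kappa y (mu b) = 0 by apply: hmu0.
have hgen p : mmap kappa y p = 0 -> exists c : 'I_n.+1 -> S, p = \sum_b c b * mu b.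
  move=> /hgen0 [c ->]; exists (fun b => c (e b)).
  by rewrite (reindex e) //; apply: onW_bij.
(* The default value of [nth] supplies the dehomogenizing equation X_i - 1 at the index
   [size eqs]. *)
pose G (a : nat) : S := nth ('X_i - 1) eqs a.
have Gx a : mmap iota x (G a) = 0.
  rewrite /G; case: (ltnP a (size eqs)) => ha; first by apply/eqs_x/mem_nth.
  by rewrite nth_default // mmapB mmapX mmap1U rmorph1 xi subrr.
have Gy a : mmap kappa y (G a) = 0 by apply/specialization/Gx.
pose s := size eqs.
have [C hC] := choice _ (fun a : 'I_s.+1 => hgen _ (Gy a)).
pose Cm : 'M[S]_(s.+1, n.+1) := \matrix_(a, b) C a b.
pose J := \matrix_(a < size eqs, j < n.+1) mmap kappa y (eqs`_a)^`M(j).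
pose Gm : 'M[L]_(s.+1, n.+1) := \matrix_(a, j) mmap kappa y (G a)^`M(j).
pose Mm : 'M[L]_(n.+1) := \matrix_(b, j) mmap kappa y (mu b)^`M(j).
have GE : Gm = map_mx (mmap kappa y) Cm *m Mm.
  apply/matrixP => a j; rewrite !mxE hC (raddf_sum (mderiv j)) (raddf_sum (mmap kappa y)) /=.
  by apply: eq_bigr => b _; rewrite mderivM rmorphD !rmorphM /= hmu mulr0 add0r !mxE.
pose yc : 'cV[L]_(n.+1) := \col_j y j.
(* By Euler's relation the gradients of the homogeneous equations kill y, whereas the gradient of
   X_i - 1 does not; this raises the rank from n - 1 to n. *)
have Jy : J *m yc = 0.
  apply/matrixP => a b; rewrite !mxE; under eq_bigr do rewrite !mxE.
  have ha : eqs`_a \in eqs by apply: mem_nth.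
  have /homogP [d hd] := eqs_homog ha.
  by rewrite (euler_mmap _ _ hd) (specialization (eqs_x ha)) mulr0.
have ltJG : (J < Gm)%MS.
  rewrite ltmxE; apply/andP; split.
    apply/row_subP => a; have -> : row a J = row (widen_ord (leqnSn s) a) Gm.
      by apply/rowP => j; rewrite !mxE /G /= [nth ('X_i - 1) _ _](set_nth_default 0) // ltn_ord.
    exact: row_sub.
  apply/negP => /submxP [D hD].
  have : (Gm *m yc) ord_max 0 = 0 by rewrite hD -mulmxA Jy mulmx0 mxE.
  rewrite mxE (bigD1 i) //= !mxE /G nth_default // big1 => [|j ji].
    rewrite mderivB mderivX mnm1E eqxx scale1r -[1]mpolyC1 mderivC subr0.
    have -> : (U_(i) - U_(i))%MM = 0%MM :> 'X_{1..n.+1}.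
      by apply/mnmP => j; rewrite mnmBE subnn mnm0E.
    by rewrite mpolyX0 rmorph1 yi mulr1 addr0 => /eqP; rewrite oner_eq0.
  rewrite !mxE /G nth_default // mderivB mderivX mnm1E eq_sym (negbTE ji) scale0r.
  by rewrite -[1]mpolyC1 mderivC subr0 rmorph0 mul0r.
have rG : (n <= \rank Gm)%N.
  by move: ltJG; rewrite ltmxErank => /andP [_]; apply: leq_trans; rewrite eqs_smooth.
set Cy := map_mx (mmap kappa y) Cm in GE.
have rC : (n <= \rank Cy)%N by apply: leq_trans rG _; rewrite GE mxrankM_maxl.
(* The rank of [Cy] is at least n, so one unit row is enough to reach n + 1; the generator [mu b0]
   it selects is the local parameter. *)
have [b0 full] : exists b0, row_full (col_mx Cy (delta_mx 0 b0 : 'rV[L]_(n.+1))).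
  case: (boolP (row_full Cy)) => hf.
    exists ord0; rewrite -sub1mx; apply: submx_trans (_ : (Cy <= _)%MS).
      by rewrite sub1mx.
    by apply: submx_trans (addsmxSl _ (delta_mx 0 ord0 : 'rV[L]_(n.+1))) _; rewrite addsmxE.
  move: hf; rewrite -sub1mx => /row_subPn [b]; rewrite row1 => hb.
  exists b; rewrite /row_full eqn_leq rank_leq_col /=.
  apply: leq_ltn_trans rC _.
  have : (Cy < col_mx Cy (delta_mx 0 b : 'rV[L]_(n.+1)))%MS.
    rewrite ltmxE -!addsmxE addsmxSl /= addsmx_sub submx_refl /=.
    by [].
  by rewrite ltmxErank => /andP [].
pose C' : 'M[S]_(s.+1 + 1, n.+1) := col_mx Cm (delta_mx 0 b0).
have mapC' : map_mx (mmap kappa y) C' = col_mx Cy (delta_mx 0 b0).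
  by rewrite map_col_mx map_delta_mx.
rewrite -mapC' in full.
pose D : 'M[S]_(n.+1) := rowsub (fullrankfun full) C'.
pose muc : 'cV[S]_(n.+1) := \col_b mu b.
exists (mu b0), (\det D); split=> //.
  rewrite -[mmap _ _ _]/((mmap kappa y : {rmorphism S -> L}) _) -det_map_mx -unitfE.
  rewrite -[_ \is a _]unitmxE.
  have -> : map_mx (mmap kappa y) D = rowsub (fullrankfun full) (map_mx (mmap kappa y) C').
    by apply/matrixP => a b; rewrite !mxE.
  exact: fullrowsub_unit.
have key b : exists q, mmap iota x (\det D * mu b) = mmap iota x (mu b0 * q).
  (* Cramer's rule: each entry of D times the column of generators is either an equation, which
     vanishes at x, or [mu b0]; [w] records which. *)
  pose w (r : 'I_n.+1) : S := if split (fullrankfun full r) is inr _ then 1 else 0.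
  exists (\sum_r (\adj D) b r * w r).
  have -> : \det D * mu b = (\adj D *m (D *m muc)) b 0.
    by rewrite mulmxA mul_adj_mx mul_scalar_mx !mxE.
  rewrite mxE.
  rewrite mulr_sumr !rmorph_sum /=; apply: eq_bigr => r _.
  rewrite mulrCA !rmorphM /=; congr (_ * _).
  have -> : (D *m muc) r 0 = (C' *m muc) (fullrankfun full r) 0.
    by rewrite !mxE; apply: eq_bigr => b' _; rewrite !mxE.
  rewrite /w mul_col_mx mxE; case: splitP => [a _|a _].
    rewrite mmap0 mulr0.
    have -> : (Cm *m muc) a 0 = G a by rewrite hC mxE; apply: eq_bigr => b' _; rewrite !mxE.
    exact: Gx.
  by rewrite rmorph1 mulr1 -rowE !mxE.
have [q0 hq0] := choice _ key.
move=> p /hgen [c ->]; exists (\sum_b c b * q0 b).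
rewrite !mulr_sumr !rmorph_sum /=; apply: eq_bigr => b _.
by rewrite mulrCA [mu b0 * _]mulrCA [LHS]rmorphM [RHS]rmorphM /= hq0.
Qed.

End LocalParameter.

(** * Orders of vanishing at a smooth point *)

Section EvaluationKernel.
Variables (k F : fieldType) (iota : {rmorphism k -> F}) (n : nat) (x : 'I_n -> F).

Definition eval_kernel (p : {mpoly k[n]}) := mmap iota x p = 0.

Lemma eval_kernel_submodule : submodule eval_kernel.
Proof.
split=> [|p q hp hq|c p hp]; rewrite /eval_kernel; first exact: mmap0.
  by rewrite mmapD hp hq addr0.
by rewrite mmapZ hp mulr0.
Qed.

Lemma eval_lincomb (T : finType) (c : T -> k) (f : T -> {mpoly k[n]}) :
  mmap iota x (\sum_t c t *: f t) = \sum_t iota (c t) * mmap iota x (f t).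
Proof. by rewrite (raddf_sum (mmap iota x)); apply: eq_bigr => t _; rewrite /= mmapZ. Qed.

Lemma spanned_homogenize d (T : finType) (b : T -> {mpoly k[n]}) i p : x i = 1 ->
  (forall q, q \is d.-homog -> spanned eval_kernel b q) ->
  (msize p <= d.+1)%N -> spanned eval_kernel b p.
Proof.
move=> xi hb hp; have [c hc] := hb _ (homogenize_homog i d p).
exists c; move: hc; rewrite /eval_kernel !mmapB mmap_homogenize //.
Qed.

End EvaluationKernel.

Lemma msize_homog (k : fieldType) n (p : {mpoly k[n]}) d : p \is d.-homog -> (msize p <= d.+1)%N.
Proof. by move=> hp; apply/bigmax_leqP_seq => m hm _; rewrite (dhomog_mf hp hm). Qed.

Lemma msizeM_leq (k : fieldType) n (p q : {mpoly k[n]}) d e :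
  (msize p <= d.+1)%N -> (msize q <= e.+1)%N -> (msize (p * q) <= (d + e).+1)%N.
Proof.
move=> hp hq; case: (eqVneq p 0) => [->|p0]; first by rewrite mul0r mmeasure0.
case: (eqVneq q 0) => [->|q0]; first by rewrite mulr0 mmeasure0.
rewrite msizeM // -subn1 leq_subLR; apply: leq_trans (leq_add hp hq) _; lia.
Qed.

Lemma msizeX_le (k : fieldType) n (p : {mpoly k[n]}) e m :
  (msize p <= e.+1)%N -> (msize (p ^+ m) <= (e * m).+1)%N.
Proof.
move=> hp; elim: m => [|m IH]; first by rewrite expr0 msize1.
by rewrite exprS mulnS; apply: msizeM_leq.
Qed.

Section Order.
Variables (k F L : fieldType) (iota : {rmorphism k -> F}) (kappa : {rmorphism k -> L}).
Variables (n : nat) (x : 'I_n.+1 -> F) (y : 'I_n.+1 -> L) (i : 'I_n.+1).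
Local Notation S := {mpoly k[n.+1]}.
Local Notation evx := (mmap iota x).
Local Notation evy := (mmap kappa y).
Variables (D N0 : nat) (theta u : S).
Hypotheses (xi : x i = 1) (specialization : forall p, evx p = 0 -> evy p = 0)
  (hilb : forall d, (N0 <= d)%N ->
     exists b : 'I_(D * d + 1) -> S, graded_basis (eval_kernel iota x) d b)
  (theta_y : evy theta = 0) (u_y : evy u != 0)
  (theta_gen : forall p, evy p = 0 -> exists q, evx (u * p) = evx (theta * q))
  (nontrivial : exists p, evy p = 0 /\ evx p != 0).

Lemma nonzero_x p : evy p != 0 -> evx p != 0.
Proof. by apply: contra_neq => /specialization. Qed.

Lemma theta_x : evx theta != 0.
Proof.
have [p [py px]] := nontrivial; have [q hq] := theta_gen py.
apply: contraTneq (nonzero_x u_y) => t0.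
move: hq; rewrite !rmorphM /= t0 mul0r => /eqP.
by rewrite mulf_eq0 (negbTE px) orbF negbK.
Qed.

(** A form of degree e has at most D e zeros. The powers of theta below m are independent modulo g;
    with the multiples of g by a basis in degree j they give m + D j + 1 independent values in
    degree e + j, where the dimension is D (e + j) + 1. *)
Lemma order_bound g e m s w : evx g != 0 -> (msize g <= e.+1)%N -> evy s != 0 ->
  evx (s * g) = evx (theta ^+ m * w) -> (m <= D * e)%N.
Proof.
move=> g0 hg sy hsg.
have [t ht] : exists t, (msize theta <= t.+1)%N by exists (msize theta).
(* Large enough for every power of theta below m to be the dehomogenization of a form of degree e +
   j. *)
pose j := maxn N0 (t * m); have [|b [b1 b2 _]] := hilb (d := j); first exact: leq_maxl.
have [|b' [_ _ b3]] := hilb (d := e + j); first by rewrite /j; lia.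
pose Z' p := exists r, evx p = evx (g * r).
have subZ' : submodule Z'.
  split=> [|p q [r hr] [r' hr']|c p [r hr]].
  - by exists 0; rewrite mulr0.
  - by exists (r + r'); rewrite mmapD hr hr' mulrDr mmapD.
  - by exists (c *: r); rewrite mmapZ hr -scalerAr mmapZ.
have subZ := eval_kernel_submodule iota x.
(* In a relation divided by theta^a, the coefficient of smallest index a is what remains after
   evaluation at y. *)
have ind1 : indep Z' (fun a : 'I_m => theta ^+ a).
  move=> c [r hr] a; have [l] := ubnP (a : nat); elim: l a => // l IH a hal.
  have ham := ltn_ord a.
  have : evx (s * \sum_(a' < m) c a' *: theta ^+ (a' - a)) = evx (theta ^+ (m - a) * w * r).
    apply: (mulfI (expf_neq0 a theta_x)).
    rewrite -rmorphXn -!rmorphM /=.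
    have -> : theta ^+ a * (s * \sum_(a' < m) c a' *: theta ^+ (a' - a))
            = s * \sum_(a' < m) c a' *: theta ^+ a'.
      rewrite mulrCA mulr_sumr; congr (s * _); apply: eq_bigr => a' _.
      rewrite -scalerAr -exprD; case: (ltnP a' a) => h; last by rewrite subnKC.
      by rewrite (IH a') ?scale0r //; apply: leq_trans h _.
    have -> : theta ^+ a * (theta ^+ (m - a) * w * r) = (theta ^+ m * w) * r.
      by rewrite !mulrA -exprD subnKC // ltnW.
    by rewrite rmorphM /= hr -rmorphM mulrA rmorphM /= hsg -rmorphM.
  move=> e1; have {e1} : evy (s * \sum_(a' < m) c a' *: theta ^+ (a' - a)
      - theta ^+ (m - a) * w * r) = 0.
    by apply: specialization; rewrite mmapB e1 subrr.
  rewrite mmapB !rmorphM rmorphXn /= theta_y expr0n subn_eq0 leqNgt ham /= !mul0r subr0.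
  rewrite eval_lincomb (bigD1 a) //= subnn expr0 rmorph1 mulr1 big1 ?addr0.
    by move/eqP; rewrite mulf_eq0 (negbTE sy) fmorph_eq0 => /eqP.
  move=> a' ne; case: (ltnP a' a) => h.
    by rewrite (IH a') ?rmorph0 ?mul0r //; apply: leq_trans h _.
  rewrite rmorphXn /= theta_y expr0n subn_eq0 leqNgt.
  by rewrite ltn_neqAle h andbT eq_sym ne mulr0.
have ind2 : indep (eval_kernel iota x) (fun v => g * b v).
  move=> c hc; apply: b2; apply/eqP; move: hc; rewrite /eval_kernel !eval_lincomb.
  under eq_bigr do rewrite rmorphM /= mulrCA.
  rewrite -mulr_sumr => /eqP; by rewrite mulf_eq0 (negbTE g0).
have sub p : eval_kernel iota x p -> Z' p by move=> hp; exists 0; rewrite mulr0 mmap0.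
have ind := indep_sum subZ' sub ind1 ind2 (fun v => ex_intro _ (b v) erefl).
have := indep_leq subZ ind; move/(_ _ b'); rewrite card_sum !card_ord => le.
have : (m + (D * j + 1) <= D * (e + j) + 1)%N; last by lia.
apply: le => -[a|v] /=; apply: (spanned_homogenize xi b3).
  apply: leq_trans (msizeX_le a ht) _; have := ltn_ord a.
  have : (t * a <= t * m)%N by rewrite leq_mul2l ltnW ?orbT // ltn_ord.
  by rewrite /j; lia.
by apply: msizeM_leq hg _; apply: msize_homog.
Qed.

(** Division by theta continues as long as the cofactor vanishes at y, and [order_bound] makes it
    stop. *)
Lemma discrete_valuation p : evx p != 0 -> exists m s a,
  [/\ evy s != 0, evy a != 0 & evx (s * p) = evx (theta ^+ m * a)].
Proof.
move=> p0; apply: NNPP => hn.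
suff h m : exists s w, evy s != 0 /\ evx (s * p) = evx (theta ^+ m * w).
  have [s [w [sy e]]] := h (D * msize p).+1.
  by have := order_bound p0 (leqnSn _) sy e; rewrite ltnn.
elim: m => [|m [s [w [sy e]]]].
  by exists 1, p; rewrite rmorph1 oner_neq0 expr0.
case: (eqVneq (evy w) 0) => [w0|w0]; last by case: hn; exists m, s, w.
have [q hq] := theta_gen w0; exists (u * s), q; split.
  by rewrite rmorphM mulf_neq0.
rewrite -mulrA rmorphM /= e -rmorphM mulrCA rmorphM /= hq -rmorphM mulrA -exprSr.
by [].
Qed.

(** An algebraic constant has no zero: 1 is a polynomial without constant term in z = p / s, and
    clearing denominators would make a power of s vanish at y. *)
Lemma algebraic_unit z p s : algebraicOver iota z -> z != 0 ->
  evy p = 0 -> evy s != 0 -> z * evx s = evx p -> False.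
Proof.
move=> zalg z0 py sy e; have [R hR] := algebraic_inverse zalg z0.
pose r := size R.
pose W := \sum_(j < r) R`_j *: (p ^+ j.+1 * s ^+ (r - j.+1)) - s ^+ r.
have s0 := nonzero_x sy.
have : evy W = 0.
  apply: specialization; rewrite /W mmapB eval_lincomb rmorphXn /=.
  have -> : evx s ^+ r = z * (map_poly iota R).[z] * evx s ^+ r by rewrite hR mul1r.
  have -> : (map_poly iota R).[z] = \sum_(j < r) iota R`_j * z ^+ j.
    rewrite (horner_coef_wide (n := r)); last exact: size_poly.
    by apply: eq_bigr => j _; rewrite coef_map.
  rewrite mulr_sumr mulr_suml -sumrB big1 // => j _.
  rewrite rmorphM !rmorphXn /= -e exprMn.
  have -> : evx s ^+ r = evx s ^+ j.+1 * evx s ^+ (r - j.+1).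
    by rewrite -exprD subnKC // ltn_ord.
  by rewrite !exprS; ring.
rewrite /W mmapB rmorphXn /= eval_lincomb big1 ?sub0r => [/eqP|j _].
  by rewrite oppr_eq0 expf_eq0 (negbTE sy) andbF.
by rewrite rmorphM rmorphXn /= py expr0n /= mul0r mulr0.
Qed.

End Order.

(** * Constants in the function field of a curve of genus 0 *)

Section ScalarRestriction.
Variables (k F : fieldType).
Definition scalar_restriction (_ : {rmorphism k -> F}) : Type := F.
Variable iota : {rmorphism k -> F}.
Local Notation M := (scalar_restriction iota).
HB.instance Definition _ := GRing.Zmodule.on M.
Fact restriction_scaleA (a b : k) (v : M) :
  iota a * (iota b * v) = iota (a * b) * v.
Proof. by rewrite rmorphM mulrA. Qed.
Fact restriction_scale1 : left_id 1 (fun (a : k) (v : M) => iota a * v : M).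
Proof. by move=> v; rewrite rmorph1 mul1r. Qed.
Fact restriction_scaleDr :
  right_distributive (fun (a : k) (v : M) => iota a * v : M) +%R.
Proof. by move=> a u v; rewrite mulrDr. Qed.
Fact restriction_scaleDl (v : M) :
  {morph (fun a : k => iota a * v : M) : a b / a + b}.
Proof. by move=> a b; rewrite rmorphD mulrDl. Qed.
HB.instance Definition _ := GRing.Zmodule_isLmodule.Build k M
  restriction_scaleA restriction_scale1 restriction_scaleDr restriction_scaleDl.

Definition is_zero (v : M) := v = 0.

Lemma is_zero_submodule : submodule is_zero.
Proof.
split=> // [x y -> ->|c x ->]; rewrite /is_zero; first by rewrite addr0.
by rewrite scaler0.
Qed.

Lemma spanned_zeroP (T : finType) (f : T -> M) v :
  spanned is_zero f v <-> exists c : T -> k, v = \sum_t c t *: f t.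
Proof.
split=> -[c hc]; exists c; first by apply/eqP; rewrite -subr_eq0; apply/eqP.
by rewrite /is_zero hc subrr.
Qed.

(* A finite-dimensional space stable under multiplication by [alpha] is a vector
   space over k(alpha). *)
Lemma degree_dvd (alpha : F) (P : {poly k}) (e h : nat) (V : M -> Prop) (b : 'I_h -> M) :
  size P = e.+1 -> root (map_poly iota P) alpha ->
  (forall R : {poly k}, (size R <= e)%N -> root (map_poly iota R) alpha -> R = 0) ->
  (forall v, V v -> V (alpha * v : F)) -> indep is_zero b -> (forall i, V (b i)) ->
  (forall v, V v -> spanned is_zero b v) -> (e %| h)%N.
Proof.
move=> sP rP Pmin hV indb Vb spb; have sub0 := is_zero_submodule.
have e0 : (0 < e)%N.
  rewrite lt0n; apply/eqP => e0; move: sP; rewrite e0 => /eqP/size_poly1P [c c0 ec].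
  by move: rP; rewrite ec map_polyC rootC fmorph_eq0 (negbTE c0).
pose fam (J : finType) (w : J -> M) (aj : 'I_e * J) : M := alpha ^+ aj.1 * (w aj.2 : F).
(* The largest number of vectors whose multiples by alpha^a, a < e, are independent over k is the
   dimension over k(alpha). *)
pose Pr r := asb (exists (J : finType) (w : J -> M), [/\ #|J| = r, forall j, V (w j) & indep is_zero (fam J w)]).
have exPr : exists r, Pr r.
  by exists 0%N; apply/asbP; exists void, (fun=> 0); split; [rewrite card_void|case|move=> c _ [_ []]].
have Vpow v a : V v -> V (alpha ^+ a * v : F).
  by elim: a => [|a IH] hv; rewrite ?expr0 ?mul1r // exprS -mulrA; apply/hV/IH.
have card_fam J w : indep is_zero (fam J w) -> (forall j, V (w j)) -> (e * #|J| <= h)%N.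
  move=> ind hw; have := indep_leq sub0 ind (g := b); rewrite card_prod !card_ord; apply.
  by case=> a j; apply/spb/Vpow.
have ubPr r : Pr r -> (r <= h)%N.
  case/asbP=> J [w [<- hw ind]]; apply: leq_trans (card_fam _ _ ind hw).
  by rewrite leq_pmull.
case: (ex_maxnP exPr ubPr) => r /asbP [J [w [hJ hw ind]]] rmax.
pose Sp v := spanned is_zero (fam J w) v.
have SpD u v : Sp u -> Sp v -> Sp (u + v).
  rewrite /Sp !spanned_zeroP => -[c ->] [d ->]; exists (fun t => c t + d t).
  by rewrite -big_split; apply: eq_bigr => t _; rewrite scalerDl.
have SpZ c v : Sp v -> Sp (c *: v).
  rewrite /Sp !spanned_zeroP => -[d ->]; exists (fun t => c * d t).
  by rewrite scaler_sumr; apply: eq_bigr => t _; rewrite scalerA.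
have Sp0 : Sp 0.
  by rewrite /Sp spanned_zeroP; exists (fun=> 0); rewrite big1 // => t _; rewrite scale0r.
have Sp_sum (T : finType) (f : T -> M) : (forall t, Sp (f t)) -> Sp (\sum_t f t).
  by move=> hf; elim/big_ind: _.
have Sp_fam a j : (a < e)%N -> Sp (alpha ^+ a * w j : F).
  move=> ha; rewrite /Sp spanned_zeroP; exists (fun t => (t == (Ordinal ha, j))%:R).
  rewrite (bigD1 (Ordinal ha, j)) //= eqxx scale1r big1 ?addr0 // => t /negbTE ->.
  by rewrite scale0r.
have lP : P`_e != 0 by have := lead_coef_eq0 P; rewrite lead_coefE sP /= => ->; rewrite -size_poly_eq0 sP.
have Pe : alpha ^+ e = \sum_(a < e) iota (- (P`_e)^-1 * P`_a) * alpha ^+ a.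
  apply: (mulfI (x := iota P`_e)); first by rewrite fmorph_eq0.
  rewrite mulr_sumr.
  move: rP; rewrite /root (horner_coef_wide (n := e.+1)) -?sP ?size_poly // sP.
  rewrite big_ord_recr /= coef_map addrC addr_eq0 => /eqP ->.
  rewrite -sumrN; apply: eq_bigr => a _; rewrite coef_map mulrA -rmorphM mulrA.
  by rewrite mulrN mulfV // mulN1r rmorphN mulNr.
have Sp_alpha v : Sp v -> Sp (alpha * v : F).
  rewrite {1}/Sp spanned_zeroP => -[c ->]; rewrite mulr_sumr; apply: (Sp_sum) => -[a j].
  have -> : alpha * (c (a, j) *: fam J w (a, j)) = c (a, j) *: (alpha ^+ a.+1 * w j : M).
    by rewrite /fam /= /GRing.scale /= exprS; ring.
  apply: (SpZ); case: (ltnP a.+1 e) => ha; first exact: (Sp_fam).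
  have -> : a.+1 = e by apply/eqP; rewrite eqn_leq ha ltn_ord.
  rewrite Pe mulr_suml; apply: (Sp_sum) => a'; rewrite -mulrA.
  by apply: (SpZ); apply: (Sp_fam).
have Sp_poly (R : {poly k}) v : Sp v -> Sp ((map_poly iota R).[alpha] * v : F).
  move=> hv; elim/poly_ind: R => [|R c IH]; first by rewrite rmorph0 horner0 mul0r.
  rewrite rmorphD rmorphM /= map_polyX map_polyC hornerMXaddC mulrDl.
  apply: (SpD); last exact: SpZ.
  by rewrite mulrAC mulrC; apply: Sp_alpha.
have SpV v : V v -> Sp v.
  move=> hv; apply: NNPP => nv.
  pose w' (j : J + unit) : M := match j with inl j => w j | inr _ => v end.
  have nind : ~ indep is_zero (fam _ w').
    move=> ind'; suff : (r.+1 <= r)%N by rewrite ltnn.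
    apply: rmax; apply/asbP; exists (J + unit)%type, w'; split=> //.
      by rewrite card_sum card_unit hJ addn1.
    by case.
  have [c hcn] := not_all_ex_not _ _ nind; have [hc hn] := imply_to_and _ _ hcn.
  pose R := \poly_(a < e) (if insub a is Some a' then c (a', inr tt) else 0).
  have Ra (a : 'I_e) : R`_a = c (a, inr tt) by rewrite coef_poly ltn_ord valK.
  pose z := \sum_(a < e) \sum_(j : J) c (a, inl j) *: fam J w (a, j).
  have e1 : z + ((map_poly iota R).[alpha] * v : F) = 0.
    have hc' : \sum_(a < e) \sum_(j : J + unit) c (a, j) *: fam _ w' (a, j) = 0.
      by rewrite pair_bigA /= -[RHS]hc; apply: eq_bigr => -[a j] _.
    rewrite -[RHS]hc' /z.
    under [RHS]eq_bigr do rewrite big_sumType /=.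
    rewrite big_split /=; congr (_ + _).
    rewrite (horner_coef_wide (n := e)); last first.
      by apply: leq_trans (size_poly _ _) _; apply: size_poly.
    rewrite mulr_suml; apply: eq_bigr => a _.
    rewrite (bigD1 tt) //= big1 ?addr0; last by case.
    by rewrite coef_map Ra -mulrA.
  have Sz : Sp z.
    by apply: (Sp_sum) => a; apply: (Sp_sum) => j; apply: (SpZ); apply: (Sp_fam).
  (* R(alpha) is the coefficient of v in the dependence relation: if it is 0 the relation
     contradicts the independence of the old family, otherwise it is inverted in k[alpha]. *)
  case: (eqVneq ((map_poly iota R).[alpha]) 0) => Ralpha.
    have R0 : R = 0 by apply: Pmin; [exact: size_poly|apply/rootP].
    apply: hn => -[a [j|[]]]; last by rewrite -Ra R0 coef0.
    move: e1; rewrite Ralpha mul0r addr0 /z pair_bigA /= => hz.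
    exact: (ind (fun aj => c (aj.1, inl aj.2)) hz (a, j)).
  have Ralg : algebraicOver iota (map_poly iota R).[alpha].
    apply/integral_algebraic; apply: integral_horner.
      by apply/integral_poly => j; rewrite coef_map; apply: integral_id.
    apply/integral_algebraic; exists P => //.
    by rewrite -size_poly_eq0 sP.
  have [R' hR'] := algebraic_inverse Ralg Ralpha.
  apply: nv; have -> : v = (map_poly iota (R' \Po R)).[alpha] * ((-1) *: z : M) :> F.
    rewrite scaleN1r; have -> : - z = (map_poly iota R).[alpha] * v :> F.
      by apply/eqP; rewrite eq_sym -addr_eq0 addrC; apply/eqP.
    rewrite map_comp_poly horner_comp mulrA [_ * (map_poly iota R).[_]]mulrC hR' mul1r.
    by [].
  by apply: Sp_poly; apply: (SpZ).
have le1 := card_fam _ _ ind hw.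
have le2 : (h <= e * #|J|)%N.
  have := indep_leq sub0 indb (g := fam J w); rewrite card_prod !card_ord; apply.
  by move=> i; apply: SpV.
by apply/dvdnP; exists #|J|; rewrite mulnC; apply/eqP; rewrite eqn_leq le1 le2.
Qed.

End ScalarRestriction.

Lemma minimal_polynomial (k F : fieldType) (iota : {rmorphism k -> F}) (alpha : F) :
  algebraicOver iota alpha ->
  exists (P : {poly k}) e, [/\ size P = e.+1, root (map_poly iota P) alpha &
    forall R : {poly k}, (size R <= e)%N -> root (map_poly iota R) alpha -> R = 0].
Proof.
move=> [P0 P00 rP0].
pose deg d := asb (exists P : {poly k}, [/\ P != 0, root (map_poly iota P) alpha & size P = d]).
have exdeg : exists d, deg d by exists (size P0); apply/asbP; exists P0.
case: (ex_minnP exdeg) => d /asbP [P [P1 hP hd]] dmin.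
exists P, d.-1; split=> //; first by rewrite prednK // -hd lt0n size_poly_eq0.
move=> R sR rR; apply/eqP; apply: contraTT isT => R0.
have := dmin (size R); have -> : deg (size R) by apply/asbP; exists R.
move/(_ isT); have : (0 < d)%N by rewrite -hd lt0n size_poly_eq0.
lia.
Qed.

Lemma rank_matrix_of (L : fieldType) (m m' N : nat) (f : nat -> 'I_N -> L) : m = m' ->
  \rank (\matrix_(a < m, j < N) f a j) = \rank (\matrix_(a < m', j < N) f a j).
Proof. by move=> ->. Qed.

Lemma nth_map0 (A B : nmodType) (f : {additive A -> B}) (s : seq A) a :
  (map f s)`_a = f s`_a.
Proof.
case: (ltnP a (size s)) => h; first by rewrite (nth_map 0).
by rewrite !nth_default ?raddf0 // size_map.
Qed.

(** * Generic and closed points of the curve over extension fields *)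

Section Curve.
Variables (K : fieldType) (n : nat) (eqs : seq {mpoly K[n.+1]}).
Variables (D N0 : nat) (bK : forall d, 'I_(D * d + 1) -> {mpoly K[n.+1]}).
Hypotheses (D_gt0 : (0 < D)%N)
  (eqs_homog : forall p, p \in eqs -> p \is homog mdeg)
  (bK_basis : forall d, (N0 <= d)%N -> graded_basis (ideal_gen eqs) d (@bK d))
  (smooth : forall (L : fieldType) (kappa : {rmorphism K -> L}) (y : 'I_n.+1 -> L),
     (exists j, y j != 0) -> (forall p, p \in eqs -> mmap kappa y p = 0) ->
     (\rank (\matrix_(a < size eqs, j < n.+1) mmap kappa y (eqs`_a)^`M(j))).+1 = n).

(* The point x of C over F is the generic point of the base change of C to k,
   normalized by x_i = 1; its Hilbert function is still that of C. *)
Record generic_point (k : fieldType) (iota0 : {rmorphism K -> k}) (F : fieldType)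
    (iota : {rmorphism k -> F}) (x : 'I_n.+1 -> F) (i : 'I_n.+1) : Prop := GenericPoint {
  gp_norm : x i = 1;
  gp_eqs : forall p, p \in eqs -> mmap (iota \o iota0) x p = 0;
  gp_indep : forall d, (N0 <= d)%N ->
    indep (eval_kernel iota x) (fun j => map_mpoly iota0 (@bK d j));
  gp_frac : forall z : F, exists p q : {mpoly k[n.+1]},
    mmap iota x q != 0 /\ z = mmap iota x p / mmap iota x q }.

Section OverField.
Variables (k : fieldType) (iota0 : {rmorphism K -> k}).

Definition eqs_ext := [seq map_mpoly iota0 p | p <- eqs].

Lemma homog_map_mpoly d (p : {mpoly K[n.+1]}) : p \is d.-homog -> map_mpoly iota0 p \is d.-homog.
Proof.
move=> hp; apply/dhomogP => m; rewrite mcoeff_msupp mcoeff_map_mpoly fmorph_eq0.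
by rewrite -mcoeff_msupp => /(dhomog_mf hp).
Qed.

Lemma eqs_ext_homog p : p \in eqs_ext -> p \is homog mdeg.
Proof.
move=> /mapP [q /eqs_homog /homogP [d hd] ->]; apply/homogP; exists d.
exact: homog_map_mpoly.
Qed.

(** Monomials are defined over K, so the K-basis spans over k. The coefficients are chosen before
    the point x, which lets [rational_point] evaluate one relation at two points. *)
Lemma spanned_base_change d (p : {mpoly k[n.+1]}) : (N0 <= d)%N -> p \is d.-homog ->
  exists c, forall (F : fieldType) (iota : {rmorphism k -> F}) x,
    (forall q, q \in eqs -> mmap (iota \o iota0) x q = 0) ->
    eval_kernel iota x (p - \sum_j c j *: map_mpoly iota0 (@bK d j)).
Proof.
move=> hd hp; have [h1 h2 h3] := bK_basis hd.
rewrite (mpolyE p) big_seq.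
elim/big_ind: _ => [|u v [c hc] [c' hc']|m hmp].
- exists (fun=> 0) => F iota x _; rewrite big1 ?subrr; last by move=> j _; rewrite scale0r.
  exact: mmap0.
- exists (fun j => c j + c' j) => F iota x hx.
  have [_ ZD _] := eval_kernel_submodule iota x.
  under eq_bigr do rewrite scalerDl.
  by rewrite big_split opprD addrACA; apply: ZD; [exact: hc|exact: hc'].
have [|c [c' hc]] := h3 'X_[m]; first by rewrite dhomogX /= (dhomog_mf hp hmp).
exists (fun j => p@_m * iota0 (c j)) => F iota x hx.
have [_ _ ZS] := eval_kernel_submodule iota x.
under eq_bigr do rewrite -scalerA.
rewrite -scaler_sumr -scalerBr; apply: ZS; rewrite /eval_kernel.
have -> : 'X_[m] - \sum_j iota0 (c j) *: map_mpoly iota0 (@bK d j) =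
    map_mpoly iota0 ('X_[m] - \sum_j c j *: @bK d j).
  rewrite raddfB /= map_mpolyX (raddf_sum (map_mpoly iota0)); congr (_ - _).
  by apply: eq_bigr => j _; rewrite /= map_mpolyZ.
rewrite mmap_map_mpoly hc (raddf_sum (mmap _ _)) big1 // => j _ /=.
by rewrite rmorphM /= [X in _ * X]hx ?mulr0 // mem_nth.
Qed.

Lemma generic_basis (F : fieldType) (iota : {rmorphism k -> F}) x i d : generic_point iota0 iota x i ->
  (N0 <= d)%N ->
  graded_basis (eval_kernel iota x) d (fun j => map_mpoly iota0 (@bK d j)).
Proof.
move=> gp hd; have [h1 h2 h3] := bK_basis hd; split.
- by move=> j; apply: homog_map_mpoly.
- exact: gp_indep gp _ hd.
move=> p hp; have [c hc] := spanned_base_change hd hp.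
by exists c; apply: hc; apply: gp_eqs gp.
Qed.

Lemma generic_rescale (F : fieldType) (iota : {rmorphism k -> F}) x i j : generic_point iota0 iota x i ->
  x j != 0 -> generic_point iota0 iota (fun l => (x j)^-1 * x l) j.
Proof.
move=> gp xj; split.
- by rewrite mulVf.
- move=> p hp; have /homogP [d hd] := eqs_homog hp.
  by rewrite (mmap_scale _ _ _ hd) (gp_eqs gp) // mulr0.
- move=> d hd; have [h1 h2 _] := generic_basis gp hd.
  move=> c; rewrite /eval_kernel => hc; apply: h2; apply/eqP; move/eqP: hc.
  have hs : \sum_l c l *: map_mpoly iota0 (@bK d l) \is d.-homog.
    by apply: rpred_sum => l _; apply: rpredZ.
  by rewrite (mmap_scale _ _ _ hs) mulf_eq0 expf_eq0 invr_eq0 (negbTE xj) andbF.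
- move=> z; have [p [q [hq ->]]] := gp_frac gp z.
  pose m := maxn (msize p) (msize q).
  have hp' := mmap_homogenize (p := p) (d := m) iota (gp_norm gp) (leqW (leq_maxl _ _)).
  have hq' := mmap_homogenize (p := q) (d := m) iota (gp_norm gp) (leqW (leq_maxr _ _)).
  exists (homogenize i m p), (homogenize i m q).
  rewrite !(mmap_scale _ _ _ (homogenize_homog i m _)) hp' hq'.
  have xm : (x j)^-1 ^+ m != 0 by rewrite expf_neq0 // invr_neq0.
  by rewrite mulf_neq0 // -mulf_div divff // mul1r.
Qed.

Section Specialization.
Variables (F : fieldType) (iota : {rmorphism k -> F}) (x : 'I_n.+1 -> F) (i : 'I_n.+1).
Hypothesis gp : generic_point iota0 iota x i.
Local Notation S := {mpoly k[n.+1]}.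

(** A form b of degree d0 that lies in Q and is nonzero on the curve leaves at most D d0 dimensions
    of S/Q in large degrees. So the D d0 + 1 forms X_j^l X_i'^(d - l) are dependent modulo Q, which
    is an equation for y_j. *)
Lemma algebraic_point (Q : S -> Prop) d0 b (L : fieldType) (kappa : {rmorphism k -> L}) y i' :
  ring_ideal Q -> (forall p, point_ideal iota x p -> Q p) ->
  b \is d0.-homog -> Q b -> mmap iota x b != 0 -> y i' = 1 ->
  (forall d p, p \is d.-homog -> Q p -> mmap kappa y p = 0) ->
  forall j, algebraicOver kappa (y j).
Proof.
move=> QI subQ hb Qb bx yi' Qhom j.
pose c := (D * d0)%N; pose j0 := maxn N0 c; pose d := (d0 + j0)%N.
have cd : (c <= d)%N by rewrite /d /j0; lia.
pose f (l : 'I_c.+1) : S := 'X_j ^+ l * 'X_i' ^+ (d - l).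
have hf l : f l \is d.-homog.
  have := dhomogM (homog_Xn k j l) (homog_Xn k i' (d - l)); rewrite subnKC //.
  by apply: leq_trans cd; rewrite -ltnS.
have [b1 b2 _] := generic_basis gp (leq_maxl N0 c : (N0 <= j0)%N).
have [b1' _ b3'] := generic_basis gp (leq_trans (leq_maxl N0 c) (leq_addl d0 j0) : (N0 <= d)%N).
have xprime : proj_prime (point_ideal iota x).
  by apply: point_ideal_prime; exists i; rewrite (gp_norm gp) oner_neq0.
have subZ : submodule (point_ideal iota x).
  by apply: ideal_submodule; have [[]] := xprime.
have nind : ~ indep Q f.
  move=> indQ.
  have ind2 : indep (point_ideal iota x) (fun l => b * map_mpoly iota0 (@bK j0 l)).
    move=> c' /(_ (d0 + j0)%N); rewrite pihomog_dE; last first.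
      apply: rpred_sum => l _; apply: rpredZ; exact: dhomogM.
    move=> hc; apply: b2; rewrite /eval_kernel.
    apply: (mulfI bx); rewrite mulr0 -[RHS]hc -rmorphM /= mulr_sumr.
    by congr mmap; apply: eq_bigr => l _; rewrite scalerAr.
  have Jg l : Q (b * map_mpoly iota0 (@bK j0 l)).
    by rewrite mulrC; have [_ _] := QI; apply.
  have ind := indep_sum (ideal_submodule QI) subQ indQ ind2 Jg.
  have := indep_leq subZ ind (g := fun l => map_mpoly iota0 (@bK d l)).
  rewrite card_sum !card_ord => le.
  have : (c.+1 + (D * j0 + 1) <= D * d + 1)%N; last by rewrite /d /c; lia.
  have sp (p : S) : p \is d.-homog ->
      spanned (point_ideal iota x) (fun l => map_mpoly iota0 (@bK d l)) p.
    move=> hp; have [c' hc'] := b3' p hp; exists c'.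
    have hpc : p - \sum_l c' l *: map_mpoly iota0 (@bK d l) \is d.-homog.
      by apply: rpredB => //; apply: rpred_sum => l _; apply: rpredZ.
    exact/(point_ideal_homog iota x hpc).
  by apply: le => -[l|l]; apply: sp => //=; exact: dhomogM.
have [c' hc'] := not_all_ex_not _ _ nind; have [hc1 hc2] := imply_to_and _ _ hc'.
have [l hl] := not_all_ex_not _ _ hc2.
exists (\poly_(t < c.+1) (if insub t is Some t' then c' t' else 0)).
  apply/eqP => h0; apply: hl; have := congr1 (fun P : {poly k} => P`_l) h0.
  by rewrite coef_poly ltn_ord valK coef0.
have hs : \sum_l c' l *: f l \is d.-homog.
  by apply: rpred_sum => t _; apply: rpredZ.
have := Qhom _ _ hs hc1; rewrite eval_lincomb => e.
rewrite /root (horner_coef_wide (n := c.+1)); last first.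
  by apply: leq_trans (size_poly _ _) _; apply: size_poly.
rewrite -[X in _ == X]e; apply/eqP; apply: eq_bigr => t _.
rewrite coef_map coef_poly ltn_ord valK; congr (_ * _).
by rewrite /f rmorphM !rmorphXn /= !mmapX !mmap1U yi' expr1n mulr1.
Qed.

Lemma point_local_parameter (L : fieldType) (kappa : {rmorphism k -> L}) y : y i = 1 ->
  (forall p, mmap iota x p = 0 -> mmap kappa y p = 0) -> (forall j, algebraicOver kappa (y j)) ->
  exists theta u : S,
  [/\ mmap kappa y theta = 0, mmap kappa y u != 0 &
    forall p, mmap kappa y p = 0 ->
      exists q, mmap iota x (u * p) = mmap iota x (theta * q)].
Proof.
move=> yi spec yalg.
pose eqs' := eqs_ext.
have eqs'x p : p \in eqs' -> mmap iota x p = 0.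
  by move=> /mapP [q hq ->]; rewrite mmap_map_mpoly; apply: gp_eqs gp _ hq.
have jac : (\rank (\matrix_(l < size eqs', j < n.+1) mmap kappa y (eqs'`_l)^`M(j))).+1 = n.
  rewrite -[RHS](smooth (kappa := kappa \o iota0) (y := y)); last first.
  - move=> p hp; rewrite -mmap_map_mpoly; apply: spec; apply: eqs'x; exact: map_f.
  - by exists i; rewrite yi oner_neq0.
  rewrite (rank_matrix_of (fun l j => mmap kappa y (eqs'`_l)^`M(j)) (size_map _ _)).
  congr (\rank _).+1; apply/matrixP => l j; rewrite !mxE nth_map0.
  by rewrite mderiv_map_mpoly mmap_map_mpoly.
exact: (local_parameter (gp_norm gp) yi spec yalg (fun p hp => eqs_ext_homog hp) eqs'x jac).
Qed.

End Specialization.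

Variables (F : fieldType) (iota : {rmorphism k -> F}) (x : 'I_n.+1 -> F) (i : 'I_n.+1).
Hypothesis gp : generic_point iota0 iota x i.
Local Notation S := {mpoly k[n.+1]}.

Definition graded_value d (z : F) := exists2 q : S, q \is d.-homog & mmap iota x q = z.

Lemma graded_value0 d : graded_value d 0.
Proof. by exists 0; [exact: rpred0|exact: mmap0]. Qed.

Lemma graded_valueD d z z' : graded_value d z -> graded_value d z' -> graded_value d (z + z').
Proof. by move=> [q hq <-] [q' hq' <-]; exists (q + q'); [exact: rpredD|exact: mmapD]. Qed.

Lemma graded_valueM d d' z z' : graded_value d z -> graded_value d' z' ->
  graded_value (d + d') (z * z').
Proof. by move=> [q hq <-] [q' hq' <-]; exists (q * q'); [exact: dhomogM|exact: rmorphM]. Qed.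

Section Conductor.
Variable alpha : F.
Hypothesis alpha_alg : algebraicOver iota alpha.

(** The ideal of denominators of alpha in the homogeneous coordinate ring; it defines the set of
    points at which alpha is not regular. *)
Definition conductor (p : S) := forall d, graded_value d (alpha * mmap iota x (pihomog mdeg d p)).

Lemma conductor_homog d p : p \is d.-homog ->
  conductor p <-> graded_value d (alpha * mmap iota x p).
Proof.
move=> hp; split=> [/(_ d)|h e]; first by rewrite pihomog_dE.
case: (eqVneq d e) => [<-|ne]; first by rewrite pihomog_dE.
by rewrite (pihomog_ne0 ne hp) mmap0 mulr0; apply: graded_value0.
Qed.

Lemma conductor_ideal : ring_ideal conductor.
Proof.
have h0 : conductor 0 by move=> d; rewrite pihomog0 mmap0 mulr0; apply: graded_value0.
have hD p q : conductor p -> conductor q -> conductor (p + q).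
  by move=> hp hq d; rewrite pihomogD mmapD mulrDr; apply: graded_valueD.
split=> // p q hq; apply: (homog_ind (P := fun p => conductor (p * q))) => [||a d].
- by rewrite mul0r.
- by move=> u v hu hv; rewrite mulrDl; apply: hD.
rewrite [pihomog _ _ p * q]mulrC; case: (ltnP d a) => hd.
  by rewrite (pihomogM_lt _ (pihomogP _ _ _)) // mmap0 mulr0; apply: graded_value0.
rewrite -(subnK hd) (pihomogM _ _ (pihomogP _ _ _)) rmorphM /= mulrA.
apply: graded_valueM; first exact: hq.
by exists (pihomog mdeg a p); first exact: pihomogP.
Qed.

Lemma conductor_homog_ideal : is_homog_ideal conductor.
Proof.
move=> p d hp e; case: (eqVneq d e) => [<-|ne]; first by rewrite pihomog_id.
by rewrite (pihomog_ne0 ne (pihomogP _ _ _)) mmap0 mulr0; apply: graded_value0.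
Qed.

(** If alpha is regular everywhere, the parts of large degree of the coordinate ring are vector
    spaces over k(alpha), so e = [k(alpha) : k] divides D d + 1 for all large d. *)
Lemma constant_of_negligible : negligible conductor -> exists c, alpha = iota c.
Proof.
move=> [d0 hd0].
have [P [e [sP rP Pmin]]] := minimal_polynomial alpha_alg.
have dvd d : (maxn d0 N0 <= d)%N -> (e %| D * d + 1)%N.
  rewrite geq_max => /andP [hd hd'].
  have [h1 h2 h3] := generic_basis gp hd'.
  pose b j : scalar_restriction iota := mmap iota x (map_mpoly iota0 (@bK d j)).
  apply: (@degree_dvd _ _ iota alpha P e _ (graded_value d) b) => //.
  - move=> v [q hq <-].
    by apply/(conductor_homog hq)/(irrelevant_sub conductor_ideal hd0 hd hq).
  - move=> c hc; apply: h2; rewrite /eval_kernel eval_lincomb; exact: hc.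
  - by move=> j; exists (map_mpoly iota0 (@bK d j)).
  - move=> v [q hq <-]; have [c hc] := h3 q hq.
    apply/spanned_zeroP; exists c; apply/eqP; rewrite -subr_eq0; apply/eqP.
    by move: hc; rewrite /eval_kernel mmapB eval_lincomb.
(* Two consecutive degrees show that e divides D, hence 1. *)
have e1 : e = 1%N.
  have h1 := dvd _ (leqnn _); have h2 := dvd _ (leqnSn _).
  move: h2; rewrite mulnS -addnA dvdn_addl // => eD.
  apply/eqP; rewrite -dvdn1 -(dvdn_addr 1 (dvdn_mulr (maxn d0 N0) eD)).
  exact: h1.
rewrite e1 in sP; move: rP; rewrite /root (horner_coef_wide (n := 2)); last first.
  by rewrite -sP size_poly.
rewrite big_ord_recl big_ord1 /= !coef_map expr0 mulr1 expr1 => /eqP h.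
have P1 : P`_1 != 0 by have := lead_coef_eq0 P; rewrite lead_coefE sP /= => ->; rewrite -size_poly_eq0 sP.
exists (- (P`_1)^-1 * P`_0); apply: (mulfI (x := iota P`_1)); first by rewrite fmorph_eq0.
rewrite -rmorphM mulrA mulrN mulfV // mulN1r rmorphN; apply/eqP.
by rewrite -addr_eq0 addrC; apply/eqP.
Qed.

(* Smoothness enters here: at a point of C where the conductor vanishes, the local
   ring is a valuation ring, so it contains the constant [alpha]. *)
Lemma no_new_constants : exists c, alpha = iota c.
Proof.
case: (eqVneq alpha 0) => [->|alpha0]; first by exists 0; rewrite rmorph0.
apply: NNPP => hn.
have nneg : ~ negligible conductor by move=> h; apply: hn; apply: constant_of_negligible.
have [Q [hQ subQ]] := exists_proj_prime conductor_ideal conductor_homog_ideal nneg.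
have [primeQ hQh [i' hi']] := hQ.
have [L [kappa [y [yi' Qy _]]]] := proj_prime_point hQ hi'.
have xi'0 : x i' != 0.
  apply/eqP => x0; apply: hi'; apply: subQ.
  apply/(conductor_homog (homog_X k i')); rewrite mmapX mmap1U x0 mulr0.
  exact: graded_value0.
pose x' j := (x i')^-1 * x j.
have gp' : generic_point iota0 iota x' i' by apply: generic_rescale gp xi'0.
have x'i := gp_norm gp'.
have scal d (p : S) : p \is d.-homog -> mmap iota x' p = (x i')^-1 ^+ d * mmap iota x p.
  by move=> hp; rewrite (mmap_scale _ _ _ hp).
have xd d : (x i')^-1 ^+ d != 0 by rewrite expf_neq0 // invr_neq0.
have Qhom d (p : S) : p \is d.-homog -> Q p -> mmap kappa y p = 0.
  by move=> hp /Qy/(point_ideal_homog kappa y hp).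
have spec p : mmap iota x' p = 0 -> mmap kappa y p = 0.
  move=> hp; have hh := homogenize_homog i' (msize p) p.
  rewrite -(mmap_homogenize (d := msize p) kappa yi') //.
  apply: (Qhom _ _ hh); apply: subQ; apply/(conductor_homog hh).
  have : mmap iota x' (homogenize i' (msize p) p) = 0 by rewrite mmap_homogenize.
  rewrite (scal _ _ hh) => /eqP; rewrite mulf_eq0 (negbTE (xd _)) => /eqP ->.
  by rewrite mulr0; apply: graded_value0.
have [a0 [b0 [b00 eab]]] := gp_frac gp alpha.
pose e0 := maxn (msize a0) (msize b0).
pose a := homogenize i e0 a0; pose b := homogenize i e0 b0.
have ha : a \is e0.-homog by apply: homogenize_homog.
have hb : b \is e0.-homog by apply: homogenize_homog.
have xa : mmap iota x a = mmap iota x a0.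
  by apply: mmap_homogenize; [exact: gp_norm gp|exact: leqW (leq_maxl _ _)].
have xb : mmap iota x b = mmap iota x b0.
  by apply: mmap_homogenize; [exact: gp_norm gp|exact: leqW (leq_maxr _ _)].
have bx : mmap iota x b != 0 by rewrite xb.
have abx : alpha * mmap iota x b = mmap iota x a by rewrite xa xb eab divfK.
have Jb : conductor b by apply/(conductor_homog hb); exists a.
have by0 : mmap kappa y b = 0 by apply: (Qhom _ _ hb); apply: subQ.
have bx' : mmap iota x' b != 0 by rewrite (scal _ _ hb) mulf_neq0.
have abx' : alpha * mmap iota x' b = mmap iota x' a.
  by rewrite (scal _ _ hb) (scal _ _ ha) mulrCA abx.
have yalg j : algebraicOver kappa (y j).
  apply: (algebraic_point gp _ _ hb (subQ _ Jb) bx yi' Qhom) => //.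
  - by have [] := primeQ.
  - by move=> p hp; apply: subQ => e; rewrite hp mulr0; apply: graded_value0.
have [theta [u [theta_y u_y theta_gen]]] := point_local_parameter gp' yi' spec yalg.
have ntriv : exists p, mmap kappa y p = 0 /\ mmap iota x' p != 0 by exists b.
have hilb d : (N0 <= d)%N ->
    exists b : 'I_(D * d + 1) -> S, graded_basis (eval_kernel iota x') d b.
  by move=> hd; eexists; apply: generic_basis gp' hd.
have ax' : mmap iota x' a != 0 by rewrite -abx' mulf_neq0.
have [m [s [a1 [sy a1y e1]]]] :=
  discrete_valuation x'i spec hilb theta_y u_y theta_gen ntriv ax'.
have [m' [s' [a2 [sy' a2y e2]]]] :=
  discrete_valuation x'i spec hilb theta_y u_y theta_gen ntriv bx'.
have tx := theta_x spec u_y theta_gen ntriv.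
have nzx := nonzero_x spec.
move: e1 e2; rewrite !rmorphM !rmorphXn /= => e1 e2.
(* Here alpha = a / b. If a vanishes at y at least as much as b, then alpha = g / h with h nonzero
   at y, and the homogenization of h lies in the conductor, which vanishes at y. Otherwise 1 / alpha
   is an algebraic constant with a zero at y. *)
case: (leqP m' m) => hm.
  pose h := s * a2; pose g := theta ^+ (m - m') * a1 * s'.
  have eh : alpha * mmap iota x' h = mmap iota x' g.
    apply: (mulfI (expf_neq0 m' tx)).
    rewrite /h /g !rmorphM rmorphXn /= !mulrA -exprD subnKC //.
    have -> : mmap iota x' theta ^+ m' * alpha * mmap iota x' s * mmap iota x' a2 =
       alpha * mmap iota x' s * (mmap iota x' theta ^+ m' * mmap iota x' a2) by ring.
    rewrite -e2 -e1 -abx'; ring.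
  pose M := maxn (msize h) (msize g).
  have hh := homogenize_homog i' M h; have hg := homogenize_homog i' M g.
  have xh : mmap iota x' (homogenize i' M h) = mmap iota x' h.
    by apply: mmap_homogenize => //; exact: leqW (leq_maxl _ _).
  have xg : mmap iota x' (homogenize i' M g) = mmap iota x' g.
    by apply: mmap_homogenize => //; exact: leqW (leq_maxr _ _).
  have : mmap kappa y h = 0.
    rewrite -(mmap_homogenize (d := M) kappa yi') ?leqW ?leq_maxl //.
    apply: (Qhom _ _ hh); apply: subQ; apply/(conductor_homog hh).
    exists (homogenize i' M g) => //; apply: (mulfI (xd M)).
    by rewrite mulrCA -(scal _ _ hh) -(scal _ _ hg) xh xg.
  by move/eqP; rewrite /h rmorphM mulf_eq0 (negbTE sy) (negbTE a2y).
apply: (@algebraic_unit _ _ _ iota kappa _ x' y spec alpha^-1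
  (theta ^+ (m' - m) * a2 * s) (s' * a1)).
- exact: algebraic_inv.
- by rewrite invr_eq0.
- by rewrite !rmorphM rmorphXn /= theta_y expr0n subn_eq0 leqNgt hm !mul0r.
- by rewrite rmorphM mulf_neq0.
- apply: (mulfI alpha0); rewrite mulrA divff // mul1r.
  apply: (mulfI (expf_neq0 m tx)).
  rewrite !rmorphM rmorphXn /=.
  have -> : mmap iota x' theta ^+ m * (mmap iota x' s' * mmap iota x' a1) =
     mmap iota x' s' * (mmap iota x' theta ^+ m * mmap iota x' a1) by ring.
  rewrite -e1 -abx'.
  have -> : mmap iota x' theta ^+ m *
     (alpha * (mmap iota x' theta ^+ (m' - m) * mmap iota x' a2 * mmap iota x' s)) =
     alpha * mmap iota x' s * (mmap iota x' theta ^+ m * mmap iota x' theta ^+ (m' - m) * mmap iota x' a2)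
     by ring.
  rewrite -exprD subnKC; last exact: ltnW.
  by rewrite -e2; ring.
Qed.

End Conductor.
End OverField.
End Curve.

(** * Base change to a field with a rational point *)

Section FieldLift.
Variables (S : comNzRingType) (F T : fieldType) (phi : {rmorphism S -> F}) (psi : {rmorphism S -> T}).
Hypotheses (phi_frac : forall z, exists a b, phi b <> 0 /\ z = phi a / phi b)
  (same_kernel : forall p, phi p = 0 <-> psi p = 0).

(** F consists of quotients of values of [phi], so psi(a) / psi(b) is the only possible image of
    phi(a) / phi(b); equality of the kernels makes it well defined. *)
Lemma field_lift : exists h : {rmorphism F -> T}, forall p, h (phi p) = psi p.
Proof.
have [num hnum] := choice _ phi_frac; have [den hden] := choice _ hnum.
pose h z := psi (num z) / psi (den z).
have psi0 b : phi b <> 0 -> psi b != 0 by move=> h0; apply/eqP => /same_kernel.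
have hE a b : phi b <> 0 -> h (phi a / phi b) = psi a / psi b.
  move=> b0; rewrite /h; have [d0 ez] := hden (phi a / phi b).
  set z := phi a / phi b in d0 ez *.
  apply/eqP; rewrite eqr_div ?psi0 // -!rmorphM -subr_eq0 -rmorphB; apply/eqP/same_kernel.
  apply/eqP; rewrite rmorphB subr_eq0 !rmorphM /= -eqr_div; last exact/eqP.
    by rewrite -ez.
  exact/eqP.
have hphi p : h (phi p) = psi p.
  have : phi 1 <> 0 by rewrite rmorph1; apply/eqP/oner_neq0.
  by move/(hE p); rewrite !rmorph1 !divr1.
have hB : {morph h : u v / u - v}.
  move=> u v; have [du eu] := hden u; have [dv ev] := hden v.
  have duv : phi (den u * den v) <> 0.
    by apply/eqP; rewrite rmorphM mulf_neq0 //; apply/eqP.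
  have -> : u - v = phi (num u * den v - num v * den u) / phi (den u * den v).
    rewrite {1}eu {1}ev -mulNr addf_div; try exact/eqP.
    by rewrite rmorphB !rmorphM mulNr.
  by rewrite hE // /h rmorphB !rmorphM -[in RHS]mulNr addf_div ?psi0 // mulNr.
have hM : {morph h : u v / u * v}.
  move=> u v; have [du eu] := hden u; have [dv ev] := hden v.
  have duv : phi (den u * den v) <> 0.
    by apply/eqP; rewrite rmorphM mulf_neq0 //; apply/eqP.
  have -> : u * v = phi (num u * num v) / phi (den u * den v).
    transitivity (phi (num u) / phi (den u) * (phi (num v) / phi (den v))); first by rewrite -eu -ev.
    by rewrite mulf_div !rmorphM.
  by rewrite hE // /h mulf_div !rmorphM.
have h1 : h 1 = 1 by rewrite -(rmorph1 phi) hphi rmorph1.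
pose hr : {rmorphism F -> T} := HB.pack_for {rmorphism F -> T} h
  (GRing.isZmodMorphism.Build F T h hB) (GRing.isMonoidMorphism.Build F T h (conj h1 hM)).
by exists hr.
Qed.
End FieldLift.

Section PolynomialExtension.
Variable F : fieldType.

Lemma irreducible_dvdM (f a b : {poly F}) : irreducible_poly f -> f %| a * b -> f %| a \/ f %| b.
Proof.
move=> irr; case: (boolP (f %| a)) => [|na]; first by left.
rewrite Gauss_dvdpr; first by right.
by rewrite irreducible_poly_coprime.
Qed.

Lemma irreducible_extension (f : {poly F}) : irreducible_poly f ->
  exists (F' : fieldType) (phi : {rmorphism {poly F} -> F'}), forall p, phi p = 0 <-> f %| p.
Proof.
move=> irr; have [||||| F' [phi [h _]]] := @prime_ideal_field _ (fun p : {poly F} => f %| p).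
- exact: dvdp0.
- by move=> p q; apply: dvdp_add.
- by move=> p q; apply: dvdp_mull.
- move/(dvdp_leq (oner_neq0 _)); rewrite size_poly1; have := irr.1; by case: (size f) => [|[]].
- by move=> p q; apply: irreducible_dvdM.
by exists F', phi.
Qed.

Lemma irreducible_factor (p : {poly F}) : (1 < size p)%N ->
  exists f, irreducible_poly f /\ f %| p.
Proof.
move=> sp; pose Pd d := asb (exists f : {poly F}, [/\ (1 < size f)%N, f %| p & size f = d]).
have exP : exists d, Pd d by exists (size p); apply/asbP; exists p.
case: (ex_minnP exP) => d /asbP [f [sf fp <-]] dmin; exists f; split=> //.
split=> // q sq qf; rewrite -dvdp_size_eqp //.
have f0 : f != 0 by rewrite -size_poly_gt0 ltnW.
have q0 : q != 0 by apply: contraTneq qf => ->; rewrite dvd0p.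
rewrite eqn_leq dvdp_leq ?dmin //.
apply/asbP; exists q; split=> //; last exact: dvdp_trans qf fp.
by rewrite ltn_neqAle eq_sym sq size_poly_gt0.
Qed.
End PolynomialExtension.

Lemma splitting_extension (m : nat) (F : fieldType) (p : {poly F}) : (size p <= m.+1)%N -> p \is monic ->
  exists (F' : fieldType) (j : {rmorphism F -> F'}) (rs : seq F'),
    map_poly j p = \prod_(r <- rs) ('X - r%:P).
Proof.
elim: m F p => [|m IH] F p sp mp.
  exists F, idfun, [::]; rewrite big_nil map_poly_id // [p]size1_polyC //.
  have e0 : (size p).-1 = 0%N by apply/eqP; rewrite -leqn0 -subn1 leq_subLR.
  by move: mp; rewrite monicE lead_coefE e0 => /eqP ->.
case: (ltnP 1 (size p)) => s1; last by apply: IH => //; apply: leq_trans s1 _.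
have [f [irr fp]] := irreducible_factor s1.
have [F1 [phi hphi]] := irreducible_extension irr.
pose j1 : {rmorphism F -> F1} := phi \o polyC.
have rt : root (map_poly j1 p) (phi 'X).
  have h q : (map_poly j1 q).[phi 'X] = phi q.
    elim/poly_ind: q => [|q c IHq]; first by rewrite !rmorph0 horner0.
    by rewrite rmorphD rmorphM /= map_polyX map_polyC hornerMXaddC IHq rmorphD rmorphM.
  by apply/rootP; rewrite h; apply/hphi.
have [q eq] := factor_theorem _ _ rt.
have mq : q \is monic by rewrite -(monicMr _ (monicXsubC (phi 'X))) -eq map_monic.
have sq : (size q <= m.+1)%N.
  have : size (map_poly j1 p) = (size q).+1.
    by rewrite eq size_Mmonic ?monicXsubC ?monic_neq0 // size_XsubC addn2.
  by rewrite size_map_poly => e; move: sp; rewrite e ltnS.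
have [F' [j [rs hrs]]] := IH F1 q sq mq.
exists F', (j \o j1), (rcons rs (j (phi 'X))).
rewrite big_rcons /= -hrs map_poly_comp eq rmorphM /=.
by rewrite rmorphB /= map_polyX map_polyC.
Qed.

Lemma coef_prod_algebraic (k F : fieldType) (iota : {rmorphism k -> F}) (rs : seq F) :
  (forall r, r \in rs -> algebraicOver iota r) ->
  forall i, algebraicOver iota (\prod_(r <- rs) ('X - r%:P))`_i.
Proof.
elim: rs => [|r rs IH] h i.
  by rewrite big_nil coef1; case: eqP => _; [exact: algebraic1|exact: algebraic0].
rewrite big_cons mulrBl coefB coefXM coefCM; apply: algebraic_sub.
  case: eqP => _; first exact: algebraic0.
  by apply: IH => r' hr'; apply: h; rewrite inE hr' orbT.
apply: algebraic_mul; first by apply: h; rewrite mem_head.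
by apply: IH => r' hr'; apply: h; rewrite inE hr' orbT.
Qed.

Lemma algebraic_inj (k F F' : fieldType) (iota : {rmorphism k -> F}) (j : {rmorphism F -> F'}) z :
  algebraicOver (j \o iota) (j z) -> algebraicOver iota z.
Proof.
by move=> [P P0 hP]; exists P => //; move: hP; rewrite map_poly_comp fmorph_root.
Qed.

(* The coefficients of a factor over F are algebraic over k. *)
Lemma irreducible_stays (k F : fieldType) (iota : {rmorphism k -> F}) (P : {poly k}) :
  (forall alpha, algebraicOver iota alpha -> exists c, alpha = iota c) ->
  irreducible_poly P -> irreducible_poly (map_poly iota P).
Proof.
move=> closed [sP irr]; split; first by rewrite size_map_poly.
have P0 : map_poly iota P != 0 by rewrite map_poly_eq0 -size_poly_gt0 ltnW.
move=> q sq qP.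
have q0 : q != 0 by apply: contraTneq qP => ->; rewrite dvd0p.
pose q1 := (lead_coef q)^-1 *: q.
have lq : lead_coef q != 0 by rewrite lead_coef_eq0.
have mq1 : q1 \is monic by rewrite monicE lead_coefZ mulVf.
have q1q : q1 %= q by rewrite eqp_scale // invr_eq0.
have [F' [j [rs hrs]]] := splitting_extension (leqnSn _) mq1.
have hq1 i : exists c, q1`_i = iota c.
  apply: closed; apply: (algebraic_inj (j := j)); rewrite -coef_map hrs.
  apply: coef_prod_algebraic => r hr; exists P; first by rewrite -size_poly_gt0 ltnW.
  have hd : map_poly j q1 %| map_poly j (map_poly iota P).
    by rewrite dvdp_map (eqp_dvdl _ q1q).
  rewrite map_poly_comp; apply: (root_dvdp hd).
  by rewrite hrs root_prod_XsubC.
have [c hc] := choice _ hq1.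
pose Q := \poly_(i < size q1) c i.
have eQ : q1 = map_poly iota Q.
  apply/polyP => i; rewrite coef_map coef_poly; case: ltnP => h; first exact: hc.
  by rewrite nth_default // raddf0.
have QP : Q %| P by rewrite -(dvdp_map iota) -eQ (eqp_dvdl _ q1q).
have sQ : size Q != 1%N by rewrite -(size_map_poly iota) -eQ size_scale ?invr_eq0.
by rewrite -(eqp_ltrans q1q) eQ eqp_map; exact: irr.
Qed.

Lemma minimal_irreducible (k F : fieldType) (iota : {rmorphism k -> F}) alpha (P : {poly k}) e :
  size P = e.+1 -> root (map_poly iota P) alpha ->
  (forall R : {poly k}, (size R <= e)%N -> root (map_poly iota R) alpha -> R = 0) ->
  irreducible_poly P /\ forall R, (P %| R) = root (map_poly iota R) alpha.
Proof.
move=> sP rP Pmin.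
have P0 : P != 0 by rewrite -size_poly_eq0 sP.
have dvd R : (P %| R) = root (map_poly iota R) alpha.
  apply/idP/idP => [|h]; first by rewrite -(dvdp_map iota) => /root_dvdp; apply.
  rewrite -[P %| R]/(R %% P == 0); apply/eqP/Pmin.
    by rewrite -ltnS -sP ltn_modp.
  move: h; rewrite {1}(divp_eq R P) rmorphD rmorphM /= /root hornerD hornerM (rootP rP) mulr0 add0r.
  by [].
split=> //; split.
  rewrite sP ltnS lt0n; apply/eqP => e0; move: sP; rewrite e0 => /eqP/size_poly1P [c c0 ec].
  by move: rP; rewrite ec map_polyC rootC fmorph_eq0 (negbTE c0).
move=> q sq /dvdpP [r er].
have r0 : r != 0 by apply: contraNneq P0 => r0; rewrite er r0 mul0r.
have q0 : q != 0 by apply: contraNneq P0 => q0; rewrite er q0 mulr0.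
have sz : (size r + size q = e.+2)%N.
  by move: sP; rewrite er size_mul // => h; rewrite -(prednK (n := (size r + size q)%N)) ?h // addn_gt0 size_poly_gt0 r0.
have q1 : (1 < size q)%N by rewrite ltn_neqAle eq_sym sq size_poly_gt0.
rewrite /eqp er dvdp_mull //= -er dvd.
move: rP; rewrite er rmorphM rootM => /orP [rr|//].
have := Pmin r _ rr; move=> h; case/negP: r0; apply/eqP/h.
by move: sz q1; clear; lia.
Qed.

Section Extension.
Variables (K : fieldType) (n : nat) (eqs : seq {mpoly K[n.+1]}).
Variables (D N0 : nat) (bK : forall d, 'I_(D * d + 1) -> {mpoly K[n.+1]}).
Hypotheses (D_gt0 : (0 < D)%N)
  (eqs_homog : forall p, p \in eqs -> p \is homog mdeg)
  (bK_basis : forall d, (N0 <= d)%N -> graded_basis (ideal_gen eqs) d (@bK d))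
  (smooth : forall (L : fieldType) (kappa : {rmorphism K -> L}) (y : 'I_n.+1 -> L),
     (exists j, y j != 0) -> (forall p, p \in eqs -> mmap kappa y p = 0) ->
     (\rank (\matrix_(a < size eqs, j < n.+1) mmap kappa y (eqs`_a)^`M(j))).+1 = n).

Local Notation generic := (generic_point eqs N0 bK).

(** Passing to the fraction field of the image of evaluation restores [gp_frac], which may fail
    after an extension of the ambient field. *)
Lemma shrink_generic (k : fieldType) (iota0 : {rmorphism K -> k}) (F : fieldType)
    (iota : {rmorphism k -> F}) x i : x i = 1 ->
  (forall p, p \in eqs -> mmap (iota \o iota0) x p = 0) ->
  (forall d, (N0 <= d)%N -> indep (eval_kernel iota x) (fun j => map_mpoly iota0 (@bK d j))) ->
  exists (F' : fieldType) (iota' : {rmorphism k -> F'}) x', generic iota0 iota' x' i.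
Proof.
move=> xi ex hx.
have [||||| F' [phi [ker frac]]] := @prime_ideal_field _ (eval_kernel iota x); rewrite /eval_kernel.
- exact: mmap0.
- by move=> p q hp hq; rewrite mmapD hp hq addr0.
- by move=> p q hq; rewrite rmorphM /= hq mulr0.
- by move/eqP; rewrite rmorph1 oner_eq0.
- by move=> p q /eqP; rewrite rmorphM mulf_eq0 => /orP [] /eqP; auto.
have [iota' phiE] := mpolyC_iota phi.
have kerE p : mmap iota' (fun j => phi 'X_j) p = 0 <-> mmap iota x p = 0.
  by rewrite -phiE; apply: ker.
exists F', iota', (fun j => phi 'X_j); split.
- apply/eqP; rewrite -subr_eq0 -[1](rmorph1 phi) -rmorphB; apply/eqP/ker.
  by rewrite /eval_kernel mmapB rmorph1 mmapX mmap1U xi subrr.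
- by move=> p hp; rewrite -mmap_map_mpoly; apply/kerE; rewrite mmap_map_mpoly; apply: ex.
- by move=> d hd c /kerE /(hx d hd).
- by move=> z; have [a [b [hb ->]]] := frac z; exists a, b; rewrite -!phiE; split=> //; apply/eqP.
Qed.

(** As F has no new constants, the minimal polynomial P of z stays irreducible over F. Adjoining a
    root of P to k and to F then gives extensions of the same degree e, and families independent
    over k remain so over k'. The map j' sends the adjoined root to z. *)
Lemma generic_extension (k : fieldType) (iota0 : {rmorphism K -> k}) (F : fieldType)
    (iota : {rmorphism k -> F}) x i (T : fieldType) (j : {rmorphism k -> T}) z :
  generic iota0 iota x i -> algebraicOver j z ->
  exists (k' : fieldType) (h : {rmorphism k -> k'}) (j' : {rmorphism k' -> T}),
    [/\ forall c, j' (h c) = j c, exists z', j' z' = z &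
      exists (F' : fieldType) (iota' : {rmorphism k' -> F'}) x', generic (h \o iota0) iota' x' i].
Proof.
move=> gp zalg.
have [P [e [sP rP Pmin]]] := minimal_polynomial zalg.
have [irrP dvdP] := minimal_irreducible sP rP Pmin.
have closed alpha : algebraicOver iota alpha -> exists c, alpha = iota c.
  exact: (no_new_constants D_gt0 eqs_homog bK_basis smooth gp).
have irrF := irreducible_stays closed irrP.
have [||||| k' [phi [kerk frac]]] := @prime_ideal_field _ (fun p : {poly k} => P %| p).
- exact: dvdp0.
- by move=> p q; apply: dvdp_add.
- by move=> p q; apply: dvdp_mull.
- move/(dvdp_leq (oner_neq0 _)); rewrite size_poly1; have := irrP.1; by case: (size P) => [|[]].
- by move=> p q; apply: irreducible_dvdM.
have [F' [psi kerF]] := irreducible_extension irrF.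
pose evz : {rmorphism {poly k} -> T} := horner_eval z \o map_poly j.
have [|j' hj'] := field_lift (psi := evz) frac.
  by move=> p; rewrite kerk dvdP; split=> [/rootP|h]; [|apply/rootP].
pose phi' : {rmorphism {poly k} -> F'} := psi \o map_poly iota.
have [|g hg] := field_lift (psi := phi') frac.
  by move=> p; rewrite kerk /phi' /= kerF dvdp_map.
pose h : {rmorphism k -> k'} := phi \o polyC.
pose iF : {rmorphism F -> F'} := psi \o polyC.
have gh c : g (h c) = iF (iota c) by rewrite /h /= hg /phi' /= map_polyC.
exists k', h, j'; split.
- by move=> c; rewrite /h /= hj' /evz /= map_polyC /horner_eval hornerC.
- by exists (phi 'X); rewrite hj' /evz /= map_polyX /horner_eval hornerX.
apply: (shrink_generic (iota := g) (x := fun l => iF (x l)) (i := i)).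
- by rewrite (gp_norm gp) rmorph1.
- move=> p hp; rewrite -(rmorph0 iF) -(gp_eqs gp hp) rmorph_mmap_comp.
  by apply: eq_mmap => // c; rewrite /= gh.
- move=> d hd c; rewrite /eval_kernel eval_lincomb => hc l.
  have surj u : exists p : {poly k}, (size p <= e)%N /\ u = phi p.
    have [a [b [b0 ->]]] := frac u.
    have balg : algebraicOver h (phi b).
      have hX : algebraicOver h (phi 'X).
        exists P; first by rewrite -size_poly_eq0 sP.
        apply/rootP; have hE q : (map_poly h q).[phi 'X] = phi q.
          elim/poly_ind: q => [|q c' IHq]; first by rewrite !rmorph0 horner0.
          by rewrite rmorphD rmorphM /= map_polyX map_polyC hornerMXaddC IHq rmorphD rmorphM.
        by rewrite hE; apply/kerk.
      elim/poly_ind: b {b0} => [|q c' IHq]; first by rewrite rmorph0; apply: algebraic0.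
      rewrite rmorphD rmorphM; apply: algebraic_add; first exact: algebraic_mul.
      by rewrite -[phi c'%:P]/(h c'); apply: algebraic_id.
    have [R hR] := algebraic_inverse balg (introN eqP b0).
    have hR' : (map_poly h R).[phi b] = phi (R \Po b).
      elim/poly_ind: R {hR} => [|q c' IHq]; first by rewrite comp_poly0 !rmorph0 horner0.
      rewrite rmorphD rmorphM /= map_polyX map_polyC hornerMXaddC IHq.
      by rewrite comp_polyD comp_polyM comp_polyX comp_polyC rmorphD rmorphM.
    have -> : phi a / phi b = phi (a * (R \Po b)).
      rewrite rmorphM -hR'; congr (_ * _); apply: (mulfI (introN eqP b0)).
      by rewrite hR mulfV //; apply/eqP.
    set w := a * _; exists (w %% P); split; first by rewrite -ltnS -sP ltn_modp -size_poly_eq0 sP.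
    rewrite {1}(divp_eq w P) rmorphD rmorphM.
    have -> : phi P = 0 by apply/kerk.
    by rewrite mulr0 add0r.
  have [r hr] := choice _ (fun l => surj (c l)).
  pose B l := mmap iota x (map_mpoly iota0 (@bK d l)).
  have eB l' : mmap g (fun l => iF (x l)) (map_mpoly (h \o iota0) (@bK d l')) = iF (B l').
    rewrite mmap_map_mpoly /B mmap_map_mpoly rmorph_mmap_comp.
    by apply: eq_mmap => // c'; rewrite /= gh.
  have : psi (\sum_l' (B l')%:P * map_poly iota (r l')) = 0.
    rewrite -[RHS]hc rmorph_sum; apply: eq_bigr => l' _.
    rewrite eB (hr l').2 hg rmorphM mulrC; congr (_ * _).
  move/kerF; set W := \sum_l' _ => dW.
  (* W has degree less than e, so it can only be a multiple of P by being 0. *)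
  have W0 : W = 0.
    apply/eqP; apply: contraTT dW => W0; apply/negP => /(dvdp_leq W0).
    rewrite size_map_poly sP leqNgt ltnS; case/negP.
    apply: (leq_trans (size_sum _ _ _)); apply/bigmax_leqP => l' _.
    by rewrite mul_polyC; apply: leq_trans (size_scale_leq _ _) _; rewrite size_map_poly (hr l').1.
  have r0 : r l = 0.
    apply/polyP => a; rewrite coef0.
    apply: (gp_indep gp hd (c := fun l' => (r l')`_a)).
    rewrite /eval_kernel eval_lincomb.
    have : W`_a = 0 by rewrite W0 coef0.
    rewrite coef_sum => e0; rewrite -[RHS]e0.
    by apply: eq_bigr => l' _; rewrite coefCM coef_map mulrC.
  by rewrite (hr l).2 r0 rmorph0.
Qed.

Lemma generic_tower (T : fieldType) (zs : seq T) (k : fieldType) (iota0 : {rmorphism K -> k})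
    (F : fieldType) (iota : {rmorphism k -> F}) x i (j : {rmorphism k -> T}) :
  generic iota0 iota x i -> (forall z, z \in zs -> algebraicOver j z) ->
  exists (L : fieldType) (h : {rmorphism k -> L}) (j' : {rmorphism L -> T}),
    [/\ forall c, j' (h c) = j c, forall z, z \in zs -> exists z', j' z' = z &
      exists (F' : fieldType) (iota' : {rmorphism L -> F'}) x', generic (h \o iota0) iota' x' i].
Proof.
elim: zs k iota0 F iota x j => [|z zs IH] k iota0 F iota x j gp hz.
  by exists k, idfun, j; split=> //; exists F, iota, x; case: gp => *; split.
have [k' [h [j' [hj [z' hz'] [F' [iota' [x' gp']]]]]]] := generic_extension gp (hz z (mem_head _ _)).
have [|L [h2 [j2 [hj2 hz2 [F2 [iota2 [x2 gp2]]]]]]] := IH _ _ _ _ _ j' gp'.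
  move=> u hu; have [P P0 hP] : algebraicOver j u by apply: hz; rewrite inE hu orbT.
  exists (map_poly h P); first by rewrite map_poly_eq0.
  rewrite -map_poly_comp; congr (root _ u): hP.
  by apply: eq_map_poly => c /=; rewrite hj.
exists L, (h2 \o h), j2; split.
- by move=> c /=; rewrite hj2.
- move=> u; rewrite inE => /orP [/eqP ->|/hz2 //].
  by exists (h2 z'); rewrite hj2.
- by exists F2, iota2, x2; case: gp2 => *; split.
Qed.

End Extension.

Section RationalPoint.
Variables (K : fieldType) (n : nat) (eqs : seq {mpoly K[n.+1]}).
Variables (D N0 : nat) (bK : forall d, 'I_(D * d + 1) -> {mpoly K[n.+1]}).
Hypotheses (D_gt0 : (0 < D)%N)
  (eqs_homog : forall p, p \in eqs -> p \is homog mdeg)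
  (bK_basis : forall d, (N0 <= d)%N -> graded_basis (ideal_gen eqs) d (@bK d))
  (smooth : forall (L : fieldType) (kappa : {rmorphism K -> L}) (y : 'I_n.+1 -> L),
     (exists j, y j != 0) -> (forall p, p \in eqs -> mmap kappa y p = 0) ->
     (\rank (\matrix_(a < size eqs, j < n.+1) mmap kappa y (eqs`_a)^`M(j))).+1 = n)
  (eqs_prime : proj_prime (ideal_gen eqs))
  (eqs_chain : proj_chain 1 (ideal_gen eqs)).

Local Notation generic := (generic_point eqs N0 bK).

Lemma ideal_gen_mem p : p \in eqs -> ideal_gen eqs p.
Proof.
move=> /(nthP 0) [a ha <-]; exists (fun b => (b == Ordinal ha)%:R).
rewrite (bigD1 (Ordinal ha)) //= eqxx mul1r big1 ?addr0 // => b /negbTE ->.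
by rewrite mul0r.
Qed.

Lemma map_mpoly_idfun (p : {mpoly K[n.+1]}) : map_mpoly idfun p = p.
Proof. by apply/mpolyP => m; rewrite mcoeff_map_mpoly. Qed.

Lemma initial_generic_point i : ~ ideal_gen eqs 'X_i ->
  exists (F : fieldType) (iota : {rmorphism K -> F}) x,
    generic idfun iota x i /\ forall p, ideal_gen eqs p <-> point_ideal iota x p.
Proof.
move=> hi; have [F [iota [x [xi hx hfrac]]]] := proj_prime_point eqs_prime hi.
exists F, iota, x; split=> //; split=> //.
- move=> p hp; have /homogP [d hd] := eqs_homog hp.
  have -> : mmap (iota \o idfun) x p = mmap iota x p by apply: eq_mmap.
  by apply/(point_ideal_homog iota x hd)/hx/ideal_gen_mem.
- move=> d hd c; have [h1 h2 _] := bK_basis hd.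
  rewrite /eval_kernel; under eq_bigr do rewrite map_mpoly_idfun.
  move=> hc; apply: h2; apply/hx.
  have hs : \sum_l c l *: @bK d l \is d.-homog by apply: rpred_sum => l _; apply: rpredZ.
  exact/(point_ideal_homog iota x hs).
Qed.

(** A chain of length 1 provides a closed point Q; its coordinates are algebraic over K and are
    adjoined one by one to obtain L. The specialization holds because a form vanishing at the
    generic point has zero coordinates in the basis, so it vanishes at every zero of the
    equations. *)
Lemma rational_point : exists (L : fieldType) (h : {rmorphism K -> L}) (F : fieldType)
    (iota : {rmorphism L -> F}) x i (y : 'I_n.+1 -> L),
  [/\ generic h iota x i, y i = 1 & forall p, mmap iota x p = 0 -> mmap idfun y p = 0].
Proof.
have [Q [hQ [subQ [b0 [Qb0 nb0]]] _]] := eqs_chain.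
have [[QI _ _] hQh [i Qi]] := hQ.
have ni : ~ ideal_gen eqs 'X_i by move/subQ.
have [d0 hd0] : exists d0, ~ ideal_gen eqs (pihomog mdeg d0 b0).
  apply: NNPP => hn; apply: nb0; rewrite (pihomog_partitionE (mf := mdeg) (leqnn (msize b0))).
  have [[[I0 ID _] _ _] _ _] := eqs_prime.
  elim/big_ind: _ => // d _; apply: NNPP => h; apply: hn; by exists d.
pose b := pihomog mdeg d0 b0.
have hb : b \is d0.-homog by apply: pihomogP.
have Qb : Q b by apply: hQh.
have [F0 [iota [x [gp hx]]]] := initial_generic_point ni.
have bx : mmap iota x b != 0.
  by apply/eqP => bx; apply/hd0/hx/(point_ideal_homog iota x hb).
have [T [kappa [y [yi Qy _]]]] := proj_prime_point hQ Qi.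
have Qhom d p : p \is d.-homog -> Q p -> mmap kappa y p = 0.
  by move=> hp /Qy/(point_ideal_homog kappa y hp).
have yalg j : algebraicOver kappa (y j).
  apply: (algebraic_point D_gt0 bK_basis gp _ _ hb Qb bx yi Qhom) => //.
  by move=> p /hx/subQ.
have [|L [h [j' [hj hz [F [iota' [x' gp']]]]]]] :=
    generic_tower D_gt0 eqs_homog bK_basis smooth (zs := codom y) gp (j := kappa).
  by move=> _ /codomP [j ->].
have [z hz'] := choice _ (fun j => hz (y j) (codom_f y j)).
have zi : z i = 1 by apply: (fmorph_inj j'); rewrite hz' rmorph1.
exists L, (h \o idfun), F, iota', x', i, z; split=> // p hp.
pose d := maxn (msize p) N0.
have pd : (msize p <= d.+1)%N by apply: leqW (leq_maxl _ _).
have hp' := homogenize_homog i d p.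
rewrite -(mmap_homogenize idfun zi pd).
have hN : (N0 <= d)%N by apply: leq_maxr.
have [c hc] := spanned_base_change bK_basis (h \o idfun) hN hp'.
have c0 : forall l, c l = 0.
  apply: (gp_indep gp' hN); have := hc _ _ _ (gp_eqs gp').
  rewrite /eval_kernel mmapB (mmap_homogenize _ (gp_norm gp') pd) hp sub0r.
  by move/eqP; rewrite oppr_eq0 => /eqP.
have := hc _ idfun z; rewrite /eval_kernel mmapB [X in _ - mmap _ _ X]big1 ?mmap0 ?subr0.
  apply=> q hq; apply: (fmorph_inj j'); rewrite rmorph0 rmorph_mmap_comp.
  have /homogP [e he] := eqs_homog hq.
  rewrite -(Qhom e q he); last by apply/subQ/ideal_gen_mem.
  by apply: eq_mmap => [a|a] /=; rewrite ?hj ?hz'.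
by move=> l _; rewrite c0 scale0r.
Qed.
End RationalPoint.

(** * Descent of vector fields on the projective line *)

(** The kernel of a matrix commutes with base change. *)
Lemma linear_system_descent (K L : fieldType) (h : {rmorphism K -> L}) (T U : finType)
    (A : T -> U -> K) :
  exists R (s : 'I_R -> T -> K), (forall r u, \sum_t s r t * A t u = 0) /\
    forall v : T -> L, (forall u, \sum_t v t * h (A t u) = 0) ->
      exists c : 'I_R -> L, forall t, v t = \sum_r c r * h (s r t).
Proof.
pose M := \matrix_(i < #|T|, j < #|U|) A (enum_val i) (enum_val j).
exists #|T|, (fun r t => kermx M r (enum_rank t)); split=> [r u|v hv].
  have /matrixP/(_ r (enum_rank u)) := mulmx_ker M; rewrite !mxE => e; apply: etrans e.
  rewrite [LHS](reindex_onto enum_val enum_rank) /=; last by move=> t _; exact: enum_rankK.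
  rewrite [LHS](eq_bigl xpredT); last by move=> i; rewrite enum_valK eqxx.
  by apply: eq_bigr => i _; rewrite !mxE enum_valK enum_rankK.
pose V := \row_(i < #|T|) v (enum_val i).
have : (V <= kermx (map_mx h M))%MS.
  apply/sub_kermxP/matrixP => a j; rewrite !mxE.
  apply: etrans (hv (enum_val j)).
  rewrite [RHS](reindex_onto enum_val enum_rank) /=; last by move=> t _; exact: enum_rankK.
  rewrite [RHS](eq_bigl xpredT); last by move=> i; rewrite enum_valK eqxx.
  by apply: eq_bigr => i _; rewrite !mxE.
rewrite -map_kermx => /submxP [c hc]; exists (fun r => c 0 r) => t.
have /matrixP/(_ 0 (enum_rank t)) := hc; rewrite !mxE enum_rankK => ->.
by apply: eq_bigr => r _; rewrite !mxE.
Qed.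

Section Descent.
Variables (K L : fieldType) (h : {rmorphism K -> L}) (Delta : nat).
(* [V] is a K-form of the graded ring of sections of the multiples of a divisor of
   degree Delta on the projective line over L. *)
Variable V : nat -> {poly L} -> Prop.
Hypotheses (Delta_gt0 : (0 < Delta)%N)
  (V_size : forall k Q, V k Q -> (size Q <= (k * Delta).+1)%N)
  (V_add : forall k P Q, V k P -> V k Q -> V k (P + Q))
  (V_scale : forall k c Q, V k Q -> V k (h c *: Q))
  (V_mul : forall k l P Q, V k P -> V l Q -> V (k + l) (P * Q))
  (V_basis : forall k, (0 < k)%N -> exists B : 'I_(k * Delta).+1 -> {poly L},
     [/\ forall l, V k (B l),
       forall c : 'I_(k * Delta).+1 -> L, \sum_l c l *: B l = 0 -> forall l, c l = 0 &
       forall Q, V k Q -> exists c : 'I_(k * Delta).+1 -> K, Q = \sum_l h (c l) *: B l]).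

Lemma V_opp k Q : V k Q -> V k (- Q).
Proof. by move=> /(V_scale (-1)); rewrite rmorphN1 scaleN1r. Qed.

Lemma V0 k : (0 < k)%N -> V k 0.
Proof.
by move=> /V_basis [B [hB _ _]]; have := V_scale 0 (hB ord0); rewrite rmorph0 scale0r.
Qed.

Lemma V_sum k (T : finType) (f : T -> {poly L}) : (0 < k)%N -> (forall t, V k (f t)) ->
  V k (\sum_t f t).
Proof. by move=> k0 hf; elim/big_ind: _ => // [|P Q]; [exact: V0|exact: V_add]. Qed.

(** The source of all descent below: in terms of the basis B, the relations over L between
    K-rational sections solve a linear system over K. *)
Lemma V_relations k (T U : finType) (f : T -> U -> {poly L}) : (0 < k)%N ->
  (forall t u, V k (f t u)) ->
  exists R (s : 'I_R -> T -> K), (forall r u, \sum_t h (s r t) *: f t u = 0) /\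
    forall v : T -> L, (forall u, \sum_t v t *: f t u = 0) ->
      exists c : 'I_R -> L, forall t, v t = \sum_r c r * h (s r t).
Proof.
move=> k0 hf; have [B [hB Bind Bspan]] := V_basis k0.
have [A hA] := choice (fun z c => f z.1 z.2 = \sum_l h (c l) *: B l)
  (fun z => Bspan _ (hf z.1 z.2)).
have sumE (v : T -> L) u :
    \sum_t v t *: f t u = \sum_l (\sum_t v t * h (A (t, u) l)) *: B l.
  under eq_bigr => t _ do rewrite (hA (t, u)) scaler_sumr.
  rewrite exchange_big; apply: eq_bigr => l _; rewrite scaler_suml.
  by apply: eq_bigr => t _; rewrite scalerA.
have [R [s [hs1 hs2]]] := linear_system_descent h
  (fun t (z : (U * 'I_(k * Delta).+1)%type) => A (t, z.1) z.2).
exists R, s; split=> [r u|v hv].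
  rewrite (sumE (fun t => h (s r t))) big1 // => l _.
  under eq_bigr do rewrite -rmorphM.
  by rewrite -rmorph_sum (hs1 r (u, l)) rmorph0 scale0r.
by apply: hs2 => -[u l] /=; apply: (Bind (fun l => \sum_t v t * h (A (t, u) l))); rewrite -sumE.
Qed.

(** The basis is independent over L and has as many elements as a polynomial of degree at most k
    Delta has coefficients, so it spans all of these over L. *)
Lemma V_extension k (B : 'I_(k * Delta).+1 -> {poly L}) :
  (forall l, V k (B l)) ->
  (forall c : 'I_(k * Delta).+1 -> L, \sum_l c l *: B l = 0 -> forall l, c l = 0) ->
  exists co : 'I_(k * Delta).+1 -> {scalar {poly L}},
    forall P : {poly L}, (size P <= (k * Delta).+1)%N -> P = \sum_l co l P *: B l.
Proof.
move=> hB Bind; set N := (k * Delta).+1 in B hB Bind *.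
pose G := \matrix_(l < N) poly_rV (B l) : 'M[L]_(N, N).
have rE (c : 'rV[L]_N) : rVpoly (c *m G) = \sum_l c 0 l *: B l.
  rewrite mulmx_sum_row (raddf_sum rVpoly); apply: eq_bigr => l _.
  by rewrite /= linearZ /= rowK poly_rV_K // V_size.
have Gu : G \in unitmx.
  rewrite -row_free_unit -kermx_eq0; apply/eqP/row_matrixP => r; rewrite row0.
  have e : row r (kermx G) *m G = 0 by rewrite -row_mul mulmx_ker row0.
  have := rE (row r (kermx G)); rewrite e linear0 => /esym /Bind c0.
  by apply/rowP => l; rewrite c0 mxE.
pose co l (P : {poly L}) := (poly_rV P *m invmx G) 0 l.
have col l : scalar (co l).
  by move=> a P Q; rewrite /co linearP mulmxDl -scalemxAl !mxE.
exists (fun l => HB.pack_for {scalar {poly L}} (co l)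
  (GRing.isLinear.Build L {poly L} L _ (co l) (col l))) => P hP.
by rewrite /= -rE -mulmxA mulVmx // mulmx1 poly_rV_K.
Qed.

(* The infinitesimal automorphism of the sections of degree k attached to the vector
   field (a + b t + c t^2) d/dt. *)
Definition vector_field (a b c : L) k (P : {poly L}) : {poly L} :=
  a *: P^`() + b *: ('X * P^`()) + c *: ('X * ('X * P^`() - (k * Delta)%:R *: P)).

Lemma vector_field_linear a b c k : linear (vector_field a b c k).
Proof.
move=> r P Q; rewrite /vector_field derivD derivZ -!mul_polyC; ring.
Qed.

Lemma vector_fieldM a b c k l P Q :
  vector_field a b c k P * Q + P * vector_field a b c l Q = vector_field a b c (k + l) (P * Q).
Proof.
rewrite /vector_field derivM -!mul_polyC mulnDl natrD polyCD; ring.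
Qed.

Lemma size_vector_field a b c k (P : {poly L}) : (size P <= (k * Delta).+1)%N ->
  (size (vector_field a b c k P) <= (k * Delta).+1)%N.
Proof.
move=> hP; have P0 n : (k * Delta < n)%N -> P`_n = 0.
  by move=> hn; apply: nth_default; apply: leq_trans hP hn.
have XP n : ('X * P^`())`_n = P`_n *+ n.
  by rewrite coefXM; case: n => // n; rewrite coef_deriv.
apply/leq_sizeP => -[//|n]; rewrite ltnS => hn.
rewrite /vector_field !coefD !coefZ XP coef_deriv [in X in _ + _ + X]coefXM coefB XP coefZ.
rewrite (P0 n.+1) // (P0 n.+2) ?ltnS ?leqW // !mul0rn !mulr0 !add0r /=.
(* For n = k Delta the terms n P_n and k Delta P_n cancel: this is why k Delta occurs in
   [vector_field]. *)
move: hn; rewrite leq_eqVlt => /orP [/eqP <-|hn]; first by rewrite mulr_natl subrr mulr0.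
by rewrite P0 // mul0rn mulr0 subrr mulr0.
Qed.

(** The unknowns are the matrices of X in degree 1 and of Y in degree 2; the product rule on pairs
    of basis elements is a linear system over K, whose coefficients come from the structure
    constants [s]. The vector fields of the projective line solve it over L, so they are
    combinations of the rational solutions. *)
Lemma rational_vector_fields : exists R (X : 'I_R -> {linear {poly L} -> {poly L}}),
  [/\ forall r P, V 1 P -> V 1 (X r P),
      forall r, exists Y : {poly L} -> {poly L}, forall P Q : {poly L},
        (size P <= (1 * Delta).+1)%N -> (size Q <= (1 * Delta).+1)%N -> X r P * Q + P * X r Q = Y (P * Q),
      forall r (P : {poly L}), (size P <= (1 * Delta).+1)%N -> (size (X r P) <= (1 * Delta).+1)%N &
      forall a b c, exists co : 'I_R -> L, forall P : {poly L}, (size P <= (1 * Delta).+1)%N ->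
        vector_field a b c 1 P = \sum_r co r *: X r P].
Proof.
have [B1 [hB1 ind1 span1]] := V_basis (isT : (0 < 1)%N).
have [B2 [hB2 ind2 span2]] := V_basis (isT : (0 < 2)%N).
have [co1 hco1] := V_extension hB1 ind1; have [co2 hco2] := V_extension hB2 ind2.
have [s hs] := choice (fun z c => B1 z.1 * B1 z.2 = \sum_l h (c l) *: B2 l)
  (fun z => span2 _ (V_mul (hB1 z.1) (hB1 z.2))).
pose I1 := 'I_(1 * Delta).+1; pose I2 := 'I_(2 * Delta).+1.
(* The contribution of the unknown t to the product rule for the pair u of basis elements. *)
pose f (t : (I1 * I1 + I2 * I2)%type) (u : I1 * I1) : {poly L} :=
  match t with
  | inl (a, b) => (a == u.1)%:R *: (B1 b * B1 u.2) + (a == u.2)%:R *: (B1 u.1 * B1 b)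
  | inr (l, m) => - (h (s u l) *: B2 m)
  end.
have hf t u : V 2 (f t u).
  have nat_scale (b : bool) P : V 2 P -> V 2 (b%:R *: P).
    by move=> hP; rewrite -(rmorph_nat h); apply: V_scale.
  case: t => [[a b]|[l m]]; last by apply/V_opp/V_scale.
  by apply: V_add; apply: nat_scale; apply: (V_mul (k := 1) (l := 1)).
have [R [sol [hsol allsol]]] := V_relations (isT : (0 < 2)%N) hf.
have sumf (v : (I1 * I1 + I2 * I2)%type -> L) u : \sum_t v t *: f t u =
    (\sum_b v (inl (u.1, b)) *: B1 b) * B1 u.2 + B1 u.1 * (\sum_b v (inl (u.2, b)) *: B1 b)
    - \sum_l h (s u l) *: \sum_m v (inr (l, m)) *: B2 m.
  rewrite big_sumType /=; congr (_ + _).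
    transitivity (\sum_a \sum_b v (inl (a, b)) *: f (inl (a, b)) u).
      by rewrite pair_bigA; apply: eq_bigr => -[].
    rewrite /=.
    under eq_bigr do rewrite (eq_bigr _ (fun b _ => scalerDr _ _ _)) big_split /=.
    rewrite big_split /=; congr (_ + _).
      rewrite (bigD1 u.1) //= [X in _ + X]big1 ?addr0 => [|a /negbTE ne].
        by rewrite mulr_suml; apply: eq_bigr => b _; rewrite eqxx scale1r scalerAl.
      by rewrite big1 // => b _; rewrite ne scale0r scaler0.
    rewrite (bigD1 u.2) //= [X in _ + X]big1 ?addr0 => [|a /negbTE ne].
      by rewrite mulr_sumr; apply: eq_bigr => b _; rewrite eqxx scale1r scalerAr.
    by rewrite big1 // => b _; rewrite ne scale0r scaler0.
  transitivity (\sum_a \sum_b v (inr (a, b)) *: f (inr (a, b)) u).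
    by rewrite pair_bigA; apply: eq_bigr => -[].
  rewrite -sumrN; apply: eq_bigr => l _; rewrite scaler_sumr -sumrN; apply: eq_bigr => m _.
  by rewrite scalerN !scalerA mulrC.
pose X0 r (P : {poly L}) : {poly L} := \sum_a co1 a P *: \sum_b h (sol r (inl (a, b))) *: B1 b.
pose Y0 r (P : {poly L}) : {poly L} := \sum_l co2 l P *: \sum_m h (sol r (inr (l, m))) *: B2 m.
have X0l r : linear (X0 r).
  move=> e P Q; rewrite /X0 scaler_sumr -big_split; apply: eq_bigr => a _ /=.
  by rewrite linearP scalerDl scalerA.
have Y0l r : linear (Y0 r).
  move=> e P Q; rewrite /Y0 scaler_sumr -big_split; apply: eq_bigr => a _ /=.
  by rewrite linearP scalerDl scalerA.
pose X r := HB.pack_for {linear {poly L} -> {poly L}} (X0 r)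
  (GRing.isLinear.Build L {poly L} {poly L} _ (X0 r) (X0l r)).
pose Y r := HB.pack_for {linear {poly L} -> {poly L}} (Y0 r)
  (GRing.isLinear.Build L {poly L} {poly L} _ (Y0 r) (Y0l r)).
have XZ r e P : X0 r (e *: P) = e *: X0 r P by exact: (linearZZ (X r)).
have YZ r e P : Y0 r (e *: P) = e *: Y0 r P by exact: (linearZZ (Y r)).
have Xsum r (T : finType) (F : T -> {poly L}) : X0 r (\sum_t F t) = \sum_t X0 r (F t).
  exact: (raddf_sum (X r)).
have Ysum r (T : finType) (F : T -> {poly L}) : Y0 r (\sum_t F t) = \sum_t Y0 r (F t).
  exact: (raddf_sum (Y r)).
have coB1 a b : co1 a (B1 b) = (a == b)%:R.
  have := hco1 _ (V_size (hB1 b)) => e.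
  have : \sum_l (co1 l (B1 b) - (l == b)%:R) *: B1 l = 0.
    under eq_bigr do rewrite scalerBl.
    rewrite sumrB -e (bigD1 b) //= eqxx scale1r big1 ?addr0 ?subrr // => l /negbTE ->.
    by rewrite scale0r.
  by move/(ind1 (fun l => _))/(_ a)/eqP; rewrite subr_eq0 => /eqP.
have coB2 a b : co2 a (B2 b) = (a == b)%:R.
  have := hco2 _ (V_size (hB2 b)) => e.
  have : \sum_l (co2 l (B2 b) - (l == b)%:R) *: B2 l = 0.
    under eq_bigr do rewrite scalerBl.
    rewrite sumrB -e (bigD1 b) //= eqxx scale1r big1 ?addr0 ?subrr // => l /negbTE ->.
    by rewrite scale0r.
  by move/(ind2 (fun l => _))/(_ a)/eqP; rewrite subr_eq0 => /eqP.
have XB r a : X0 r (B1 a) = \sum_b h (sol r (inl (a, b))) *: B1 b.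
  rewrite /X0 (bigD1 a) //= coB1 eqxx scale1r [X in _ + X]big1 ?addr0 // => b ne.
  by rewrite coB1 (negbTE ne) scale0r.
have YB r a : Y0 r (B2 a) = \sum_b h (sol r (inr (a, b))) *: B2 b.
  rewrite /Y0 (bigD1 a) //= coB2 eqxx scale1r [X in _ + X]big1 ?addr0 // => b ne.
  by rewrite coB2 (negbTE ne) scale0r.
have XY r a b : X0 r (B1 a) * B1 b + B1 a * X0 r (B1 b) = Y0 r (B1 a * B1 b).
  have /eqP := hsol r (a, b); rewrite (sumf (fun t => h (sol r t))) /= subr_eq0 => /eqP e.
  rewrite !XB e (hs (a, b)) Ysum; apply: eq_bigr => l _.
  by rewrite YZ YB.
exists R, X; split.
- move=> r P /span1 [c ->]; rewrite -[Z in V _ Z]/(X0 r _) Xsum; apply: V_sum => // a.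
  by rewrite XZ; apply: V_scale; rewrite XB; apply: V_sum => // b; apply: V_scale.
- move=> r; exists (Y0 r) => P Q hP hQ; rewrite -[X r P]/(X0 r P) -[X r Q]/(X0 r Q).
  have [p ->] : exists p, P = \sum_a p a *: B1 a by eexists; apply: hco1.
  have [q ->] : exists q, Q = \sum_a q a *: B1 a by eexists; apply: hco1.
  rewrite !Xsum !mulr_suml -big_split Ysum; apply: eq_bigr => a _.
  rewrite /= !mulr_sumr -big_split Ysum; apply: eq_bigr => b _.
  by rewrite /= !XZ -!scalerAl -!scalerAr !YZ -XY !scalerDr.
- move=> r P hP; rewrite -[X r P]/(X0 r P) (hco1 P hP) Xsum.
  apply: (leq_trans (size_sum _ _ _)); apply/bigmax_leqP => a _.
  rewrite XZ; apply: leq_trans (size_scale_leq _ _) _; rewrite XB.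
  apply: (leq_trans (size_sum _ _ _)); apply/bigmax_leqP => b _.
  by apply: leq_trans (size_scale_leq _ _) _; apply: V_size.
move=> a b c; pose vf0 := vector_field a b c; pose vf k := HB.pack_for {linear {poly L} -> {poly L}} (vector_field a b c k)
  (GRing.isLinear.Build L {poly L} {poly L} _ _ (vector_field_linear a b c k)).
have vfZ k e P : vf0 k (e *: P) = e *: vf0 k P by exact: (linearZZ (vf k)).
have vfsum k (T : finType) (F : T -> {poly L}) : vf0 k (\sum_t F t) = \sum_t vf0 k (F t).
  exact: (raddf_sum (vf k)).
pose v (t : (I1 * I1 + I2 * I2)%type) : L := match t with
  | inl (i, j) => co1 j (vf0 1 (B1 i)) | inr (l, m) => co2 m (vf0 2 (B2 l)) end.
have v1 i : \sum_j v (inl (i, j)) *: B1 j = vf0 1 (B1 i).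
  by rewrite -hco1 // size_vector_field // V_size.
have v2 i : \sum_j v (inr (i, j)) *: B2 j = vf0 2 (B2 i).
  by rewrite -hco2 // size_vector_field // V_size.
have [|co hco] := allsol v.
  move=> [i j]; rewrite sumf /= !v1.
  under eq_bigr do rewrite v2 -vfZ.
  by rewrite -vfsum -(hs (i, j)) /= (vector_fieldM _ _ _ 1 1) subrr.
exists co => P hP; rewrite -[LHS]/(vf0 1 P) {1}(hco1 P hP) vfsum.
have -> : \sum_r co r *: X r P = \sum_a co1 a P *: \sum_r co r *: X0 r (B1 a).
  under eq_bigr => r _ do rewrite -[X r P]/(X0 r P) {1}(hco1 P hP) Xsum scaler_sumr.
  rewrite exchange_big; apply: eq_bigr => l _; rewrite scaler_sumr; apply: eq_bigr => r _.
  by rewrite XZ !scalerA mulrC.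
apply: eq_bigr => i _; rewrite vfZ; congr (_ *: _).
rewrite -v1; under [RHS]eq_bigr do rewrite XB scaler_sumr.
rewrite exchange_big; apply: eq_bigr => j _ /=.
by rewrite -[co1 j _]/(v (inl (i, j))) hco scaler_suml; apply: eq_bigr => r _; rewrite scalerA.
Qed.

End Descent.

(** * Evaluation at points of the projective line *)

Section Evaluation.
Variables (L : fieldType) (o : option L).

(* The value at a point of the projective line, [None] being the point at infinity. *)
Definition proj_eval (n : nat) (P : {poly L}) : L := if o is Some t then P.[t] else P`_n.

Lemma proj_evalB n P Q : proj_eval n (P - Q) = proj_eval n P - proj_eval n Q.
Proof. by rewrite /proj_eval; case: o => [t|]; rewrite ?hornerD ?hornerN ?coefB. Qed.

Lemma proj_evalD n P Q : proj_eval n (P + Q) = proj_eval n P + proj_eval n Q.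
Proof. by rewrite /proj_eval; case: o => [t|]; rewrite ?hornerD ?coefD. Qed.

Lemma proj_evalZ n a P : proj_eval n (a *: P) = a * proj_eval n P.
Proof. by rewrite /proj_eval; case: o => [t|]; rewrite ?hornerZ ?coefZ. Qed.

Lemma proj_eval_sum n (T : finType) (F : T -> {poly L}) :
  proj_eval n (\sum_t F t) = \sum_t proj_eval n (F t).
Proof.
by rewrite /proj_eval; case: o => [t|]; [exact: (raddf_sum (horner_eval t))|exact: coef_sum].
Qed.

Lemma coef_top_mul n m (P Q : {poly L}) : (size P <= n.+1)%N -> (size Q <= m.+1)%N ->
  (P * Q)`_(n + m) = P`_n * Q`_m.
Proof.
move=> hP hQ; have hn : (n < (n + m).+1)%N by rewrite ltnS leq_addr.
rewrite coefM (bigD1 (Ordinal hn)) //= addKn big1 ?addr0 // => i ne.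
case: (ltngtP i n) => h; last by case/negP: ne; apply/eqP/val_inj.
  by rewrite [Q`__]nth_default ?mulr0 //; apply: leq_trans hQ _; lia.
by rewrite nth_default ?mul0r //; apply: leq_trans hP _.
Qed.

Lemma proj_evalM n m (P Q : {poly L}) : (size P <= n.+1)%N -> (size Q <= m.+1)%N ->
  proj_eval (n + m) (P * Q) = proj_eval n P * proj_eval m Q.
Proof.
by move=> hP hQ; rewrite /proj_eval; case: o => [t|]; [exact: hornerM|exact: coef_top_mul].
Qed.

Lemma proj_eval_neq0 n : exists2 P : {poly L}, (size P <= n.+1)%N & proj_eval n P != 0.
Proof.
rewrite /proj_eval; case: o => [t|].
  by exists 1; rewrite ?size_poly1 // hornerC oner_neq0.
by exists 'X^n; rewrite ?size_polyXn // coefXn eqxx oner_neq0.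
Qed.

(** The quadratic sections that vanish at the point have the basis X - t and (X - t) X, or 1 and X
    at infinity; they generate the sections of higher degree that vanish there. *)
Lemma proj_eval_kernel n (P : {poly L}) : (0 < n)%N -> (size P <= n.+2)%N ->
  proj_eval n.+1 P = 0 ->
  exists A : 'I_2 -> {poly L}, exists B : 'I_2 -> {poly L},
    [/\ forall j, (size (A j) <= 3)%N /\ proj_eval 2 (A j) = 0,
        forall j, (size (B j) <= n)%N & P = \sum_j A j * B j].
Proof.
move=> n0 hP; have split1 (G : {poly L}) : (size G <= n.+1)%N -> exists B : {poly L},
    (size B <= n)%N /\ G = (G`_0)%:P + 'X * B.
  move=> hG; exists (\poly_(i < n) G`_i.+1); split; first exact: size_poly.
  apply/polyP => -[|i]; rewrite coefD coefC coefXM /= ?addr0 // coef_poly add0r.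
  by case: ltnP => // hi; apply: nth_default; apply: leq_trans hG _.
have hC (c : L) : (size c%:P <= n)%N by apply: leq_trans (size_polyC_leq1 _) _.
rewrite /proj_eval; case: o => [t|] h.
  have /factor_theorem [G eG] : root P t by apply/rootP.
  have hG : (size G <= n.+1)%N.
    case: (eqVneq G 0) => [->|G0]; first by rewrite size_poly0.
    by move: hP; rewrite eG size_mul ?polyXsubC_eq0 // size_XsubC addn2 /= ltnS.
  have [B [hB eB]] := split1 _ hG.
  exists (fun j => if j == 0 then 'X - t%:P else ('X - t%:P) * 'X).
  exists (fun j => if j == 0 then (G`_0)%:P else B); split.
  - move=> j; case: ifP => _; rewrite ?hornerM hornerXsubC subrr ?mul0r; split=> //.
      by rewrite size_XsubC.
    by apply: leq_trans (size_polyMleq _ _) _; rewrite size_XsubC size_polyX.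
  - by move=> j; case: ifP.
  - by rewrite big_ord_recl big_ord1 /= eG {1}eB; ring.
have hP' : (size P <= n.+1)%N.
  apply/leq_sizeP => j; rewrite leq_eqVlt => /orP [/eqP <- //|hj].
  by apply: nth_default; apply: leq_trans hP _.
have [B [hB eB]] := split1 _ hP'.
exists (fun j => if j == 0 then 1 else 'X), (fun j => if j == 0 then (P`_0)%:P else B); split.
- by move=> j; case: ifP => _; rewrite ?size_poly1 ?size_polyX ?coef1 ?coefX.
- by move=> j; case: ifP.
- by rewrite big_ord_recl big_ord1 /= {1}eB; ring.
Qed.
End Evaluation.

(* A symmetric matrix R with z R z = 0 for z = (1, t, t^2) is a multiple of the conic
   z_1^2 = z_0 z_2. *)
Lemma veronese_conic (L : fieldType) (R : 'M[L]_3) (c : 'cV[L]_3) : 2%:R != 0 :> L ->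
  R^T = R -> R != 0 -> \sum_j \sum_l R j l *: 'X^(j + l) = 0 :> {poly L} ->
  (c^T *m R *m c) 0 0 = 0 ->
  c ord0 0 * c ord_max 0 = c (lift ord0 ord0) 0 ^+ 2.
Proof.
move=> two /matrixP sym R0 hR hc.
pose i0 : 'I_3 := ord0; pose i1 : 'I_3 := lift ord0 ord0; pose i2 : 'I_3 := ord_max.
have s3 (M : zmodType) (F : 'I_3 -> M) : \sum_j F j = F i0 + F i1 + F i2.
  rewrite big_ord_recl big_ord_recl big_ord1 addrA; congr (_ + _ + F _).
  exact: val_inj.
have sy j l : R l j = R j l by have := sym j l; rewrite mxE.
have cf n : \sum_j \sum_l R j l * ((n == j + l)%N)%:R = 0.
  have := congr1 (fun P : {poly L} => P`_n) hR; rewrite coef0 coef_sum => e.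
  apply: etrans e; apply: eq_bigr => j _; rewrite coef_sum; apply: eq_bigr => l _.
  by rewrite coefZ coefXn.
have e0 := cf 0%N; have e1 := cf 1%N; have e2 := cf 2%N; have e3 := cf 3%N; have e4 := cf 4%N.
rewrite !s3 /= !mulr0 !mulr1 !addr0 !add0r in e0, e1, e2, e3, e4.
have r01 : R i0 i1 = 0.
  by move: e1; rewrite (sy i0 i1) -mulr2n -mulr_natl => /eqP; rewrite mulf_eq0 (negbTE two) => /eqP.
have r12 : R i1 i2 = 0.
  by move: e3; rewrite (sy i1 i2) -mulr2n -mulr_natl => /eqP; rewrite mulf_eq0 (negbTE two) => /eqP.
have r11 : R i1 i1 = - 2%:R * R i0 i2.
  by apply/eqP; rewrite -subr_eq0; apply/eqP; apply: etrans e2; rewrite (sy i0 i2); ring.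
have r02 : R i0 i2 != 0.
  apply: contraNneq R0 => r02; apply/eqP/matrixP => j l; rewrite mxE.
  have I3 k : [\/ k = i0, k = i1 | k = i2].
    by case: k => -[|[|[|//]]] hk; [constructor 1|constructor 2|constructor 3]; apply: val_inj.
  by case: (I3 j) => ->; case: (I3 l) => ->; rewrite ?(sy i0 i1) ?(sy i0 i2) ?(sy i1 i2) ?e0 ?e4 ?r01 ?r12 ?r11 ?r02 ?mulr0.
have : R i0 i2 * 2%:R * (c i0 0 * c i2 0 - c i1 0 ^+ 2) = 0.
  apply: etrans hc; rewrite mxE s3 !mxE !s3 !mxE (sy i0 i1) (sy i0 i2) (sy i1 i2) e0 e4 r01 r12 r11; ring.
by move/eqP; rewrite !mulf_eq0 (negbTE r02) (negbTE two) /= subr_eq0 => /eqP.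
Qed.

Lemma bilinear_sum (R : comNzRingType) n (M : 'M[R]_n) (x y : 'cV[R]_n) :
  (x^T *m M *m y) 0 0 = \sum_i \sum_j M i j * (x i 0 * y j 0).
Proof.
rewrite exchange_big !mxE; apply: eq_bigr => j _; rewrite !mxE mulr_suml.
by apply: eq_bigr => i _; rewrite !mxE; ring.
Qed.

(** * The conic of vector fields and evaluation at one of its points *)

Section ConicDescent.
Variables (K L : fieldType) (h : {rmorphism K -> L}) (Delta : nat).
Variable V : nat -> {poly L} -> Prop.
Hypotheses (Delta_gt0 : (0 < Delta)%N)
  (V_size : forall k Q, V k Q -> (size Q <= (k * Delta).+1)%N)
  (V_add : forall k P Q, V k P -> V k Q -> V k (P + Q))
  (V_scale : forall k c Q, V k Q -> V k (h c *: Q))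
  (V_mul : forall k l P Q, V k P -> V l Q -> V (k + l) (P * Q))
  (V_basis : forall k, (0 < k)%N -> exists B : 'I_(k * Delta).+1 -> {poly L},
     [/\ forall l, V k (B l),
       forall c : 'I_(k * Delta).+1 -> L, \sum_l c l *: B l = 0 -> forall l, c l = 0 &
       forall Q, V k Q -> exists c : 'I_(k * Delta).+1 -> K, Q = \sum_l h (c l) *: B l])
  (two : 2%:R != 0 :> K)
  (isotropic : forall Q : 'M[K]_3, exists a : 'cV[K]_3, a != 0 /\ (a^T *m Q *m a) 0 0 = 0).

(** For an operator P -> m P + tau P' this is tau, the coefficient of the underlying vector
    field. *)
Definition field_coef (X : {poly L} -> {poly L}) : {poly L} := X 'X - 'X * X 1.

(** The product rule for the factorizations of t P into t P and 1, and into t and P, yields X(t P) =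
    t X(P) + P tau, whence the formula for X(P). As d/dt, t d/dt and t^2 d/dt are combinations of
    the rational solutions, the tau span the quadratic polynomials, and three of them form a
    basis. *)
Lemma three_vector_fields : exists (X : 'I_3 -> {linear {poly L} -> {poly L}}),
  [/\ forall i P, V 1 P -> V 1 (X i P),
      forall i (P : {poly L}), (size P <= (1 * Delta).+1)%N ->
        X i P = P * X i 1 + P^`() * field_coef (X i),
      forall i, (size (field_coef (X i)) <= 3)%N &
      \matrix_(i < 3, j < 3) (field_coef (X i))`_j \in unitmx].
Proof.
have [R [X [XV XY Xsz Xall]]] := rational_vector_fields V_size V_add V_scale V_mul V_basis.
pose tau r : {poly L} := field_coef (X r).
have s1 : (size (1%R : {poly L}) <= (1 * Delta).+1)%N by rewrite size_poly1.
have sX : (size ('X : {poly L}) <= (1 * Delta).+1)%N by rewrite size_polyX mul1n ltnS.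
have step r (P : {poly L}) : (size P <= 1 * Delta)%N -> X r ('X * P) = 'X * X r P + P * tau r.
  rewrite /tau /field_coef => hP; have [Y hY] := XY r.
  have hXP : (size ('X * P)%R <= (1 * Delta).+1)%N.
    by apply: leq_trans (size_polyMleq _ _) _; rewrite size_polyX.
  have e1 := hY _ _ hXP s1; have e2 := hY _ _ sX (leqW hP).
  move: e1; rewrite !mulr1 -e2 => e1.
  have -> : X r ('X * P) = X r ('X * P) + 'X * P * X r 1 - 'X * P * X r 1 by rewrite addrK.
  by rewrite e1; ring.
have formula r (P : {poly L}) : (size P <= (1 * Delta).+1)%N -> X r P = P * X r 1 + P^`() * tau r.
  elim/poly_ind: P => [|P c IH] hP; first by rewrite deriv0 !mul0r addr0 linear0.
  have sP : (size P <= 1 * Delta)%N.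
    case: (eqVneq P 0) => [->|P0]; first by rewrite size_poly0.
    by move: hP; rewrite size_MXaddC (negbTE P0).
  rewrite linearD /= mulrC step // IH ?leqW // derivD derivM derivX derivC.
  rewrite -[c%:P]alg_polyC linearZ /= -!mul_polyC mulr1; ring.
have stau r : (size (tau r) <= 3)%N.
  (* The identity [step] applies up to degree Delta - 1; as P tau has degree at most Delta + 1,
     degree 2 is left for tau. *)
  pose P : {poly L} := 'X^((1 * Delta).-1).
  have sP : size P = (1 * Delta)%N by rewrite size_polyXn prednK // mul1n.
  have e : P * tau r = X r ('X * P) - 'X * X r P by rewrite step ?sP //; ring.
  have hPt : (size (P * tau r)%R <= (1 * Delta).+2)%N.
    rewrite e; apply: leq_trans (size_polyD _ _) _; rewrite size_polyN geq_max.
    have hXP : (size ('X * P)%R <= (1 * Delta).+1)%N.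
      by apply: leq_trans (size_polyMleq _ _) _; rewrite size_polyX sP.
    rewrite leqW ?Xsz //=; apply: leq_trans (size_polyMleq _ _) _.
    by rewrite size_polyX /= ltnS Xsz // sP leqnSn.
  case: (eqVneq (tau r) 0) => [->|t0]; first by rewrite size_poly0.
  move: hPt; rewrite size_monicM ?monicXn // sP; clear; move: (1 * Delta)%N (size _) => a b.
  by case: a => [|a]; lia.
pose Tm := \matrix_(r < R, j < 3) (tau r)`_j.
have full : row_full Tm.
  apply/row_fullP.
  have comb (j : 'I_3) : exists co : 'I_R -> L, 'X^j = \sum_r co r *: tau r.
    have [co hco] := Xall (j == 0 :> nat)%:R (j == 1%N :> nat)%:R (j == 2%N :> nat)%:R.
    exists co; rewrite /tau /field_coef; under eq_bigr do rewrite scalerBr scalerAr.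
    rewrite sumrB -hco // -mulr_sumr -hco // /vector_field derivX -polyC1 derivC.
    rewrite !mulr0 -!mul_polyC polyC1.
    by case: j {hco} => -[|[|[|//]]] hj; rewrite /= ?polyC0 ?polyC1 ?expr0 ?expr1; ring.
  have [co hco] := choice _ comb; exists (\matrix_(j, r) co j r).
  apply/matrixP => j l; rewrite !mxE; have := congr1 (fun P : {poly L} => P`_l) (hco j).
  rewrite coefXn coef_sum eq_sym => e; apply/esym/(etrans e).
  by apply: eq_bigr => r _; rewrite !mxE coefZ.
exists (fun i => X (fullrankfun full i)); split=> [i|i|i|].
- exact: XV.
- exact: formula.
- exact: stau.
have := fullrowsub_unit full; congr (_ \in unitmx).
by apply/matrixP => i j; rewrite !mxE.
Qed.

(** Multiplied by a Wronskian W, the three tau_i become K-rational sections u_i of degree 2, so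
    their quadratic relation descends to K. An isotropic vector is a point o at which the ratios of
    the tau_i lie in K. For the ratio of two sections P and P0 at o, the vanishing of (P - c P0) tau
    at o is turned into a linear relation between K-rational sections. *)
Theorem conic_descent : exists (o : option L) lam, [/\ lam != 0,
  forall P, V 1 P -> exists c, proj_eval o (1 * Delta) P = lam * h c &
  exists2 P, V 1 P & proj_eval o (1 * Delta) P != 0].
Proof.
have [X [XV formula stau Tu]] := three_vector_fields.
pose tau i := field_coef (X i); pose T3 := \matrix_(i < 3, j < 3) (tau i)`_j.
have {}Tu : T3 \in unitmx by [].
have [B [hB Bind Bspan]] := V_basis (isT : (0 < 1)%N).
have [co hco] := V_extension V_size hB Bind.
pose wr (v w : {poly L}) := v^`() * w - v * w^`().
(* If the Wronskians of basis elements vanished, so would, by bilinearity over L, that of t and 1,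
   which is 1. *)
have [v [w [Vv Vw wr0]]] : exists v w, [/\ V 1 v, V 1 w & wr v w != 0].
  apply: NNPP => hn.
  have wB i j : wr (B i) (B j) = 0.
    by apply/eqP; apply: contra_notT hn => wij; exists (B i), (B j); split.
  have : wr 'X 1 = 0.
    rewrite (hco 'X) ?size_polyX ?mul1n // (hco 1) ?size_poly1 // /wr.
    move: (fun l => co l 'X) (fun l => co l 1) => p q.
    rewrite !(raddf_sum deriv) !mulr_suml -sumrB big1 // => i _.
    rewrite !mulr_sumr -sumrB big1 // => j _ /=.
    by rewrite !derivZ -!scalerAl -!scalerAr -!scalerBr -/(wr _ _) wB !scaler0.
  by move/eqP; rewrite /wr derivX -polyC1 derivC mulr0 subr0 mulr1 polyC1 oner_eq0.
set W := wr v w in wr0; pose u i := X i v * w - v * X i w.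
have uE i : u i = tau i * W.
  by rewrite /u (formula i v (V_size Vv)) (formula i w (V_size Vw)) /W /wr /tau; ring.
have Vu i : V 2 (u i).
  apply: V_add; first by apply: (V_mul (k := 1) (l := 1)) => //; apply: XV.
  by apply: (V_opp V_scale); apply: (V_mul (k := 1) (l := 1)) => //; apply: XV.
have tauE (c : 'rV[L]_3) : \sum_i c 0 i *: tau i = rVpoly (c *m T3).
  apply/polyP => n; rewrite coef_sum coef_rVpoly; case: insubP => [j _ <-|].
    by rewrite mxE; apply: eq_bigr => i _; rewrite mxE coefZ.
  rewrite -leqNgt => hn; rewrite big1 // => i _.
  by rewrite coefZ nth_default ?mulr0 //; apply: leq_trans (stau i) hn.
have tau_span (A : {poly L}) : (size A <= 3)%N -> exists al : 'rV[L]_3, A = \sum_i al 0 i *: tau i.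
  move=> hA; exists (poly_rV A *m invmx T3).
  by rewrite tauE -mulmxA mulVmx // mulmx1 poly_rV_K.
have [Q [Qsym Q0 Qrel]] : exists Q : 'M[K]_3, [/\ Q^T = Q, Q != 0 &
    \sum_i \sum_j h (Q i j) *: (tau i * tau j) = 0].
  (* Over L the relation between 1, t and t^2, written in the tau_i and multiplied by W^2, is a
     relation between the products u_i u_j in degree 4; K-rational relations must combine to it. *)
  have [R [s [hs alls]]] := @V_relations _ _ h _ _ V_basis 4 ('I_3 * 'I_3)%type unit
    (fun z _ => u z.1 * u z.2) isT (fun z _ => V_mul (Vu z.1) (Vu z.2)).
  have [al hal] := tau_span 1 (ltac:(by rewrite size_poly1)).
  have [be hbe] := tau_span 'X (ltac:(by rewrite size_polyX)).
  have [ga hga] := tau_span 'X^2 (ltac:(by rewrite size_polyXn)).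
  have coefc (c : 'rV[L]_3) (P : {poly L}) : P = \sum_i c 0 i *: tau i ->
      forall n, P`_n = \sum_i c 0 i * (tau i)`_n.
    by move=> -> n; rewrite coef_sum; apply: eq_bigr => i _; rewrite coefZ.
  pose rel (z : 'I_3 * 'I_3) := al 0 z.1 * ga 0 z.2 - be 0 z.1 * be 0 z.2.
  have sumM (c d : 'rV[L]_3) (F : 'I_3 -> {poly L}) : \sum_i \sum_j (c 0 i * d 0 j) *: (F i * F j) =
      (\sum_i c 0 i *: F i) * \sum_j d 0 j *: F j.
    rewrite mulr_suml; apply: eq_bigr => i _; rewrite mulr_sumr; apply: eq_bigr => j _.
    by rewrite -scalerAl -scalerAr scalerA.
  have [c hc] : exists c : 'I_R -> L, forall z, rel z = \sum_r c r * h (s r z).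
    apply: alls => _; transitivity (\sum_i \sum_j rel (i, j) *: (u i * u j)).
      by rewrite pair_bigA; apply: eq_bigr => -[].
    have uc (d : 'rV[L]_3) : \sum_i d 0 i *: u i = (\sum_i d 0 i *: tau i) * W.
      by rewrite mulr_suml; apply: eq_bigr => i _; rewrite uE -scalerAl.
    rewrite /rel /=; under eq_bigr do (under eq_bigr do rewrite scalerBl; rewrite sumrB).
    by rewrite sumrB !sumM !uc -hal -hbe -hga; ring.
  (* A relation that only expresses u_i u_j = u_j u_i is worthless. If all K-rational ones were of
     this kind, the symmetrization of [rel] would be 0; but paired with the coefficients of t it
     gives -2. *)
  have [r [i [j sij]]] : exists r i j, s r (i, j) + s r (j, i) != 0.
    apply: NNPP => hn.
    have rel0 i j : rel (i, j) + rel (j, i) = 0.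
      rewrite !hc -big_split big1 // => r _ /=; rewrite -mulrDr -rmorphD.
      suff -> : s r (i, j) + s r (j, i) = 0 by rewrite rmorph0 mulr0.
      by apply/eqP; apply: contra_notT hn => sij; exists r, i, j.
    have : \sum_i \sum_j (rel (i, j) + rel (j, i)) * ((tau i)`_1 * (tau j)`_1) = 0.
      by apply: big1 => i _; apply: big1 => j _; rewrite rel0 mul0r.
    have sM (c' d : 'rV[L]_3) : \sum_i \sum_j c' 0 i * d 0 j * ((tau i)`_1 * (tau j)`_1) =
        (\sum_i c' 0 i * (tau i)`_1) * \sum_j d 0 j * (tau j)`_1.
      rewrite mulr_suml; apply: eq_bigr => i _; rewrite mulr_sumr; apply: eq_bigr => j _; ring.
    have -> : \sum_i \sum_j (rel (i, j) + rel (j, i)) * ((tau i)`_1 * (tau j)`_1) =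
        (\sum_i \sum_j al 0 i * ga 0 j * ((tau i)`_1 * (tau j)`_1) +
         \sum_i \sum_j ga 0 i * al 0 j * ((tau i)`_1 * (tau j)`_1)) -
        (\sum_i \sum_j be 0 i * be 0 j * ((tau i)`_1 * (tau j)`_1) +
         \sum_i \sum_j be 0 i * be 0 j * ((tau i)`_1 * (tau j)`_1)).
      rewrite -!big_split -sumrB; apply: eq_bigr => i _.
      by rewrite -!big_split -sumrB; apply: eq_bigr => j _; rewrite /rel /=; ring.
    rewrite !sM -(coefc _ _ hal) -(coefc _ _ hbe) -(coefc _ _ hga) coef1 coefX coefXn /= !mulr0 addr0 sub0r mulr1 => /eqP.
    by rewrite oppr_eq0 -(rmorph1 h) -rmorphD fmorph_eq0 (negbTE two).
  exists (\matrix_(i, j) (s r (i, j) + s r (j, i))); split.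
  - by apply/matrixP => i' j'; rewrite !mxE addrC.
  - by apply: contraNneq sij => /matrixP/(_ i j); rewrite !mxE => ->.
  have W2 : W * W != 0 by rewrite mulf_neq0.
  apply: (mulIf W2); rewrite mul0r.
  have : \sum_i \sum_j h (s r (i, j)) *: (u i * u j) = 0.
    by rewrite pair_bigA; apply: etrans (hs r tt); apply: eq_bigr => -[].
  move=> e; have e' : \sum_i \sum_j h (s r (j, i)) *: (u i * u j) = 0.
    rewrite exchange_big; apply: etrans e; apply: eq_bigr => i' _; apply: eq_bigr => j' _ /=.
    by rewrite mulrC.
  have {}e : \sum_i \sum_j h (s r (i, j)) *: (u i * u j) +
      \sum_i \sum_j h (s r (j, i)) *: (u i * u j) = 0 by rewrite e e' addr0.
  apply: etrans e; rewrite -big_split mulr_suml.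
  apply: eq_bigr => i' _; rewrite -big_split mulr_suml; apply: eq_bigr => j' _ /=.
  by rewrite mxE rmorphD scalerDl mulrDl -!scalerAl !uE !(mulrACA _ W).
have [a [a0 aQ]] := isotropic Q.
pose Qh := map_mx h Q; pose ah := map_mx h a.
(* The form Q in the coordinates 1, t, t^2. *)
pose R := T3^T *m Qh *m T3.
have [c Tc] : exists c, T3 *m c = ah by exists (invmx T3 *m ah); rewrite mulmxA mulmxV // mul1mx.
have hv : c ord0 0 * c ord_max 0 = c (lift ord0 ord0) 0 ^+ 2.
  apply: (veronese_conic (R := R)).
  - by rewrite -(rmorph_nat h) fmorph_eq0.
  - by rewrite !trmx_mul trmxK matrix.map_trmx Qsym mulmxA.
  - apply: contra_neq Q0 => R0; apply/eqP; rewrite -(map_mx_eq0 h); apply/eqP.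
    have : invmx T3^T *m R *m invmx T3 = Qh.
      by rewrite /R !mulmxA mulVmx ?unitmx_tr // mul1mx -mulmxA mulmxV // mulmx1.
    by rewrite R0 mulmx0 mul0mx => /esym.
  - apply: etrans Qrel.
    pose Z : 'cV[{poly L}]_3 := \col_j 'X^j; pose P3 := map_mx polyC T3.
    have PZ i : (P3 *m Z) i 0 = tau i.
      rewrite mxE; have -> : tau i = \poly_(j < 3) (tau i)`_j.
        apply/polyP => n; rewrite coef_poly; case: ltnP => // hn.
        by apply: nth_default; apply: leq_trans (stau i) hn.
      by rewrite poly_def; apply: eq_bigr => j _; rewrite !mxE mul_polyC.
    transitivity ((Z^T *m map_mx polyC R *m Z) 0 0).
      rewrite bilinear_sum; apply: eq_bigr => i _; apply: eq_bigr => j _.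
      by rewrite !mxE -exprD mul_polyC.
    have -> : Z^T *m map_mx polyC R *m Z = (P3 *m Z)^T *m map_mx polyC Qh *m (P3 *m Z).
      by rewrite /R !map_mxM -matrix.map_trmx trmx_mul !mulmxA.
    rewrite bilinear_sum; apply: eq_bigr => i _; apply: eq_bigr => j _.
    by rewrite !PZ !mxE mul_polyC.
  - have -> : c^T *m R *m c = (T3 *m c)^T *m Qh *m (T3 *m c).
    by rewrite /R trmx_mul !mulmxA.
    by rewrite Tc matrix.map_trmx -!map_mxM mxE aQ rmorph0.
(* The vector c is proportional to (1, t, t^2) with t = c_1 / c_0, or to (0, 0, 1), the point at
   infinity. *)
pose o := if c ord0 0 == 0 then None else Some (c (lift ord0 ord0) 0 / c ord0 0).
pose mu := if c ord0 0 == 0 then c ord_max 0 else c ord0 0.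
have c0 : c != 0.
  apply: contra_neq a0 => c0; apply/eqP; rewrite -(map_mx_eq0 h); apply/eqP.
  by rewrite -[LHS]Tc c0 mulmx0.
have s3 (F : 'I_3 -> L) : \sum_j F j = F ord0 + F (lift ord0 ord0) + F ord_max.
  rewrite big_ord_recl big_ord_recl big_ord1 addrA; congr (_ + _ + F _).
  exact: val_inj.
have mu0 : mu != 0.
  rewrite /mu; case: ifPn => // /eqP c00; apply: contra_neq c0 => c2.
  have /eqP : c (lift ord0 ord0) 0 ^+ 2 = 0 by rewrite -hv c00 mul0r.
  rewrite expf_eq0 /= => /eqP c1; apply/matrixP => j l; rewrite ord1 mxE.
  case: j => -[|[|[|//]]] hj; [rewrite -[RHS]c00|rewrite -[RHS]c1|rewrite -[RHS]c2];
    by congr (c _ _); apply: val_inj.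
have evc (A : {poly L}) : (size A <= 3)%N ->
    \sum_(j < 3) A`_j * c j 0 = mu * proj_eval o 2 A.
  move=> hA; rewrite s3 /mu /o /proj_eval; case: ifPn => [/eqP c00|c00].
    have /eqP : c (lift ord0 ord0) 0 ^+ 2 = 0 by rewrite -hv c00 mul0r.
    by rewrite expf_eq0 /= => /eqP ->; rewrite c00 !mulr0 !add0r mulrC.
  have c2 : c ord_max 0 = c (lift ord0 ord0) 0 ^+ 2 / c ord0 0 by rewrite -hv mulrAC divff // mul1r.
  rewrite (horner_coef_wide _ hA) s3 c2 /= expr0 expr1; field; exact: c00.
have ev_tau i : h (a i 0) = mu * proj_eval o 2 (tau i).
  rewrite -evc ?stau //; have /matrixP/(_ i 0) := Tc; rewrite !mxE => <-.
  by apply: eq_bigr => j _; rewrite !mxE.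
have [i1 ai1] : exists i1, a i1 0 != 0.
  apply: NNPP => hn; case/negP: a0; apply/eqP/matrixP => i j; rewrite ord1 mxE.
  by apply/eqP; apply: contra_notT hn => ai; exists i.
pose rho i := a i 0 / a i1 0.
(* The [sg i] span the quadratic polynomials that vanish at o, and their multiples [Sg i] by W are
   K-rational. *)
pose sg i := tau i - h (rho i) *: tau i1; pose Sg i := u i - h (rho i) *: u i1.
have SgE i : Sg i = sg i * W by rewrite /Sg !uE /sg [RHS]mulrBl -[in RHS]scalerAl.
have VSg i : V 2 (Sg i) by apply: V_add => //; apply: (V_opp V_scale); apply: V_scale.
have sgs i : (size (sg i) <= 3)%N.
  apply: leq_trans (size_polyD _ _) _; rewrite size_polyN geq_max stau.
  by apply: leq_trans (size_scale_leq _ _) (stau _).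
have ev_tau' i : proj_eval o 2 (tau i) = h (a i 0) / mu.
  by rewrite ev_tau mulrAC divff // mul1r.
have sg0 i : proj_eval o 2 (sg i) = 0.
  by rewrite proj_evalB proj_evalZ !ev_tau' /rho mulrA -rmorphM divfK ?subrr.
have sg_span (A : {poly L}) : (size A <= 3)%N -> proj_eval o 2 A = 0 ->
    exists al : 'I_3 -> L, A = \sum_i al i *: sg i.
  move=> hA A0; have [al hal] := tau_span A hA; exists (fun i => al 0 i).
  rewrite /sg; under eq_bigr do rewrite scalerBr scalerA.
  rewrite sumrB -hal -scaler_suml.
  have -> : \sum_i al 0 i * h (rho i) = 0; last by rewrite scale0r subr0.
  have : proj_eval o 2 A = (\sum_i al 0 i * h (a i 0)) / mu.
    rewrite {1}hal proj_eval_sum mulr_suml; apply: eq_bigr => i _.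
    by rewrite proj_evalZ ev_tau' mulrA.
  rewrite A0 => /esym/eqP; rewrite mulf_eq0 invr_eq0 (negbTE mu0) orbF => /eqP e.
  rewrite /rho; under eq_bigr do rewrite rmorphM mulrA.
  by rewrite -mulr_suml e mul0r.
have [P0 VP0 eP0] : exists2 P, V 1 P & proj_eval o (1 * Delta) P != 0.
  apply: NNPP => hn; have [P sP] := proj_eval_neq0 o (1 * Delta).
  rewrite (hco P sP) proj_eval_sum big1 ?eqxx // => l _; rewrite proj_evalZ.
  suff -> : proj_eval o (1 * Delta) (B l) = 0 by rewrite mulr0.
  by apply/eqP; apply: contra_notT hn => e; exists (B l).
exists o, (proj_eval o (1 * Delta) P0); split=> //; last by exists P0.
move=> P VP; pose cL := proj_eval o (1 * Delta) P / proj_eval o (1 * Delta) P0.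
(* [G] vanishes at o by the choice of cL, so it is a combination over L of the products of some
   [sg i] with some [B l]. After multiplication by W this relates K-rational sections, and P u_i1
   has coefficient 1. *)
pose G := (P - cL *: P0) * tau i1.
have sP := V_size VP; have sP0 := V_size VP0.
have sPP : (size (P - cL *: P0)%R <= (1 * Delta).+1)%N.
  apply: leq_trans (size_polyD _ _) _; rewrite size_polyN geq_max sP.
  by apply: leq_trans (size_scale_leq _ _) sP0.
have sG : (size G <= ((1 * Delta).+1).+2)%N.
  apply: leq_trans (size_polyMleq _ _) _; move: sPP (stau i1).
  by rewrite -/(tau i1); move: (size _) (size _) => x y; lia.
have G0 : proj_eval o (1 * Delta).+2 G = 0.
  rewrite -addn2 proj_evalM //; last exact: stau.
  by rewrite proj_evalB proj_evalZ /cL divfK // subrr mul0r.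
have [A [C [hA hC eG]]] := proj_eval_kernel (isT : (0 < (1 * Delta).+1)%N) sG G0.
have [al hal] := choice _ (fun j => sg_span (A j) (hA j).1 (hA j).2).
have V3 l i : V 3 (Sg i * B l) by apply: (V_mul (k := 2) (l := 1)).
pose I := 'I_(1 * Delta).+1.
pose f (z : (bool + 'I_3 * I)%type) (_ : unit) : {poly L} := match z with
  | inl b => (if b then P else P0) * u i1 | inr (i, l) => Sg i * B l end.
have Vf z t : V 3 (f z t).
  case: z => [b|[i l]]; last exact: V3.
  by apply: (V_mul (k := 1) (l := 2)) => //; case: b.
have [R' [s [hs alls]]] := V_relations V_basis (isT : (0 < 3)%N) Vf.
have sumf (vz : (bool + 'I_3 * I)%type -> L) : \sum_z vz z *: f z tt =
    ((vz (inl true) *: P + vz (inl false) *: P0) * tau i1 +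
      \sum_i \sum_l vz (inr (i, l)) *: (sg i * B l)) * W.
  rewrite big_sumType big_bool mulrDl /=; congr (_ + _).
    by rewrite uE [in RHS]mulrDl [in RHS]mulrDl -![in RHS]scalerAl !mulrA.
  rewrite mulr_suml; transitivity (\sum_i \sum_l vz (inr (i, l)) *: f (inr (i, l)) tt).
    by rewrite pair_bigA; apply: eq_bigr => -[].
  apply: eq_bigr => i _; rewrite mulr_suml; apply: eq_bigr => l _ /=.
  by rewrite SgE -scalerAl mulrAC.
pose vz (z : (bool + 'I_3 * I)%type) : L := match z with
  | inl b => if b then 1 else - cL
  | inr (i, l) => - \sum_j al j i * co l (C j) end.
have [|cc hcc] := alls vz.
  move=> []; rewrite sumf /= scale1r scaleNr -/G eG.
  rewrite [X in _ + X](_ : _ = - \sum_j A j * C j) ?subrr ?mul0r //.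
  rewrite -sumrN; under [RHS]eq_bigr do rewrite hal mulr_suml -sumrN.
  rewrite [RHS]exchange_big; apply: eq_bigr => i _.
  under [RHS]eq_bigr => j _ do rewrite {1}(hco (C j) (hC j)) mulr_sumr -sumrN.
  rewrite exchange_big; apply: eq_bigr => l _; rewrite scaleNr scaler_suml -sumrN.
  by apply: eq_bigr => j _; rewrite -scalerAr -scalerAl scalerA mulrC.
(* Some K-rational relation involves P u_i1; at o the terms with a factor [sg i] disappear and the
   ratio of P and P0 remains. *)
have [r sr] : exists r, s r (inl true) != 0.
  apply: NNPP => hn; have := hcc (inl true); rewrite big1 => [|r _].
    by move/eqP; rewrite /= oner_eq0.
  suff -> : s r (inl true) = 0 by rewrite rmorph0 mulr0.
  by apply/eqP; apply: contra_notT hn => e; exists r.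
exists (- s r (inl false) / s r (inl true)).
have /eqP := hs r tt; rewrite (sumf (fun z => h (s r z))) mulf_eq0 (negbTE wr0) orbF => /eqP e.
have ev0 n : proj_eval o n 0 = 0 by have := proj_evalB o n 0 0; rewrite !subrr.
have := congr1 (proj_eval o (1 * Delta + 2)) e.
rewrite proj_evalD ev0 proj_eval_sum big1 ?addr0 => [|i _]; last first.
  rewrite proj_eval_sum big1 // => l _; rewrite proj_evalZ addnC proj_evalM ?sg0 ?mul0r ?mulr0 //.
  exact: V_size.
rewrite proj_evalM ?stau //; last first.
  apply: leq_trans (size_polyD _ _) _; rewrite geq_max.
  by rewrite !(leq_trans (size_scale_leq _ _)).
rewrite ev_tau' proj_evalD !proj_evalZ => /eqP.
rewrite !mulf_eq0 invr_eq0 (negbTE mu0) fmorph_eq0 (negbTE ai1) !orbF => /eqP e1.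
rewrite rmorphM rmorphN fmorphV mulrA mulrN; apply: (canRL (mulfK _)); first by rewrite fmorph_eq0.
by apply/eqP; rewrite -subr_eq0 opprK mulrC [X in _ + X]mulrC e1.
Qed.

End ConicDescent.

(** * Parametrization and descent of a point *)

Section RationalOrders.
Variables (k F : fieldType) (iota : {rmorphism k -> F}) (n : nat).
Variables (x : 'I_n.+1 -> F) (y : 'I_n.+1 -> k) (i : 'I_n.+1).
Local Notation S := {mpoly k[n.+1]}.
Local Notation evx := (mmap iota x).
Local Notation evy := (mmap idfun y).
Variables (D N0 : nat) (theta u : S).
Hypotheses (D_gt0 : (0 < D)%N) (xi : x i = 1) (yi : y i = 1)
  (specialization : forall p, evx p = 0 -> evy p = 0)
  (hilb : forall d, (N0 <= d)%N ->
     exists b : 'I_(D * d + 1) -> S, graded_basis (eval_kernel iota x) d b)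
  (theta_y : evy theta = 0) (u_y : evy u != 0)
  (theta_gen : forall p, evy p = 0 -> exists q, evx (u * p) = evx (theta * q)).

(** In degree N0 + 1 there are two independent forms, and a combination of them vanishes at y. *)
Lemma nontrivial_specialization : exists p, evy p = 0 /\ evx p != 0.
Proof.
have [b [bh bi _]] := hilb (leqnSn N0).
have lt1 : (1 < D * N0.+1 + 1)%N by rewrite addn1 ltnS muln_gt0 D_gt0.
pose j0 := Ordinal (ltnW lt1); pose j1 := Ordinal lt1.
have nz (c : 'I_(D * N0.+1 + 1) -> k) l : c l != 0 -> evx (\sum_j c j *: b j) != 0.
  by apply: contra_neq => /bi; apply.
case: (eqVneq (evy (b j0)) 0) => [b0|b0].
  exists (\sum_j (j == j0)%:R *: b j); split; last by apply: (nz (fun j => (j == j0)%:R) j0); exact: oner_neq0.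
  rewrite (bigD1 j0) //= ?eqxx scale1r big1 ?addr0 // => j /negbTE ->.
  by rewrite scale0r.
pose c j := if j == j0 then - evy (b j1) else if j == j1 then evy (b j0) else 0.
exists (\sum_j c j *: b j); split; last by apply: (nz c j1); rewrite /c /= ?eqxx.
rewrite eval_lincomb (bigD1 j0) //= (bigD1 j1) //= /c /= ?eqxx big1 ?addr0 => [|j /andP [/negbTE -> /negbTE ->]].
  by rewrite /=; ring.
by rewrite mul0r.
Qed.

Let ntriv := nontrivial_specialization.

Definition order_ge p m := exists s w, evy s != 0 /\ evx (s * p) = evx (theta ^+ m * w).
Definition order_eq p m :=
  exists s a, [/\ evy s != 0, evy a != 0 & evx (s * p) = evx (theta ^+ m * a)].

Lemma order_geM p q m l : order_ge p m -> order_ge q l -> order_ge (p * q) (m + l).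
Proof.
move=> [s [w [hs e]]] [s' [w' [hs' e']]]; exists (s * s'), (w * w'); split.
  by rewrite rmorphM mulf_neq0.
by rewrite exprD mulrACA rmorphM /= e e' -rmorphM mulrACA.
Qed.

Lemma order_eqM p q m l : order_eq p m -> order_eq q l -> order_eq (p * q) (m + l).
Proof.
move=> [s [w [hs hw e]]] [s' [w' [hs' hw' e']]]; exists (s * s'), (w * w'); split.
- by rewrite rmorphM mulf_neq0.
- by rewrite rmorphM mulf_neq0.
by rewrite exprD mulrACA rmorphM /= e e' -rmorphM mulrACA.
Qed.

Lemma order_eq1 : order_eq 1 0.
Proof. by exists 1, 1; rewrite rmorph1 oner_neq0. Qed.

Lemma order_eqX p m j : order_eq p m -> order_eq (p ^+ j) (m * j).
Proof.
move=> h; elim: j => [|j IH]; first by rewrite expr0 muln0; exact: order_eq1.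
by rewrite exprS mulnS; apply: order_eqM.
Qed.

Lemma order_ge_eq p m : order_eq p m -> order_ge p m.
Proof. by move=> [s [a [h1 _ h2]]]; exists s, a. Qed.

Lemma order_ge0 p : order_ge p 0.
Proof. by exists 1, p; rewrite rmorph1 oner_neq0 expr0. Qed.

Lemma order_ge_step p m : order_ge p m -> ~ order_eq p m -> order_ge p m.+1.
Proof.
move=> [s [w [hs e]]] ne; case: (eqVneq (evy w) 0) => [w0|w0]; last by case: ne; exists s, w.
have [q hq] := theta_gen w0; exists (u * s), q; split; first by rewrite rmorphM mulf_neq0.
by rewrite -mulrA rmorphM /= e -rmorphM mulrCA rmorphM /= hq -rmorphM mulrA -exprSr.
Qed.

(* The residue field of y is k, so an element of order m can be corrected by a multiple
   of any other element of order m. *)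
Lemma order_ge_sub p g m : order_ge p m -> order_eq g m -> exists c, order_ge (p - c *: g) m.+1.
Proof.
move=> [s [w [hs e]]] [s' [a [hs' ha e']]].
pose c := evy w * evy s' / (evy s * evy a); exists c.
have w0 : evy (s' * w - c *: (s * a)) = 0.
  rewrite mmapB mmapZ !rmorphM /= /c divfK ?mulf_neq0 // mulrC subrr //.
have [q hq] := theta_gen w0; exists (u * (s * s')), q; split; first by rewrite !rmorphM !mulf_neq0.
have -> : evx (u * (s * s') * (p - c *: g)) = evx (theta ^+ m) * evx (u * (s' * w - c *: (s * a))).
  have -> : u * (s * s') * (p - c *: g) = u * (s' * (s * p) - c *: (s * (s' * g))).
    by rewrite -!mul_mpolyC; ring.
  rewrite [LHS]rmorphM [in RHS]rmorphM /= !mmapB !mmapZ.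
  rewrite [evx (s' * (s * p))]rmorphM [evx (s * (s' * g))]rmorphM [evx (s' * w)]rmorphM.
  rewrite [evx (s * a)]rmorphM /= e e' !rmorphM /=; ring.
by rewrite hq exprSr !rmorphM /= mulrA.
Qed.

Lemma order_ge_zero p e m : order_ge p m -> (msize p <= e.+1)%N -> (D * e < m)%N -> evx p = 0.
Proof.
move=> [s [w [hs e1]]] hp hm; apply/eqP; apply: contraTT hm => p0; rewrite -leqNgt.
exact: (order_bound xi specialization hilb theta_y u_y theta_gen ntriv p0 hp hs e1).
Qed.

Lemma order_expansion (g : nat -> S) l p m : order_ge p l ->
  (forall j, (l <= j < m)%N -> order_eq (g j) j) -> (l <= m)%N ->
  exists c : nat -> k, order_ge (p - \sum_(l <= j < m) c j *: g j) m.
Proof.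
move=> hp hg; elim: m hg => [|m IH] hg.
  by rewrite leqn0 => /eqP l0; exists (fun=> 0); rewrite l0 big_geq // subr0 -l0.
rewrite leq_eqVlt => /orP [/eqP <-|].
  by exists (fun=> 0); rewrite big_geq // subr0.
rewrite ltnS => lm; have [|c hc] := IH _ lm.
  by move=> j /andP [h1 h2]; apply: hg; rewrite h1 ltnW.
have [|c' hc'] := order_ge_sub hc (hg m _); first by rewrite lm ltnSn.
exists (fun j => if j == m then c' else c j).
rewrite big_nat_recr //= eqxx opprD addrA.
rewrite (eq_big_nat _ _ (F2 := fun j => c j *: g j)) // => j /andP [_ hj].
by rewrite ltn_eqF.
Qed.

(** Nonzero forms of degree d have order at most D d at y. If the order m did not occur, every form
    could be expanded along the D d other orders until the rest vanishes by [order_ge_zero], against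
    the dimension D d + 1. *)
Lemma order_attained d m : (N0 <= d)%N -> (m <= D * d)%N ->
  exists2 g, g \is d.-homog & order_eq g m.
Proof.
move=> hd hm; apply: NNPP => hn.
have [b [bh bi _]] := hilb hd.
have [g hg] : exists g : nat -> S, forall j, g j \is d.-homog /\
    ((exists2 g, g \is d.-homog & order_eq g j) -> order_eq (g j) j).
  apply: (choice (fun j g => g \is d.-homog /\
    ((exists2 g, g \is d.-homog & order_eq g j) -> order_eq g j))) => j.
  case: (classic (exists2 g, g \is d.-homog & order_eq g j)) => [[g h1 h2]|h].
    by exists g.
  by exists 0; split=> //; exact: rpred0.
have expand p r : p \is d.-homog -> exists2 c : nat -> k, c m = 0 &
    order_ge (p - \sum_(j < r) c j *: g j) r.
  move=> hp; elim: r => [|r [c cm hc]].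
    by exists (fun=> 0) => //; rewrite big_ord0 subr0; apply: order_ge0.
  set q := p - _ in hc.
  have hq : q \is d.-homog.
    by apply: rpredB => //; apply: rpred_sum => j _; apply: rpredZ; case: (hg j).
  case: (classic (order_eq (g r) r)) => [gr|ngr].
    have [c' hc'] := order_ge_sub hc gr.
    exists (fun j => if j == r then c' else c j).
      by case: eqP => // mr; case: hn; exists (g r); rewrite ?mr //; case: (hg r).
    rewrite big_ord_recr /= eqxx opprD addrA.
    rewrite (eq_bigr (fun j : 'I_r => c j *: g j)) // => j _.
    by rewrite ltn_eqF.
  exists (fun j => if j == r then 0 else c j); first by case: eqP.
  rewrite big_ord_recr /= eqxx scale0r addr0.
  rewrite (eq_bigr (fun j : 'I_r => c j *: g j)) => [|j _]; last by rewrite ltn_eqF.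
  apply: order_ge_step hc _ => hqr; apply: ngr; apply: (hg r).2; by exists q.
pose o : 'I_(D * d).+1 := Ordinal (hm : (m < (D * d).+1)%N).
have := indep_leq (eval_kernel_submodule iota x) bi (g := fun t : 'I_(D * d) => g (lift o t)).
rewrite !card_ord => h; suff : (D * d + 1 <= D * d)%N by rewrite addn1 ltnn.
apply: h => l; have [c cm hc] := expand _ (D * d).+1 (bh l).
exists (fun t => c (lift o t)).
have -> : \sum_t c (lift o t) *: g (lift o t) = \sum_(j < (D * d).+1) c j *: g j.
  by rewrite (bigD1_ord o) //= cm scale0r add0r.
apply: (order_ge_zero (e := d) hc); last by [].
apply: msize_homog; apply: rpredB => //; apply: rpred_sum => j _; apply: rpredZ.
by case: (hg j).
Qed.

(** All D d zeros of v are at y, and v1 has one zero less there, so t = v1 / v has a simple pole at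
    y as its only pole. A form of degree l d divided by v^l has no other pole than y either, of
    order at most l D d, and so is a polynomial in t. *)
Lemma projective_coordinate : exists d (v t : F),
  [/\ (N0 <= d)%N, (0 < d)%N, v != 0,
      forall P : {poly k}, (map_poly iota P).[t] = 0 -> P = 0 &
      forall l p, p \is (l * d).-homog ->
        exists Q : {poly k}, (size Q <= (l * (D * d)).+1)%N /\ evx p = v ^+ l * (map_poly iota Q).[t]].
Proof.
pose d := N0.+1; have dN : (N0 <= d)%N by apply: leqnSn.
pose M := (D * d)%N; have M_gt0 : (0 < M)%N by rewrite muln_gt0 D_gt0.
have [v hv ov] := order_attained dN (leqnn M).
have [v1 hv1 ov1] := order_attained dN (leq_pred M).
have order_neq0 p m : order_eq p m -> evx p != 0.
  move=> [s [a [hs ha e]]]; apply: contraTneq (nonzero_x specialization ha) => p0.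
  move: e; rewrite !rmorphM rmorphXn /= p0 mulr0 => /esym/eqP; rewrite mulf_eq0 negbK.
  by rewrite expf_eq0 (negbTE (theta_x specialization u_y theta_gen ntriv)) andbF.
have v0 := order_neq0 _ _ ov; have v10 := order_neq0 _ _ ov1.
pose t := evx v1 / evx v; exists d, (evx v), t; split=> //.
- move=> P; case: (eqVneq P 0) => // P0 hP.
  have talg : algebraicOver iota t by exists P => //; apply/rootP.
  have [s [a [hs ha e]]] := ov; have [s1 [a1 [hs1 ha1 e1]]] := ov1.
  case: (@algebraic_unit _ _ _ iota idfun _ x y specialization t^-1 (theta * (a * s1)) (s * a1)).
  + exact: algebraic_inv.
  + by rewrite invr_eq0 mulf_neq0 ?invr_eq0.
  + by rewrite rmorphM /= theta_y mul0r.
  + by rewrite rmorphM mulf_neq0.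
  have th0 := theta_x specialization u_y theta_gen ntriv.
  apply: (mulfI (expf_neq0 M.-1 th0)); apply: (mulfI v10).
  have -> : evx v1 * (evx theta ^+ M.-1 * (t^-1 * evx (s * a1))) =
      evx (s * v) * (evx (theta ^+ M.-1 * a1)).
    by rewrite /t invf_div !rmorphM rmorphXn /=; field.
  rewrite e -e1 -(prednK M_gt0) exprSr !rmorphM !rmorphXn /=; ring.
move=> l p hp; pose N := (l * M)%N.
have lN : (l <= N)%N by rewrite leq_pmulr.
(* With r = N M - j, the form [g j] has order M N - r = j, and divided by v^N it is t^r. The factor
   v^(N - l) in q raises the order to N M - N at least, so that only 0 <= r <= N occurs. *)
pose g j := v ^+ (N - (N * M - j)) * v1 ^+ (N * M - j).
pose q := p * v ^+ (N - l).
have hXn (w : S) e r : w \is e.-homog -> w ^+ r \is (e * r).-homog.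
  move=> hw; elim: r => [|r IH]; first by rewrite expr0 muln0; exact: dhomog1.
  by rewrite exprS mulnS; apply: dhomogM.
have oq : order_ge q (N * M - N).
  have := order_geM (order_ge0 p) (order_ge_eq (order_eqX (N - l) ov)).
  by rewrite add0n mulnBr [(M * l)%N]mulnC -/N [(M * N)%N]mulnC.
have hg j : (N * M - N <= j < (N * M).+1)%N -> order_eq (g j) j.
  move=> /andP [h1 h2]; have := order_eqM (order_eqX (N - (N * M - j)) ov) (order_eqX (N * M - j) ov1).
  suff -> : (M * (N - (N * M - j)) + M.-1 * (N * M - j))%N = j by [].
  set r := (N * M - j)%N; have rN : (r <= N)%N by rewrite /r; lia.
  by rewrite mulnBr -subn1 mulnBl mul1n; move: (leq_mul (leqnn M) rN) M_gt0 h2; rewrite /r; nia.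
have [|c hc] := order_expansion oq hg; first by apply: leqW; apply: leq_subr.
have hq : q \is (d * N).-homog.
  have := dhomogM hp (hXn _ _ (N - l)%N hv).
  by rewrite [(l * d)%N]mulnC -mulnDr subnKC.
have hgh j : (N * M - N <= j < (N * M).+1)%N -> g j \is (d * N).-homog.
  move=> /andP [h1 h2]; have := dhomogM (hXn _ _ (N - (N * M - j))%N hv) (hXn _ _ (N * M - j)%N hv1).
  by rewrite -mulnDr subnK //; lia.
have e0 := order_ge_zero hc (e := (d * N)%N).
have {}e0 : evx q = evx (\sum_(N * M - N <= j < (N * M).+1) c j *: g j).
  apply/eqP; rewrite -subr_eq0 -mmapB; apply/eqP; apply: e0.
    apply: msize_homog; apply: rpredB => //; rewrite big_nat.
    by apply: rpred_sum => j hj; apply: rpredZ; apply: hgh.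
  by rewrite ltnS mulnA -/M mulnC.
pose Q := \sum_(N * M - N <= j < (N * M).+1) c j *: 'X^(N * M - j) : {poly k}.
exists Q; split.
  rewrite /Q big_nat; apply: (leq_trans (size_sum _ _ _)); apply/bigmax_leqP_seq => j _ /andP [h1 h2].
  by apply: leq_trans (size_scale_leq _ _) _; rewrite size_polyXn ltnS; lia.
apply: (mulIf (expf_neq0 (N - l) v0)); have -> : evx p * evx v ^+ (N - l) = evx q by rewrite /q rmorphM rmorphXn.
rewrite e0.
rewrite (raddf_sum (mmap iota x)) /Q (raddf_sum (map_poly iota)) horner_sum [RHS]mulrAC -exprD subnKC //.
rewrite mulr_sumr big_nat [RHS]big_nat; apply: eq_bigr => j /andP [h1 h2] /=.
rewrite mmapZ map_polyZ map_polyXn hornerZ hornerXn /g rmorphM !rmorphXn /= [RHS]mulrCA; congr (_ * _).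
have rN : (N * M - j <= N)%N by lia.
rewrite /t expr_div_n [RHS]mulrCA [RHS]mulrC; congr (_ * _).
have -> : evx v ^+ N = evx v ^+ (N - (N * M - j)) * evx v ^+ (N * M - j).
  by rewrite -exprD subnK.
by rewrite mulfK // expf_neq0.
Qed.

End RationalOrders.

Lemma size_prod_exp (L : fieldType) (o : option L) M (T : Type) (r : seq T) (Q : T -> {poly L}) (e : T -> nat) :
  (forall j, (size (Q j) <= M.+1)%N) ->
  (size (\prod_(j <- r) Q j ^+ e j)%R <= ((\sum_(j <- r) e j) * M).+1)%N /\
  proj_eval o ((\sum_(j <- r) e j) * M) (\prod_(j <- r) Q j ^+ e j) =
    \prod_(j <- r) proj_eval o M (Q j) ^+ e j.
Proof.
move=> hQ.
have ev1 : proj_eval o 0 1 = 1 by rewrite /proj_eval; case: o => [t|]; rewrite ?hornerC ?coef1.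
have step (A B : {poly L}) a b : (size A <= a.+1)%N -> (size B <= b.+1)%N ->
    (size (A * B)%R <= (a + b).+1)%N.
  by move=> hA hB; apply: leq_trans (size_polyMleq _ _) _; lia.
have hX j m : (size (Q j ^+ m)%R <= (m * M).+1)%N /\ proj_eval o (m * M) (Q j ^+ m) = proj_eval o M (Q j) ^+ m.
  elim: m => [|m [IH1 IH2]]; first by rewrite !expr0 mul0n size_poly1 ev1.
  by rewrite !exprS mulSn step // proj_evalM // IH2.
elim: r => [|j r [IH1 IH2]]; first by rewrite !big_nil mul0n size_poly1 ev1.
have [h1 h2] := hX j (e j).
by rewrite !big_cons mulnDl step // proj_evalM // h2 IH2.
Qed.

(** The [Q j] count as sections of degree M, so a form of degree e in them is a section of degree e
    M; this bookkeeping matters at infinity. *)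
Lemma proj_eval_mmap (K L : fieldType) (f : {rmorphism K -> L}) (o : option L) M n
    (Q : 'I_n -> {poly L}) e (p : {mpoly K[n]}) :
  (forall j, (size (Q j) <= M.+1)%N) -> p \is e.-homog ->
  proj_eval o (e * M) (mmap (polyC \o f) Q p) = mmap f (fun j => proj_eval o M (Q j)) p.
Proof.
move=> hQ hp; rewrite /mmap !big_seq.
have -> : proj_eval o (e * M) (\sum_(m <- msupp p | m \in msupp p) (polyC \o f) p@_m * mmap1 Q m) =
  \sum_(m <- msupp p | m \in msupp p) proj_eval o (e * M) ((polyC \o f) p@_m * mmap1 Q m).
  elim/big_ind2: _ => // [|A a B b <- <-]; last by rewrite proj_evalD.
  by have := proj_evalB o (e * M) 0 0; rewrite !subrr.
apply: eq_bigr => m hm; rewrite /= mul_polyC proj_evalZ; congr (_ * _).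
have [_] := size_prod_exp o (index_enum 'I_n) m hQ; rewrite -mdegE.
by rewrite (dhomog_mf hp hm).
Qed.

(** * The point of the curve over K *)

Section KPoint.
Variables (K : fieldType) (n : nat) (eqs : seq {mpoly K[n.+1]}).
Variables (D N0 : nat) (bK : forall d, 'I_(D * d + 1) -> {mpoly K[n.+1]}).
Hypotheses (D_gt0 : (0 < D)%N)
  (eqs_homog : forall p, p \in eqs -> p \is homog mdeg)
  (bK_basis : forall d, (N0 <= d)%N -> graded_basis (ideal_gen eqs) d (@bK d))
  (smooth : forall (L : fieldType) (kappa : {rmorphism K -> L}) (y : 'I_n.+1 -> L),
     (exists j, y j != 0) -> (forall p, p \in eqs -> mmap kappa y p = 0) ->
     (\rank (\matrix_(a < size eqs, j < n.+1) mmap kappa y (eqs`_a)^`M(j))).+1 = n)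
  (eqs_prime : proj_prime (ideal_gen eqs))
  (eqs_chain : proj_chain 1 (ideal_gen eqs))
  (two : 2%:R != 0 :> K)
  (isotropic : forall Q : 'M[K]_3, exists a : 'cV[K]_3, a != 0 /\ (a^T *m Q *m a) 0 0 = 0).

(** [V l] consists of the K-forms of degree l d, written as v^l times a polynomial in t. At the
    point o given by [conic_descent] they are K-rational up to a factor, and coordinates are read
    off from the forms g X_j, where g is a monomial of degree d - 1 such that some g X_j is nonzero
    at o. *)
Lemma descended_point : exists z : 'I_n.+1 -> K,
  (exists j, z j != 0) /\ forall p, p \in eqs -> mmap idfun z p = 0.
Proof.
have [L [h [F [iota [x [i [y [gp yi spec]]]]]]]] :=
  rational_point D_gt0 eqs_homog bK_basis smooth eqs_prime eqs_chain.
have yalg j : algebraicOver (idfun : {rmorphism L -> L}) (y j) by apply: algebraic_id.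
have [theta [u [theta_y u_y theta_gen]]] := point_local_parameter eqs_homog smooth gp yi spec yalg.
have hilb d : (N0 <= d)%N ->
    exists b : 'I_(D * d + 1) -> {mpoly L[n.+1]}, graded_basis (eval_kernel iota x) d b.
  by move=> hd; eexists; apply: (generic_basis bK_basis gp hd).
have [d [v [t [dN d0 v0 trans val]]]] :=
  projective_coordinate D_gt0 (gp_norm gp) spec hilb theta_y u_y theta_gen.
pose M := (D * d)%N.
have M_gt0 : (0 < M)%N by rewrite muln_gt0 D_gt0.
pose ev (Q : {poly L}) := (map_poly iota Q).[t].
have evD P Q : ev (P + Q) = ev P + ev Q by rewrite /ev rmorphD hornerD.
have evM P Q : ev (P * Q) = ev P * ev Q by rewrite /ev rmorphM hornerM.
have evZ c P : ev (c *: P) = iota c * ev P by rewrite /ev map_polyZ hornerZ.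
have evsum (T : finType) (G : T -> {poly L}) : ev (\sum_t G t) = \sum_t ev (G t).
  by rewrite /ev (raddf_sum (map_poly iota)) horner_sum.
have evinj P Q : ev P = ev Q -> P = Q.
  move=> e; apply/eqP; rewrite -subr_eq0; apply/eqP/trans.
  by rewrite raddfB hornerD hornerN -/(ev P) -/(ev Q) e subrr.
pose xK := mmap (iota \o h) x.
pose V l (Q : {poly L}) := (size Q <= (l * M).+1)%N /\
  exists2 p : {mpoly K[n.+1]}, p \is (l * d).-homog & xK p = v ^+ l * ev Q.
have valK l (p : {mpoly K[n.+1]}) : p \is (l * d).-homog -> exists Q, V l Q /\ xK p = v ^+ l * ev Q.
  move=> hp; have [Q [sQ eQ]] := val l _ (homog_map_mpoly h hp).
  by exists Q; rewrite mmap_map_mpoly in eQ; split=> //; split=> //; exists p.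
have V_size l Q : V l Q -> (size Q <= (l * M).+1)%N by case.
have V_add l P Q : V l P -> V l Q -> V l (P + Q).
  move=> [sP [p hp eP]] [sQ [q hq eQ]]; split.
    by apply: leq_trans (size_polyD _ _) _; rewrite geq_max sP.
  by exists (p + q); [exact: rpredD|rewrite /xK mmapD -!/(xK _) eP eQ evD mulrDr].
have V_scale l c Q : V l Q -> V l (h c *: Q).
  move=> [sQ [q hq eQ]]; split; first exact: leq_trans (size_scale_leq _ _) sQ.
  by exists (c *: q); [exact: rpredZ|rewrite /xK mmapZ -!/(xK _) eQ evZ /= mulrCA].
have V_mul l m P Q : V l P -> V m Q -> V (l + m) (P * Q).
  move=> [sP [p hp eP]] [sQ [q hq eQ]]; split.
    by apply: leq_trans (size_polyMleq _ _) _; lia.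
  exists (p * q); first by rewrite mulnDl; apply: dhomogM.
  by rewrite /xK rmorphM /= -!/(xK _) eP eQ evM exprD mulrACA.
have V_basis l : (0 < l)%N -> exists B : 'I_(l * M).+1 -> {poly L},
     [/\ forall j, V l (B j),
       forall c : 'I_(l * M).+1 -> L, \sum_j c j *: B j = 0 -> forall j, c j = 0 &
       forall Q, V l Q -> exists c : 'I_(l * M).+1 -> K, Q = \sum_j h (c j) *: B j].
  move=> l0; have eN : (D * (l * d) + 1 = (l * M).+1)%N by rewrite addn1 mulnCA.
  have hd : (N0 <= l * d)%N by apply: leq_trans dN _; rewrite leq_pmull.
  rewrite -eN; have [b1 b2 b3] := bK_basis hd.
  have [B hB] := choice _ (fun j => valK l _ (b1 j)).
  have vl : v ^+ l != 0 by rewrite expf_neq0.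
  exists B; split=> [j|c hc|Q [sQ [q hq eQ]]]; first by case: (hB j).
    apply: (gp_indep gp hd); rewrite /eval_kernel eval_lincomb.
    transitivity (v ^+ l * ev (\sum_j c j *: B j)); last first.
      by rewrite hc /ev rmorph0 horner0 mulr0.
    rewrite evsum mulr_sumr; apply: eq_bigr => j _.
    by rewrite mmap_map_mpoly -/(xK _) (hB j).2 evZ mulrCA.
  have [c [c' hc]] := b3 q hq; exists c; apply: evinj; apply: (mulfI vl); rewrite -eQ.
  rewrite evsum mulr_sumr.
  have : xK (q - \sum_j c j *: bK j) = 0.
    rewrite hc /xK (raddf_sum (mmap _ _)) big1 // => j _ /=.
    by rewrite rmorphM /= [X in _ * X](gp_eqs gp) ?mulr0 // mem_nth.
  rewrite /xK mmapB eval_lincomb => /eqP; rewrite subr_eq0 => /eqP ->.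
  by apply: eq_bigr => j _; rewrite -/(xK _) (hB j).2 evZ /= mulrCA.
have [o [lam [lam0 hlam [P0 VP0 P00]]]] :=
  conic_descent M_gt0 V_size V_add V_scale V_mul V_basis two isotropic.
(* The section P0 is nonzero at o, so one of the monomials of a form representing it is. *)
have [m [hm Qm0]] : exists m : 'X_{1..n.+1}, mdeg m = d /\
    forall Q, xK 'X_[m] = v ^+ 1 * ev Q -> proj_eval o (1 * M) Q != 0.
  have [sP0 [p hp eP]] := VP0; apply: NNPP => hn; case/negP: P00; apply/eqP.
  rewrite mul1n in hp.
  have hmon m : m \in msupp p -> exists Q, xK 'X_[m] = v ^+ 1 * ev Q /\ proj_eval o (1 * M) Q = 0.
    move=> hm; apply: NNPP => h'; apply: hn; exists m; split; first exact: (dhomog_mf hp hm).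
    by move=> Q eQ; apply/eqP => Q0; apply: h'; exists Q.
  have : exists Q, xK p = v ^+ 1 * ev Q /\ proj_eval o (1 * M) Q = 0.
    have ev0 : proj_eval o (1 * M) 0 = 0 by have := proj_evalB o (1 * M) 0 0; rewrite !subrr.
    rewrite {1}(mpolyE p) big_seq; elim/big_ind: _ => [|p1 p2 [Q1 [e1 z1]] [Q2 [e2 z2]]|m /hmon [Q [e1 z1]]].
    - by exists 0; rewrite /xK mmap0 /ev rmorph0 horner0 mulr0.
    - by exists (Q1 + Q2); rewrite /xK mmapD -!/(xK _) e1 e2 evD mulrDr proj_evalD z1 z2 addr0.
    - by exists (h p@_m *: Q); rewrite /xK mmapZ -!/(xK _) e1 evZ proj_evalZ z1 mulr0 /= mulrCA.
  move=> [Q [eQ Q0]]; suff -> : P0 = Q by [].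
  by apply: evinj; apply: (mulfI (expf_neq0 1 v0)); rewrite -eP -eQ.
have [j0 hj0] : exists j0, (0 < m j0)%N.
  apply: NNPP => hn; move: d0; rewrite -hm mdegE big1 // => j _.
  by apply/eqP; apply: contra_notT hn; rewrite -lt0n; exists j.
pose g : {mpoly K[n.+1]} := 'X_[m - U_(j0)].
have hg : g \is d.-1.-homog.
  rewrite dhomogX /=; have : (U_(j0) + (m - U_(j0)) = m)%MM.
    rewrite addmC submK //; apply/mnm_lepP => j; rewrite mnm1E; case: eqP => [<-|] //.
  by move/(congr1 mdeg); rewrite mdegD mdeg1 hm => <-.
have hgX j : g * 'X_j \is (1 * d).-homog.
  by rewrite mul1n -(prednK d0) -[d.-1.+1]addn1; apply: dhomogM => //; apply: homog_X.
have [Q hQ] := choice _ (fun j => valK 1 _ (hgX j)).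
have [z hz] := choice _ (fun j => hlam _ (hQ j).1).
exists z; split.
  exists j0; have := Qm0 (Q j0); rewrite -(hQ j0).2 hz mulf_eq0 (negbTE lam0) fmorph_eq0; apply.
  rewrite /g -mpolyXD submK //; apply/mnm_lepP => j; rewrite mnm1E; case: eqP => [<-|] //.
move=> p hp; have /homogP [e he] := eqs_homog hp.
(* In F the [Q j] are proportional to the coordinates x_j of the generic point, so they satisfy the
   equations identically in t, and the identity can be evaluated at o. *)
have Qp : mmap (polyC \o h) Q p = 0.
  apply: evinj; rewrite [RHS]/ev rmorph0 horner0.
  pose evr : {rmorphism {poly L} -> F} := horner_eval t \o map_poly iota.
  rewrite -[LHS]/(evr _) rmorph_mmap_comp.
  transitivity (mmap (iota \o h) (fun j => (v^-1 * xK g) * x j) p).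
    apply: eq_mmap => [c|j]; first by rewrite /= map_polyC /horner_eval hornerC.
    rewrite -[LHS]/(ev (Q j)) -mulrA.
    have -> : xK g * x j = xK (g * 'X_j) by rewrite /xK rmorphM /= [X in _ = _ * X]mmapX mmap1U.
    by rewrite (hQ j).2 expr1 mulKf.
  by rewrite (mmap_scale _ _ _ he) (gp_eqs gp hp) mulr0.
have := proj_eval_mmap h o (fun j => V_size 1%N _ (hQ j).1) he; rewrite Qp.
have -> : proj_eval o (e * (1 * M)) 0 = 0.
  by have := proj_evalB o (e * (1 * M)) 0 0; rewrite !subrr.
have -> : mmap h (fun j => proj_eval o (1 * M) (Q j)) p = mmap h (fun j => lam * h (z j)) p.
  by apply: eq_mmap => // j; apply: hz.
rewrite (mmap_scale _ _ _ he) => /esym/eqP; rewrite mulf_eq0 expf_eq0 (negbTE lam0) andbF /=.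
have -> : mmap h (fun j => h (z j)) p = h (mmap idfun z p).
  by rewrite rmorph_mmap_comp; apply: eq_mmap.
by rewrite fmorph_eq0 => /eqP.
Qed.
End KPoint.

(** * Ternary quadratic forms *)

Lemma nonzero_kernel (K : fieldType) m n (A : 'M[K]_(m, n)) : (m < n)%N ->
  exists2 x : 'cV[K]_n, x != 0 & A *m x = 0.
Proof.
move=> mn; have : kermx A^T != 0.
  rewrite -mxrank_eq0 mxrank_ker mxrank_tr subn_eq0 -ltnNge.
  by apply: leq_ltn_trans (rank_leq_row A) mn.
move=> /rowV0Pn [v /sub_kermxP hv v0]; exists v^T; first by rewrite trmx_eq0.
by apply: trmx_inj; rewrite trmx_mul trmxK hv trmx0.
Qed.

(* Diagonalize the form: it suffices to solve a x^2 + b y^2 = 1. *)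
Lemma ternary_isotropic (K : fieldType) : 2%:R != 0 :> K ->
  (forall a b : K, a != 0 -> b != 0 -> exists x y, a * x ^+ 2 + b * y ^+ 2 = 1) ->
  forall Q : 'M[K]_3, exists a : 'cV[K]_3, a != 0 /\ (a^T *m Q *m a) 0 0 = 0.
Proof.
move=> two universal Q.
pose B (x y : 'cV[K]_3) := (x^T *m (Q + Q^T) *m y) 0 0.
pose q (x : 'cV[K]_3) := (x^T *m Q *m x) 0 0.
have Bsym x y : B x y = B y x.
  rewrite /B.
  have <- : (x^T *m (Q + Q^T) *m y)^T = y^T *m (Q + Q^T) *m x.
    by rewrite !trmx_mul trmxK linearD /= trmxK addrC mulmxA.
  by rewrite [RHS]mxE.
have BD x y z : B (x + y) z = B x z + B y z.
  by rewrite /B [(x + y)^T]raddfD /= !mulmxDl mxE.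
have BZ c x z : B (c *: x) z = c * B x z by rewrite /B [(c *: x)^T]linearZ /= -!scalemxAl mxE.
have qB x : B x x = 2%:R * q x.
  rewrite /B mulmxDr mulmxDl mxE.
  have -> : x^T *m Q^T *m x = (x^T *m Q *m x)^T by rewrite !trmx_mul trmxK mulmxA.
  by rewrite [(_^T) _ _]mxE -/(q x); ring.
(* Arguing by contradiction makes the form anisotropic, so that the orthogonal vectors e0, e1, e2
   take nonzero values. *)
apply: NNPP => hn.
have aniso x : x != 0 -> q x != 0 by move=> x0; apply: contra_notN hn => /eqP qx; exists x.
pose e0 : 'cV[K]_3 := delta_mx 0 0.
have e00 : e0 != 0 by apply/eqP => /matrixP/(_ 0 0)/eqP; rewrite !mxE oner_eq0.
have [e1 e10 h1] := nonzero_kernel (e0^T *m (Q + Q^T)) (isT : (1 < 3)%N).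
have [e2 e20 h2] := nonzero_kernel (col_mx (e0^T *m (Q + Q^T)) (e1^T *m (Q + Q^T))) (isT : (1 + 1 < 3)%N).
have b01 : B e0 e1 = 0 by rewrite /B h1 mxE.
move: h2; rewrite mul_col_mx -[0]vsubmxK => /eq_col_mx [h02 h12].
have b02 : B e0 e2 = 0 by rewrite /B h02 !mxE.
have b12 : B e1 e2 = 0 by rewrite /B h12 !mxE.
have q0 := aniso _ e00; have q1 := aniso _ e10; have q2 := aniso _ e20.
have [||x [y hxy]] := universal (- q e0 / q e2) (- q e1 / q e2).
- by rewrite mulf_neq0 ?oppr_eq0 ?invr_eq0.
- by rewrite mulf_neq0 ?oppr_eq0 ?invr_eq0.
pose z := x *: e0 + y *: e1 + e2.
have Bz2 : B z e2 = 2%:R * q e2 by rewrite /z !BD !BZ b02 b12 !mulr0 !add0r qB.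
have Bz : B z z = 2%:R * (x ^+ 2 * q e0 + y ^+ 2 * q e1 + q e2).
  rewrite {1}/z !BD !BZ ![B _ z]Bsym Bz2 /z !BD !BZ ?[B e1 e0]Bsym ?[B e2 e0]Bsym ?[B e2 e1]Bsym.
  by rewrite b01 b02 b12 !qB; ring.
have qz : q z = 0.
  apply: (mulfI two); rewrite -qB Bz mulr0.
  have -> : x ^+ 2 * q e0 + y ^+ 2 * q e1 + q e2 = 0; last by rewrite mulr0.
  have -> : x ^+ 2 * q e0 + y ^+ 2 * q e1 + q e2 =
      q e2 * (1 - (- q e0 / q e2 * x ^+ 2 + - q e1 / q e2 * y ^+ 2)) by field.
  by rewrite hxy subrr mulr0.
have z0 : z != 0.
  apply: contra_eqN Bz2 => /eqP ->.
  by rewrite /B trmx0 !mul0mx mxE eq_sym mulf_neq0.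
by have := aniso _ z0; rewrite qz eqxx.
Qed.

(** * Systems of squares over a large field *)

(** Power series have no zero divisors, in terms of truncations. *)
Lemma dvdXn_mul (K : fieldType) N M (f g : {poly K}) :
  'X^(N + M) %| f * g -> 'X^N %| f \/ 'X^M %| g.
Proof.
elim: N M f g => [|N IH] M f g; first by left; rewrite expr0 dvd1p.
elim: M f g => [|M IHM] f g h; first by right; rewrite expr0 dvd1p.
have : root (f * g) 0.
  rewrite -dvdp_XsubCl subr0; apply: dvdp_trans h.
  by rewrite addSn exprS dvdp_mulIl.
rewrite rootM -!dvdp_XsubCl subr0 => /orP [] /dvdpP [f1 e1].
  case: (IH M.+1 f1 g) => [|h1|h1]; [|left|by right].
    move: h; rewrite e1 mulrAC addSn exprSr dvdp_mul2r ?polyX_eq0 //.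
  by rewrite e1 exprSr dvdp_mul.
case: (IHM f f1) => [|h1|h1]; [|by left|right].
  by move: h; rewrite e1 mulrA addnS exprSr dvdp_mul2r ?polyX_eq0.
by rewrite e1 exprSr dvdp_mul.
Qed.

Lemma coef_dvdXn (K : fieldType) N (f : {poly K}) i : 'X^N %| f -> (i < N)%N -> f`_i = 0.
Proof. by move=> /dvdpP [q ->] hi; rewrite coefMXn hi. Qed.

Lemma dvdX (K : fieldType) (f : {poly K}) : f`_0 = 0 -> 'X %| f.
Proof.
move=> h; have : root f 0 by rewrite /root horner_coef0 h.
by rewrite -dvdp_XsubCl subr0.
Qed.

(** Newton's iteration for the square root of 1 + e X^2, one coefficient at a time; each correction
    c divides by 2. *)
Lemma sqrt_series (K : fieldType) (e : K) : 2%:R != 0 :> K ->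
  exists z : nat -> {poly K}, forall N,
    [/\ (z N)`_0 = 1, 'X^N %| z N ^+ 2 - (1 + e *: 'X^2) & 'X^N %| z N.+1 - z N].
Proof.
move=> two; pose good N (z : {poly K}) := z`_0 = 1 /\ 'X^N %| z ^+ 2 - (1 + e *: 'X^2).
have step (w : nat * {poly K}) : exists z', good w.1 w.2 -> good w.1.+1 z' /\ 'X^(w.1) %| z' - w.2.
  case: w => N0 z /=; case: (classic (good N0 z)) => [[z0 hz]|h]; last by exists 0.
  case: N0 hz => [|N] hz.
    exists z => _; rewrite expr0 dvd1p; split=> //; split=> //.
    rewrite expr1; apply: dvdX; rewrite !coefB !coefD coefZ coefXn coef1 -!horner_coef0.
    by rewrite horner_exp horner_coef0 z0 expr1n mulr0 addr0 subrr.
  have /dvdpP [r hr] := hz.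
  pose c := - r`_0 / 2%:R; exists (z + c *: 'X^(N.+1)) => _; split; last first.
    by rewrite addrAC subrr add0r -mul_polyC dvdp_mulIr.
  split; first by rewrite coefD coefZ coefXn mulr0 addr0.
  have -> : (z + c *: 'X^(N.+1)) ^+ 2 - (1 + e *: 'X^2) =
      (r + (c%:P * z + c%:P * z) + (c ^+ 2)%:P * 'X^(N.+1)) * 'X^(N.+1).
    have -> : (z + c *: 'X^(N.+1)) ^+ 2 - (1 + e *: 'X^2) =
        (z ^+ 2 - (1 + e *: 'X^2)) + (c%:P * z + c%:P * z) * 'X^(N.+1) + (c ^+ 2)%:P * 'X^(N.+1) * 'X^(N.+1).
      by rewrite -!mul_polyC polyC_exp; ring.
    by rewrite hr; ring.
  rewrite [X in X %| _]exprS dvdp_mul //; apply: dvdX.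
  rewrite !coefD !coefCM coefXn z0 mulr0 addr0 mulr1.
  by rewrite -mulr2n -mulr_natr /c divfK // subrr.
have [F hF] := choice _ step.
pose z := fix z N := if N is N'.+1 then F (N', z N') else 1.
have gz N : good N (z N).
  elim: N => [|N IH]; first by split; rewrite ?coef1 // expr0 dvd1p.
  exact: (hF (N, z N) IH).1.
exists z => N; have [h1 h2] := gz N; split=> //.
exact: (hF (N, z N) (gz N)).2.
Qed.

Lemma mpoly_ring_ind (k : fieldType) n (P : {mpoly k[n]} -> Prop) :
  (forall c, P c%:MP) -> (forall i, P 'X_i) -> (forall p q, P p -> P q -> P (p + q)) ->
  (forall p q, P p -> P q -> P (p * q)) -> forall p, P p.
Proof.
move=> hC hX hD hM p; rewrite (mpolyE p).
have P0 : P 0 by rewrite -mpolyC0.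
elim/big_ind: _ => // m _; rewrite -mul_mpolyC; apply: (hM) => //.
rewrite mpolyXE_id; elim/big_ind: _ => [||i _]; [by rewrite -mpolyC1|by move=> *; apply: hM|].
by elim: (m i) => [|e IH]; [rewrite expr0 -mpolyC1|rewrite exprS; apply: hM].
Qed.

Lemma coef0_mmap (k : fieldType) n (Q : 'I_n -> {poly k}) p :
  (mmap polyC Q p)`_0 = mmap idfun (fun j => (Q j)`_0) p.
Proof.
elim/mpoly_ring_ind: p => [c|i|p q hp hq|p q hp hq].
- by rewrite !mmapC coefC.
- by rewrite !mmapX !mmap1U.
- by rewrite !mmapD coefD hp hq.
- by rewrite !rmorphM /= coefM big_ord_recl big_ord0 addr0 hp hq.
Qed.

Lemma coef1_mmap (k : fieldType) n (Q : 'I_n -> {poly k}) p :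
  (mmap polyC Q p)`_1 = \sum_j mmap idfun (fun j => (Q j)`_0) p^`M(j) * (Q j)`_1.
Proof.
elim/mpoly_ring_ind: p => [c|i|p q hp hq|p q hp hq].
- by rewrite mmapC coefC /= big1 // => j _; rewrite mderivC mmap0 mul0r.
- rewrite mmapX mmap1U (bigD1 i) //= mderivX mnm1E eqxx big1 => [|j /negbTE ne].
    have -> : (U_(i) - U_(i) = 0)%MM by apply/mnmP => j; rewrite mnmBE subnn mnm0E.
    by rewrite scale1r mpolyX0 rmorph1 mul1r addr0.
  by rewrite mderivX mnm1E eq_sym ne scale0r mmap0 mul0r.
- rewrite mmapD coefD hp hq -big_split; apply: eq_bigr => j _ /=.
  by rewrite mderivD mmapD mulrDl.
rewrite rmorphM /= coefM big_ord_recl big_ord1 /= hp hq !coef0_mmap mulr_sumr mulr_suml -big_split.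
apply: eq_bigr => j _ /=; rewrite mderivM mmapD !rmorphM /=; ring.
Qed.

(** * Formal branches of curves *)

Section Branch.
Variables (K : fieldType) (n : nat) (xi : nat -> 'I_n.+1 -> {poly K}).
Hypotheses (xi_coherent : forall N j, 'X^N %| xi N.+1 j - xi N j) (xi0 : forall N, xi N ord0 = 1).
Local Notation S := {mpoly K[n.+1]}.
Local Notation ev N := (mmap polyC (xi N)).

(* The homogeneous polynomials vanishing along the formal branch lim xi. *)
Definition branch_ideal (p : S) := forall d N, 'X^N %| ev N (pihomog mdeg d p).

Lemma branch_coherent N M p : (N <= M)%N -> 'X^N %| ev M p - ev N p.
Proof.
move=> /subnKC <-; elim: (M - N)%N => {M} [|M IH]; first by rewrite addn0 subrr dvdp0.
rewrite addnS -(subrK (ev (N + M) p) (ev (N + M).+1 p)) -addrA dvdp_add //.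
apply: (@dvdp_trans _ 'X^(N + M)); first by rewrite exprD dvdp_mulIl.
elim/mpoly_ring_ind: p {IH} => [c|i|p q hp hq|p q hp hq].
- by rewrite !mmapC subrr dvdp0.
- by rewrite !mmapX !mmap1U.
- by rewrite !mmapD opprD addrACA dvdp_add.
rewrite !rmorphM /=.
have -> : ev (N + M).+1 p * ev (N + M).+1 q - ev (N + M) p * ev (N + M) q =
    ev (N + M).+1 p * (ev (N + M).+1 q - ev (N + M) q) +
    (ev (N + M).+1 p - ev (N + M) p) * ev (N + M) q by ring.
by apply: dvdp_add; [apply: dvdp_mull|apply: dvdp_mulr].
Qed.

Lemma branch_ideal_homog d p : p \is d.-homog -> branch_ideal p <-> forall N, 'X^N %| ev N p.
Proof.
move=> hp; split=> [h N|h e N]; first by have := h d N; rewrite pihomog_dE.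
case: (eqVneq d e) => [<-|ne]; first by rewrite pihomog_dE.
by rewrite (pihomog_ne0 ne hp) mmap0 dvdp0.
Qed.

Lemma branch_ideal_prime : proj_prime branch_ideal.
Proof.
have hI : ring_ideal branch_ideal.
  have h0 : branch_ideal 0 by move=> d N; rewrite pihomog0 mmap0 dvdp0.
  have hD p q : branch_ideal p -> branch_ideal q -> branch_ideal (p + q).
    by move=> hp hq d N; rewrite pihomogD mmapD dvdp_add.
  split=> // p q hq; apply: (homog_ind (P := fun p => branch_ideal (p * q))) => [||a d N].
  - by rewrite mul0r.
  - by move=> u v hu hv; rewrite mulrDl; apply: hD.
  rewrite [pihomog _ _ p * q]mulrC; case: (ltnP d a) => hd.
    by rewrite (pihomogM_lt _ (pihomogP _ _ _)) // mmap0 dvdp0.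
  by rewrite -(subnK hd) (pihomogM _ _ (pihomogP _ _ _)) rmorphM /= dvdp_mulr.
have hh : is_homog_ideal branch_ideal.
  move=> p d hp e N; case: (eqVneq d e) => [<-|ne]; first by rewrite pihomog_id.
  by rewrite (pihomog_ne0 ne (pihomogP _ _ _)) mmap0 dvdp0.
have n1 : ~ branch_ideal 1.
  move/(branch_ideal_homog (dhomog1 _ _))/(_ 1%N); rewrite rmorph1 expr1 => /dvdp_leq.
  by rewrite oner_eq0 size_polyX size_poly1 => /(_ isT).
split=> //; last first.
  exists ord0; move/(branch_ideal_homog (homog_X _ _))/(_ 1%N).
  rewrite mmapX mmap1U xi0 expr1 => /dvdp_leq.
  by rewrite oner_eq0 size_polyX size_poly1 => /(_ isT).
split=> //; apply: homog_prime => // a b d e ha hb hab.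
case: (classic (branch_ideal a)) => [|na]; first by left.
case: (classic (branch_ideal b)) => [|nb]; first by right.
have [N hN] : exists N, ~~ ('X^N %| ev N a).
  by apply: NNPP => hn; apply: na; apply/(branch_ideal_homog ha) => N; apply: contra_notT hn => h; exists N.
have [M hM] : exists N, ~~ ('X^N %| ev N b).
  by apply: NNPP => hn; apply: nb; apply/(branch_ideal_homog hb) => M; apply: contra_notT hn => h; exists M.
have := (branch_ideal_homog (dhomogM ha hb)).1 hab (N + M)%N; rewrite rmorphM /=.
move/dvdXn_mul => [h|h].
  case/negP: hN; rewrite -(subrK (ev (N + M) a) (ev N a)) dvdp_add // -opprB dvdpNr.
  by apply: branch_coherent; apply: leq_addr.
case/negP: hM; rewrite -(subrK (ev (N + M) b) (ev M b)) dvdp_add // -opprB dvdpNr.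
by apply: branch_coherent; apply: leq_addl.
Qed.

Lemma branch_point p : branch_ideal p -> forall d,
  mmap idfun (fun j => (xi 1%N j)`_0) (pihomog mdeg d p) = 0.
Proof.
by move=> h d; rewrite -coef0_mmap (coef_dvdXn (h d 1%N)).
Qed.

Lemma branch_tangent p d : p \is d.-homog -> branch_ideal p ->
  \sum_j mmap idfun (fun j => (xi 2%N j)`_0) p^`M(j) * (xi 2%N j)`_1 = 0.
Proof.
by move=> hp /(branch_ideal_homog hp)/(_ 2%N) h; rewrite -coef1_mmap (coef_dvdXn h).
Qed.

End Branch.

Lemma homog_generators (k : fieldType) n (I : {mpoly k[n.+1]} -> Prop) :
  ring_ideal I -> is_homog_ideal I ->
  exists s, (forall p, p \in s -> p \is homog mdeg) /\ forall p, ideal_gen s p <-> I p.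
Proof.
move=> hI hh; have [g gI gen] := noetherian_mpoly hI.
pose s := flatten [seq [seq pihomog mdeg d p | d <- iota 0 (msize p)] | p <- g].
have sI p : p \in s -> I p.
  by move=> /flatten_mapP [q hq /mapP [d _ ->]]; apply/hh/gI.
have [I0 ID IM] := hI.
exists s; split=> [p /flatten_mapP [q hq /mapP [d _ ->]]|p].
  by apply/homogP; exists d; apply: pihomogP.
split=> [[c ->]|/gen].
  by elim/big_ind: _ => // a _; apply: IM; apply: sI; apply: mem_nth.
have sid : ring_ideal (ideal_gen s).
  split=> [|u v [c ->] [c' ->]|u v [c ->]].
  - by exists (fun=> 0); rewrite big1 // => a _; rewrite mul0r.
  - by exists (fun a => c a + c' a); rewrite -big_split; apply: eq_bigr => a _; rewrite mulrDl.
  - by exists (fun a => u * c a); rewrite mulr_sumr; apply: eq_bigr => a _; rewrite mulrA.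
apply=> // q hq; have [s0 sD sM] := sid.
rewrite (pihomog_partitionE (k := msize q) (mf := mdeg) (p := q)) //.
elim/big_ind: _ => // d _.
have /(nthP 0) [a ha <-] : pihomog mdeg d q \in s.
  by apply/flatten_mapP; exists q => //; apply: map_f; rewrite mem_iota add0n ltn_ord.
exists (fun b => (b == Ordinal ha)%:R).
rewrite (bigD1 (Ordinal ha)) //= eqxx mul1r big1 ?addr0 // => b /negbTE ->.
by rewrite mul0r.
Qed.

(** * Bounding the dimension by the Hilbert function *)

Section Dimension.
Variables (k : fieldType) (n : nat).
Local Notation S := {mpoly k[n.+1]}.

(** Modulo Q only the term without a survives, so its coefficients vanish; then a is cancelled
    modulo P, and induction applies. *)
Lemma prime_powers_indep (P Q : S -> Prop) a r (T : finType) (f : nat -> T -> S) (c : nat -> T -> k) :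
  is_prime P -> ring_ideal Q -> (forall p, P p -> Q p) -> ~ P a -> Q a ->
  (forall i, indep Q (f i)) ->
  P (\sum_(i < r) a ^+ i * \sum_t c i t *: f i t) -> forall i, (i < r)%N -> forall t, c i t = 0.
Proof.
move=> hP hQ sub na Qa; have [Q0 QD QM] := hQ; have [_ _ Pprime] := hP.
elim: r f c => [//|r IH] f c hf; rewrite big_ord_recl expr0 mul1r => h.
have e : \sum_(i < r) a ^+ lift ord0 i * \sum_t c (lift ord0 i) t *: f (lift ord0 i) t =
    a * \sum_(i < r) a ^+ i * \sum_t c i.+1 t *: f i.+1 t.
  by rewrite mulr_sumr; apply: eq_bigr => i _; rewrite /= /bump /= add1n exprS mulrA.
rewrite e in h.
have c0 t : c 0%N t = 0.
  apply: (hf 0%N (c 0%N)); move/sub: h => h.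
  set u := \sum_t _ in h *; set w := \sum_(i < r) _ in h.
  have -> : u = (u + a * w) + (- w) * a by ring.
  by apply: QD => //; apply: QM.
move: h; rewrite big1 => [|t _]; last by rewrite c0 scale0r.
rewrite add0r => /Pprime [//|h] [//|i] hi t.
exact: (IH (fun i => f i.+1) (fun i => c i.+1)).
Qed.

(** A chain P, Q1, Q2 with forms a in Q1 outside P and b in Q2 outside Q1 gives r^2 independent
    forms of degree d, a^i b^l times a power of X_j. As d is linear in r, this exceeds a linear
    bound on the Hilbert function. *)
Lemma dim_le1 (P : S -> Prop) C : proj_prime P ->
  (forall d, exists (T : finType) (g : T -> S), (#|T| <= C * d.+1)%N /\
     forall p, p \is d.-homog -> spanned P g p) -> ~ proj_chain 2 P.
Proof.
move=> hP span [Q1 [hQ1 [sub1 [a0 [Qa0 na0]]] [Q2 [hQ2 [sub2 [b0 [Qb0 nb0]]] _]]]].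
have [[hPi P1 Pprime] hPh _] := hP.
have [[hQ1i Q11 Q1prime] hQ1h _] := hQ1.
have [[hQ2i Q21 Q2prime] hQ2h [j hj]] := hQ2.
have [al na] := homog_not_mem hPi na0; have [be nb] := homog_not_mem hQ1i nb0.
pose a := pihomog mdeg al a0; pose b := pihomog mdeg be b0.
have Qa : Q1 a by apply: hQ1h. have Qb : Q2 b by apply: hQ2h.
have ha : a \is al.-homog by apply: pihomogP. have hb : b \is be.-homog by apply: pihomogP.
(* This r satisfies r^2 > C (d + 1). *)
pose r := (C * (al + be) + C).+1; pose d := (r * (al + be))%N.
have primeP : is_prime P by split. have primeQ1 : is_prime Q1 by split.
have primeQ2 : is_prime Q2 by split.
pose mon i l : S := b ^+ l * 'X_j ^+ (d - i * al - l * be).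
have ind1 i : indep Q1 (fun l : 'I_r => mon i l).
  move=> c hc l.
  have := prime_powers_indep (r := r) (f := fun l (_ : unit) => 'X_j ^+ (d - i * al - l * be))
    (c := fun l _ => if insub l is Some l' then c l' else 0) primeQ1 hQ2i sub2 nb Qb.
  move=> h; have := h _ _ l (ltn_ord l) tt; rewrite valK; apply.
    move=> l' c'; rewrite sum_unit => hx [].
    apply/eqP; apply: contra_notT (@prime_expr _ _ _ _ (d - i * al - l' * be) primeQ2 hj) => c0.
    have -> : 'X_j ^+ (d - i * al - l' * be) = (c' tt)^-1 *: (c' tt *: 'X_j ^+ (d - i * al - l' * be)) :> S.
      by rewrite scalerA mulVf // scale1r.
    by have [_ _ QM] := hQ2i; rewrite -mul_mpolyC; apply: (QM) hx.
  suff <- : \sum_l c l *: mon i l = \sum_(l0 < r) b ^+ l0 * \sum_(t : unit)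
     (match insub (l0 : nat) with Some l' => c l' | None => 0 end) *: 'X_j ^+ (d - i * al - l0 * be) by [].
  by apply: eq_bigr => l0 _; rewrite sum_unit valK /mon scalerAr.
have ind2 : indep P (fun z : 'I_r * 'I_r => a ^+ z.1 * mon z.1 z.2).
  move=> c hc [i l].
  have := prime_powers_indep (r := r) (f := fun i (l : 'I_r) => mon i l)
    (c := fun i l => if insub i is Some i' then c (i', l) else 0) primeP hQ1i sub1 na Qa ind1.
  move=> h; have := h _ i (ltn_ord i) l; rewrite valK; apply.
  have ep : \sum_z c z *: (a ^+ z.1 * mon z.1 z.2) =
      \sum_(i0 < r) \sum_(j0 < r) c (i0, j0) *: (a ^+ i0 * mon i0 j0).
    by rewrite pair_bigA; apply: eq_bigr => -[].
  move: hc; rewrite ep.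
  have -> : \sum_(i0 < r) \sum_(j0 < r) c (i0, j0) *: (a ^+ i0 * mon i0 j0) =
    \sum_(i0 < r) a ^+ i0 * \sum_(t < r)
       (match insub (i0 : nat) with Some i' => c (i', t) | None => 0 end) *: mon i0 t; last by [].
  apply: eq_bigr => i0 _; rewrite mulr_sumr; apply: eq_bigr => l0 _.
  by rewrite valK scalerAr.
have [T [g [cT hg]]] := span d.
have := indep_leq (ideal_submodule hPi) ind2 (g := g).
rewrite card_prod card_ord => h.
have {}h : (r * r <= #|T|)%N.
  apply: h => -[i l]; apply: hg.
  have hi : (i * al <= r * al)%N by rewrite leq_mul2r ltnW ?orbT.
  have hl : (l * be <= r * be)%N by rewrite leq_mul2r ltnW ?orbT.
  have e : d = (al * i + (be * l + 1 * (d - i * al - l * be)))%N.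
    by rewrite mul1n [(al * i)%N]mulnC [(be * l)%N]mulnC /d mulnDr; lia.
  rewrite [X in _ \is X.-homog]e; apply: dhomogM; first exact: dhomogMn.
  by apply: dhomogM; apply: dhomogMn => //; apply: homog_X.
have := leq_trans h cT; rewrite /d /r; clear; move: (al + be)%N => s; nia.
Qed.

End Dimension.

Lemma mderiv_var (k : fieldType) n (i j : 'I_n) : ('X_j : {mpoly k[n]})^`M(i) = ((j == i)%:R)%:MP.
Proof.
rewrite mderivX mnm1E; case: eqP => [->|_]; last by rewrite scale0r mpolyC0.
have -> : (U_(i) - U_(i) = 0)%MM by apply/mnmP => l; rewrite mnmBE subnn mnm0E.
by rewrite scale1r mpolyX0 mpolyC1.
Qed.

(** * The curve of simultaneous squares *)

Section SquareCurve.
Variables (K : fieldType) (m : nat) (e : 'I_m -> K).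
Hypothesis two : 2%:R != 0 :> K.
Local Notation S := {mpoly K[m.+2]}.
Local Notation iW := (ord0 : 'I_m.+2).
Local Notation iT := (lift ord0 ord0 : 'I_m.+2).
Local Notation iZ k := (lift ord0 (lift ord0 k) : 'I_m.+2).

Definition coords (T : Type) (w t : T) (z : 'I_m -> T) (j : 'I_m.+2) : T :=
  if unlift iW j is Some j' then if unlift ord0 j' is Some k then z k else t else w.

Lemma coordsW T w t z : @coords T w t z iW = w.
Proof. by rewrite /coords unlift_none. Qed.

Lemma coordsT T w t z : @coords T w t z iT = t.
Proof. by rewrite /coords liftK unlift_none. Qed.

Lemma coordsZ T w t z k : @coords T w t z (iZ k) = z k.
Proof. by rewrite /coords !liftK. Qed.

Definition quadric k : S := 'X_(iZ k) ^+ 2 - ('X_iW ^+ 2 + e k *: 'X_iT ^+ 2).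

Lemma index_cases (Pj : 'I_m.+2 -> Prop) : Pj iW -> Pj iT -> (forall k, Pj (iZ k)) -> forall j, Pj j.
Proof.
move=> hW hT hZ j; case: (unliftP iW j) => [j'|] -> //.
by case: (unliftP ord0 j') => [k|] ->.
Qed.

Lemma quadric_homog k : quadric k \is 2.-homog.
Proof.
have h j : ('X_j ^+ 2 : S) \is 2.-homog by exact: homog_Xn.
by rewrite /quadric rpredB ?rpredD ?rpredZ ?h.
Qed.

Section Branch.
Variable zeta : 'I_m -> nat -> {poly K}.
Hypothesis zetaP : forall k N, [/\ (zeta k N)`_0 = 1,
  'X^N %| zeta k N ^+ 2 - (1 + e k *: 'X^2) & 'X^N %| zeta k N.+1 - zeta k N].

(** The curve is defined by its branch at w = 1, t = 0, z_k = 1, because the quadrics may define a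
    reducible set, for instance when two of the e_k are equal. *)
Definition branch N := coords 1 'X (fun k => zeta k N).
Local Notation P := (branch_ideal branch).
Local Notation y0 := (coords (1 : K) 0 (fun=> 1)).

Lemma branch_coh N j : 'X^N %| branch N.+1 j - branch N j.
Proof.
elim/index_cases: j => [||k]; rewrite /branch ?coordsW ?coordsT ?coordsZ ?subrr ?dvdp0 //.
by have [] := zetaP k N.
Qed.

Lemma branch_W N : branch N iW = 1. Proof. exact: coordsW. Qed.

Lemma branch_prime : proj_prime P.
Proof. exact: branch_ideal_prime branch_coh branch_W. Qed.

Lemma branch_coef0 N j : (branch N j)`_0 = y0 j.
Proof.
elim/index_cases: j => [||k]; rewrite /branch ?coordsW ?coordsT ?coordsZ ?coef1 ?coefX //.
by have [] := zetaP k N.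
Qed.

Lemma branch_coef1 j : (branch 2 j)`_1 = (j == iT)%:R.
Proof.
elim/index_cases: j => [||k]; rewrite /branch ?coordsW ?coordsT ?coordsZ ?coef1 ?coefX ?eqxx //.
have [z0 h _] := zetaP k 2.
have := coef_dvdXn h (isT : (1 < 2)%N).
rewrite coefB coefD coefZ coefXn coef1 mulr0 addr0 subr0 expr2 coefM big_ord_recl big_ord1 /= z0.
have -> : bump 0 0 = 1%N by []. rewrite subn0 mul1r mulr1 => h2.
by apply: (mulfI two); rewrite mulr0 mulr_natl mulr2n.
Qed.

Lemma quadric_branch k : P (quadric k).
Proof.
apply/(branch_ideal_homog _ (quadric_homog k)) => N.
rewrite /quadric mmapB mmapD mmapZ !rmorphXn /= !mmapX !mmap1U /branch coordsW coordsT coordsZ.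
by rewrite mul_polyC expr1n; have [] := zetaP k N.
Qed.

Lemma branch_y0 p d : p \is d.-homog -> P p -> mmap idfun y0 p = 0.
Proof.
move=> hp hP; have := branch_point hP d; rewrite (pihomog_dE hp) => h.
by apply: etrans h; apply: eq_mmap => // j; rewrite branch_coef0.
Qed.

Definition monomial p q (f : 'I_m -> nat) : S :=
  'X_iW ^+ p * 'X_iT ^+ q * \prod_k 'X_(iZ k) ^+ f k.

Lemma monomialE (mu : 'X_{1..m.+2}) : 'X_[mu] = monomial (mu iW) (mu iT) (fun k => mu (iZ k)).
Proof. by rewrite mpolyXE_id !big_ord_recl mulrA. Qed.

(** The quadrics eliminate the squares of the z_k; there remain 2^m choices of their exponents and
    an exponent of t at most d. *)
Lemma branch_span d : exists (T : finType) (g : T -> S), (#|T| <= 2 ^ m * d.+1)%N /\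
  forall p, p \is d.-homog -> spanned P g p.
Proof.
have [[Pid _ _] _ _] := branch_prime; have subP := ideal_submodule Pid.
have [P0 PD PZ] := subP; have [_ _ PM] := Pid.
pose T : finType := ({ffun 'I_m -> bool} * 'I_d.+1)%type.
pose g (z : T) := monomial (d - z.2 - \sum_k z.1 k) z.2 (fun k => z.1 k : nat).
exists T, g; split; first by rewrite card_prod card_ffun card_bool !card_ord.
have spD x y c : spanned P g x -> spanned P g y -> spanned P g (x + c *: y).
  move=> [a ha] [b hb]; exists (fun t => a t + c * b t).
  have -> : x + c *: y - \sum_i (a i + c * b i) *: g i =
      (x - \sum_i a i *: g i) + c *: (y - \sum_i b i *: g i).
    rewrite scalerBr scaler_sumr addrACA -opprD -big_split; congr (_ - _).
    by apply: eq_bigr => t _; rewrite scalerDl scalerA.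
  by apply: PD => //; apply: PZ.
have spP x y : P (x - y) -> spanned P g y -> spanned P g x.
  move=> hxy [a ha]; exists a; rewrite -(subrK y x) -addrA; exact: PD.
have small p q f : ~ (exists k, (1 < f k)%N) -> (p + q + \sum_k f k = d)%N ->
    spanned P g (monomial p q f).
  move=> hf hd; have f1 k : (f k <= 1)%N by rewrite leqNgt; apply/negP => h; apply: hf; exists k.
  have qd : (q < d.+1)%N by rewrite ltnS -hd; lia.
  pose A := [ffun k => f k == 1%N].
  have fA k : A k = f k :> nat by rewrite ffunE; have := f1 k; case: (f k) => [|[|]].
  exists (fun t => (t == (A, Ordinal qd))%:R).
  rewrite (bigD1 (A, Ordinal qd)) //= eqxx scale1r big1 ?addr0 => [|t /negbTE ->]; last exact: scale0r.
  rewrite /g /=; have -> : (d - q - \sum_k A k = p)%N.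
    have -> : (\sum_k A k = \sum_k f k)%N by apply: eq_bigr => k _; apply: fA.
    by rewrite -hd; clear; move: (\sum_k f k)%N => s; lia.
  by rewrite /monomial (eq_bigr _ (fun k _ => congr1 (fun x => 'X_(iZ k) ^+ x) (fA k))) subrr.
have mon N p q f : (\sum_k f k <= N)%N -> (p + q + \sum_k f k = d)%N ->
    spanned P g (monomial p q f).
  elim: N p q f => [|N IH] p q f hN hd;
    case: (classic (exists k, (1 < f k)%N)) => [[k hk]|hf].
  - by move: hN; rewrite (bigD1 k) //= leqn0 addn_eq0; move: hk; case: (f k).
  - exact: small.
  - pose f' l := (f l - (l == k).*2)%N.
    have ef l : f l = (f' l + (l == k).*2)%N.
      by rewrite /f' subnK //; case: eqP => [->|].
    have sf : (\sum_l f l = \sum_l f' l + 2)%N.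
      rewrite (eq_bigr _ (fun l _ => ef l)) big_split /=; congr (_ + _)%N.
      by rewrite (bigD1 k) //= eqxx big1 ?addn0 // => l /negbTE ->.
    have hf' : (\sum_l f' l <= N)%N by move: hN; rewrite sf addn2 ltnS; apply: ltnW.
    apply: (spP _ (monomial p.+2 q f' + e k *: monomial p q.+2 f')).
      have -> : monomial p q f - (monomial p.+2 q f' + e k *: monomial p q.+2 f') =
          monomial p q f' * quadric k.
        have -> : monomial p q f = monomial p q f' * 'X_(iZ k) ^+ 2.
          rewrite /monomial -[RHS]mulrA; congr (_ * _).
          transitivity (\prod_l ('X_(iZ l) ^+ f' l * 'X_(iZ l) ^+ (l == k).*2) : S).
            by apply: eq_bigr => l _; rewrite {1}ef exprD.
          rewrite big_split /=; congr (_ * _).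
          by rewrite (bigD1 k) //= eqxx big1 ?mulr1 // => l /negbTE ->.
        rewrite /quadric /monomial -!mul_mpolyC !exprS; ring.
      exact: (PM _ _ (quadric_branch k)).
    by apply: spD; apply: IH => //; rewrite -hd sf; clear; move: (\sum_l f' l)%N => s; lia.
  - exact: small.
move=> p hp; rewrite (mpolyE p) big_seq; elim/big_ind: _ => [|x y hx hy|mu hmu].
- by exists (fun=> 0); rewrite big1 ?subr0 // => t _; rewrite scale0r.
- by rewrite -[y]scale1r; apply: spD.
rewrite -[_ *: _]add0r; apply: spD.
  by exists (fun=> 0); rewrite big1 ?subr0 // => t _; rewrite scale0r.
rewrite monomialE; apply: (mon _ _ _ _ (leqnn _)).
by rewrite -(dhomog_mf hp hmu) /= mdegE !big_ord_recl addnA.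
Qed.

Lemma branch_dim : has_proj_dim P 1.
Proof.
split; last exact: dim_le1 branch_prime branch_span.
have y0W : y0 iW = 1 by apply: coordsW.
exists (point_ideal (idfun : {rmorphism K -> K}) y0); split=> //.
  by apply: point_ideal_prime; exists iW; rewrite y0W oner_neq0.
split=> [p hp d|].
  have [_ hh _] := branch_prime.
  exact: (branch_y0 (pihomogP _ _ _) (hh _ _ hp)).
exists 'X_iT; split.
  by apply/(point_ideal_homog _ _ (homog_X _ _)); rewrite mmapX mmap1U coordsT.
move/(branch_ideal_homog _ (homog_X _ _))/(_ 2%N).
rewrite mmapX mmap1U /branch coordsT => /dvdp_leq.
by rewrite polyX_eq0 size_polyXn size_polyX => /(_ isT).
Qed.

(** The rank is at most m because y0, by Euler's relation, and the tangent vector of the branch lie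
    in the kernel. It is at least m because the quadrics belong to the ideal and their derivatives
    in the z_k form twice the identity at y0. *)
Lemma branch_smooth (s : seq S) : (forall p, p \in s -> p \is homog mdeg) ->
  (forall p, ideal_gen s p <-> P p) ->
  \rank (\matrix_(a < size s, j < m.+2) mmap idfun y0 (s`_a)^`M(j)) = m.
Proof.
move=> sh sP; set J := \matrix_(a, j) _.
have sy a : mmap idfun y0 s`_a = 0.
  case: (ltnP a (size s)) => ha; last by rewrite nth_default // mmap0.
  have /homogP [d hd] := sh _ (mem_nth 0 ha).
  by apply: (branch_y0 hd); apply/sP/ideal_gen_mem/mem_nth.
apply/eqP; rewrite eqn_leq; apply/andP; split.
  pose U := \matrix_(j < m.+2, l < 2) (if l == 0 then y0 j else (j == iT)%:R).
  pose V := \matrix_(l < 2, j < m.+2) (if l == 0 then (j == iW)%:R else (j == iT)%:R : K).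
  have JU : J *m U = 0.
    apply/matrixP => a l; rewrite !mxE; have /homogP [d hd] := sh _ (mem_nth 0 (ltn_ord a)).
    under eq_bigr do rewrite !mxE.
    case: (l == 0); first by rewrite (euler_mmap _ _ hd) sy mulr0.
    have hb : P s`_a by apply/sP/ideal_gen_mem/mem_nth.
    have := branch_tangent hd hb => h; apply: etrans h; apply: eq_bigr => j _.
    rewrite branch_coef1; congr (_ * _); apply: eq_mmap => // i; rewrite branch_coef0 //.
  have VU : V *m U = 1%:M.
    have sel (j0 : 'I_m.+2) (F : 'I_m.+2 -> K) : \sum_j (j == j0)%:R * F j = F j0.
      rewrite (bigD1 j0) //= eqxx mul1r big1 ?addr0 // => j /negbTE ->.
      by rewrite mul0r.
    apply/matrixP => l l'; rewrite !mxE.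
    under eq_bigr do rewrite !mxE.
    have I2 (i : 'I_2) : i = 0 \/ i = 1 by case: i => -[|[|//]] h; [left|right]; apply: val_inj.
    by case: (I2 l) => ->; case: (I2 l') => -> /=; rewrite sel ?coordsW ?coordsT.
  have := mulmx0_rank_max JU; have : (2 <= \rank U)%N.
    by have := mxrankM_maxr V U; rewrite VU mxrank1.
  lia.
have hC k : exists c : 'I_(size s) -> S, quadric k = \sum_(a < size s) c a * s`_a.
  by apply/sP/quadric_branch.
have [c hc] := choice _ hC.
pose A := \matrix_(k < m, a < size s) mmap idfun y0 (c k a).
pose B := \matrix_(j < m.+2, l < m) ((j == iZ l)%:R : K).
have AJB : A *m J *m B = 2%:R%:M.
  have AJ k j : (A *m J) k j = mmap idfun y0 (quadric k)^`M(j).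
    rewrite mxE hc (raddf_sum (mderiv j)) (raddf_sum (mmap idfun y0)); apply: eq_bigr => a _.
    by rewrite !mxE /= mderivM mmapD !rmorphM /= sy mulr0 add0r.
  apply/matrixP => k l; rewrite mxE (bigD1 (iZ l)) //= [B _ _]mxE eqxx mulr1 big1 ?addr0; last first.
    by move=> j /negbTE ne; rewrite [B _ _]mxE ne mulr0.
  rewrite AJ /quadric mderivB mderivD mderivZ !expr2 !mderivM !mderiv_var.
  rewrite mmapB !mmapD mmapZ !mmapD !rmorphM /= !mmapC !mmapX !mmap1U !coordsZ !mxE.
  by rewrite !(inj_eq lift_inj) /=; case: (k == l) => /=; ring.
have := leq_trans (mxrankM_maxl (A *m J) B) (mxrankM_maxr A J).
by rewrite AJB -scalemx1 mxrank_scale_nz // mxrank1.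
Qed.

End Branch.

(** On the open part where w and all z_k are nonzero, the points with t = 0 are (1, 0, +-1, ...,
    +-1) up to scalars, finitely many; so an infinite set of points contains one with t nonzero. *)
Lemma large_field_squares : large_field K ->
  exists t, t != 0 /\ forall k, exists z, z != 0 /\ 1 + e k * t ^+ 2 = z ^+ 2.
Proof.
move=> large.
have [zeta hz] := choice _ (fun k => sqrt_series (e k) two).
have bp := branch_prime hz; have [[Pid _ _] hh _] := bp.
have [s [sh sP]] := homog_generators Pid hh.
have eP : ideal_gen s = branch_ideal (branch zeta).
  by apply: functional_extensionality => p; apply: propositional_extensionality.
have pr : proj_prime (ideal_gen s) by rewrite eP.
have dm : has_proj_dim (ideal_gen s) 1 by rewrite eP; apply: branch_dim hz.
pose C := ProjCurve sh pr dm.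
pose u : S := 'X_iW * \prod_k 'X_(iZ k).
pose y0 : 'rV[K]_m.+2 := \row_j coords 1 0 (fun=> 1) j.
have evE (p : S) (x : 'rV[K]_m.+2) : p.@[x 0] = mmap idfun (x 0) p by [].
have y0E (p : S) : p.@[y0 0] = mmap idfun (coords 1 0 (fun=> 1)) p.
  by apply: eq_mmap => // j; rewrite mxE.
have hu : forall p, p \in [:: u] -> p \is homog mdeg.
  move=> p; rewrite inE => /eqP ->; apply/homogP; exists (1 + \sum_(k < m) 1)%N.
  apply: dhomogM; first exact: homog_X.
  elim/big_rec2: _ => [|k d q _ hq]; first exact: dhomog1.
  by apply: dhomogM => //; apply: homog_X.
have inf : infinite (open_point C [:: u]).
  apply: (large C [:: u] hu); exists <[y0]>%VS, y0; split=> //.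
  - by apply/eqP => /rowP/(_ iW)/eqP; rewrite !mxE coordsW oner_eq0.
  - move=> p hp; rewrite y0E; have /homogP [d hd] := sh _ hp.
    by apply: (branch_y0 hz hd); apply/sP/ideal_gen_mem.
  - move/(_ u (mem_head _ _))/eqP; rewrite y0E /u rmorphM rmorph_prod /= mmapX mmap1U coordsW mul1r.
    by rewrite big1 ?oner_eq0 // => k _; rewrite /= mmapX mmap1U coordsZ.
  - congr _.+1; rewrite -[RHS](branch_smooth hz sh sP).
    rewrite /jacobian /pc_ext (rank_matrix_of (fun i j => ([seq map_mpoly idfun p | p <- s]`_i)^`M(j).@[y0 0]) (size_map _ _)).
    congr (\rank _); apply/matrixP => a j; rewrite !mxE nth_map0.
    by rewrite /= (map_mpoly_idfun s`_a) y0E.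
pose z (A : {ffun 'I_m -> bool}) : 'rV[K]_m.+2 := \row_j coords 1 0 (fun k => (-1) ^+ A k) j.
have [P1 [[x [x0 hx hu' eP1]] nP1]] := inf [seq <[z A]>%VS | A : {ffun 'I_m -> bool}].
have ux : u.@[x 0] != 0.
  by apply: contra_notN hu' => /eqP ux p; rewrite inE => /eqP ->.
have [xW xZ] : x 0 iW != 0 /\ forall k, x 0 (iZ k) != 0.
  move: ux; rewrite evE /u rmorphM rmorph_prod /= mmapX mmap1U mulf_eq0 negb_or => /andP [-> h].
  split=> // k; move: h => /prodf_neq0/(_ k isT).
  by rewrite /= mmapX mmap1U.
have qx k : x 0 (iZ k) ^+ 2 = x 0 iW ^+ 2 + e k * x 0 iT ^+ 2.
  have [c hc] : ideal_gen s (quadric k) by apply/sP; apply: quadric_branch.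
  have : mmap idfun (x 0) (quadric k) = 0.
    rewrite hc (raddf_sum (mmap idfun (x 0))) big1 // => a _.
    by rewrite /= rmorphM /= -[mmap _ _ s`_a]evE (hx _ (mem_nth 0 (ltn_ord a))) mulr0.
  rewrite /quadric mmapB mmapD mmapZ !rmorphXn /= !mmapX !mmap1U => /eqP.
  by rewrite subr_eq0 => /eqP.
exists (x 0 iT / x 0 iW); split; last first.
  move=> k; exists (x 0 (iZ k) / x 0 iW); split; first by rewrite mulf_neq0 ?invr_neq0.
  by rewrite !expr_div_n qx; field.
apply/eqP => /eqP; rewrite mulf_eq0 invr_eq0 (negbTE xW) orbF => /eqP xT.
case/negP: nP1; apply/imageP.
have xs k : x 0 (iZ k) = x 0 iW * (-1) ^+ (x 0 (iZ k) != x 0 iW).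
  have := qx k; rewrite xT expr0n mulr0 addr0 => /eqP; rewrite eqf_sqr.
  by case: eqP => [->|_] /=; [rewrite mulr1|move=> /eqP ->; rewrite mulrN1].
exists [ffun k => x 0 (iZ k) != x 0 iW] => //; rewrite eP1.
set w := z _.
have ex : x = x 0 iW *: z [ffun k => x 0 (iZ k) != x 0 iW].
  apply/rowP; apply: index_cases => [||k]; rewrite !mxE ?coordsW ?coordsT ?coordsZ ?mulr1 ?mulr0 //.
  by rewrite {1}xs ffunE.
rewrite {1}ex -/w; apply: subv_anti; apply/andP; split; rewrite -memvE.
  by apply: rpredZ; apply: memv_line.
rewrite -[X in X \in _](scalerK xW); apply: rpredZ; apply: memv_line.
Qed.
End SquareCurve.

(** * The tree property *)

Section TwoSquares.
Variable K : fieldType.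

Definition in_coset (u y : K) := exists s, s != 0 /\ y = u * s ^+ 2.

(* Variables: s, x, c, d, a, b. *)
Local Notation v i := (@RVar 6 (inord i)).
Local Notation sq := (RMul (v 0) (v 0)).

(* phi(x; c, d, a, b) says that x - c is a times a nonzero square and d - x is b times a
   nonzero square. *)
Definition interval_formula : rformula (1 + 4) :=
  RAnd
    (RExists (RAnd (RNot (REq (v 0) (RZero 6))) (REq (RAdd (v 1) (ROpp (v 2))) (RMul (v 4) sq))))
    (RExists (RAnd (RNot (REq (v 0) (RZero 6))) (REq (RAdd (v 3) (ROpp (v 1))) (RMul (v 5) sq)))).

Lemma interval_formulaP (x c d a b : K) (A : 1.-tuple K) (B : 4.-tuple K) :
  A = [:: x] :> seq K -> B = [:: c; d; a; b] :> seq K ->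
  rholds interval_formula [tuple of A ++ B] <-> in_coset a (x - c) /\ in_coset b (d - x).
Proof.
move=> eA eB.
have ev (s : K) i : (i < 6)%N ->
    tnth [tuple of s :: [tuple of A ++ B]] (inord i) = nth 0 [:: s; x; c; d; a; b] i.
  by move=> hi; rewrite (tnth_nth 0) /= inordK // eA eB.
have h (s p q r : K) : (~ s = 0 /\ p - q = r * (s * s)) <-> (s != 0 /\ p - q = r * s ^+ 2).
  by rewrite expr2; split=> -[/eqP hs ->]; split=> //; apply/eqP.
rewrite /in_coset /=; split=> -[[s hs] [s' hs']]; split; [exists s|exists s'|exists s|exists s'];
  move: hs hs'; rewrite ?ev //=; move=> /h hs /h hs' //.
Qed.

Definition satisfies (cs : seq (K * K)) (x : K) := forall z, z \in cs -> in_coset z.2 (x - z.1).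

Definition nonzero_classes (cs : seq (K * K)) := forall z, z \in cs -> z.2 != 0.

Hypotheses (two : 2%:R != 0 :> K) (large : large_field K).

(** For y = x + u t^2 one has y - c = (x - c)(1 + u / (x - c) t^2), and largeness makes all the
    second factors nonzero squares at once. *)
Lemma satisfies_near cs x u : nonzero_classes cs -> satisfies cs x -> u != 0 ->
  exists y, satisfies cs y /\ in_coset u (y - x).
Proof.
move=> cs0 sx u0.
pose f (k : 'I_(size cs)) := u / (x - (nth (0, 0) cs k).1).
have [t [t0 ht]] := large_field_squares f two large.
exists (x + u * t ^+ 2); split; last by exists t; rewrite addrAC subrr add0r.
move=> z hz; have [s [s0 es]] := sx z hz.
have hk : (index z cs < size cs)%N by rewrite index_mem.
have [r [r0 er]] := ht (Ordinal hk); rewrite /f /= nth_index // in er.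
exists (s * r); split; first by rewrite mulf_neq0.
have xz0 : x - z.1 != 0 by rewrite es mulf_neq0 ?expf_neq0 // cs0.
have -> : x + u * t ^+ 2 - z.1 = (x - z.1) * (1 + u / (x - z.1) * t ^+ 2) by field.
by rewrite er exprMn [RHS]mulrA -es.
Qed.

(* If a x^2 + b y^2 does not represent 1, then a(square) + b(square) contains no nonzero
   square, so the sets phi(x; c, d) and phi(x; c', d') are disjoint as soon as d' - c is a
   nonzero square; the formula has the tree property because finitely many square class
   conditions can be kept while moving a point in any square class. *)
Section Tree.
Variables a b : K.
Hypotheses (a0 : a != 0) (b0 : b != 0) (no_sol : ~ exists x y, a * x ^+ 2 + b * y ^+ 2 = 1).

Lemma disjoint_intervals x c d c' d' : in_coset 1 (d' - c) ->
  in_coset a (x - c) -> in_coset b (d - x) -> in_coset a (x - c') -> in_coset b (d' - x) -> False.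
Proof.
move=> [r [r0 er]] [s [s0 es]] _ _ [t [t0 et]]; apply: no_sol; exists (s / r), (t / r).
have e : a * s ^+ 2 + b * t ^+ 2 = r ^+ 2 by rewrite -es -et -[RHS]mul1r -er; ring.
have r2 : r ^+ 2 != 0 by rewrite expf_neq0.
by apply: (mulIf r2); rewrite mul1r; apply: etrans e; field.
Qed.

(** A choice function is fixed, so that the same data always produce the same point. *)
Definition near_choice : {near : seq (K * K) * K * K -> K | forall cs x u,
  nonzero_classes cs -> satisfies cs x -> u != 0 ->
  satisfies cs (near (cs, x, u)) /\ in_coset u (near (cs, x, u) - x)}.
Proof.
apply: constructive_indefinite_description.
have [near hnear] := choice (fun (w : seq (K * K) * K * K) y =>
    nonzero_classes w.1.1 -> satisfies w.1.1 w.1.2 -> w.2 != 0 ->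
    satisfies w.1.1 y /\ in_coset w.2 (y - w.1.2))
  (fun w => (match classic (nonzero_classes w.1.1 /\ satisfies w.1.1 w.1.2 /\ w.2 != 0) with
    | or_introl h => let: ex_intro y hy := satisfies_near h.1 h.2.1 h.2.2 in ex_intro _ y (fun _ _ _ => hy)
    | or_intror h => ex_intro _ 0 (fun h1 h2 h3 => False_ind _ (h (conj h1 (conj h2 h3)))) end)).
by exists near => cs x u; apply: (hnear (cs, x, u)).
Qed.

Let near cs x u := sval near_choice (cs, x, u).

Lemma nearP cs x u : nonzero_classes cs -> satisfies cs x -> u != 0 ->
  satisfies cs (near cs x u) /\ in_coset u (near cs x u - x).
Proof. exact: (svalP near_choice). Qed.

(* The conditions and the witnesses z_i for the children of a node (cs, x). *)
Fixpoint children (cs : seq (K * K)) (x : K) (i : nat) : seq (K * K) * K :=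
  if i is i'.+1 then
    let: (cs', z) := children cs x i' in
    let c := near cs' z (- a) in ((c, 1) :: cs', near cs' c 1)
  else (cs, x).

(** This is the very point c used in [children]. There the next witness is c plus a nonzero square,
    and this is kept as a condition, so every later upper bound differs from c by a nonzero square,
    as [disjoint_intervals] requires. *)
Definition lower cs x i := near (children cs x i).1 (children cs x i).2 (- a).
Definition upper cs x i := near (children cs x i).1 (children cs x i).2 b.

Lemma satisfies_cons z cs x : satisfies (z :: cs) x <-> in_coset z.2 (x - z.1) /\ satisfies cs x.
Proof.
split=> [h|[h1 h2] w]; first split; first by apply: h; rewrite mem_head.
  by move=> w hw; apply: h; rewrite inE hw orbT.
by rewrite inE => /orP [/eqP ->|/h2].
Qed.

Lemma childrenP cs x i : nonzero_classes cs -> satisfies cs x ->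
  [/\ nonzero_classes (children cs x i).1, satisfies (children cs x i).1 (children cs x i).2,
      {subset cs <= (children cs x i).1} &
      forall j, (j < i)%N -> (lower cs x j, 1) \in (children cs x i).1].
Proof.
move=> cs0 sx; elim: i => [|i [IH1 IH2 IH3 IH4]]; first by split.
rewrite /=; have : lower cs x i = near (children cs x i).1 (children cs x i).2 (- a) by [].
case: (children cs x i) IH1 IH2 IH3 IH4 => cs' z /= IH1 IH2 IH3 IH4 el.
have a0' : - a != 0 by rewrite oppr_eq0.
have [h1 _] := nearP IH1 IH2 a0'; have [h2 h3] := nearP IH1 h1 (oner_neq0 K).
split=> [w|||j].
- by rewrite inE => /orP [/eqP ->|/IH1 //]; exact: oner_neq0.
- by apply/satisfies_cons.
- by move=> w /IH3 hw; rewrite inE hw orbT.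
- by rewrite ltnS leq_eqVlt => /orP [/eqP ->|/IH4 h]; rewrite ?el inE ?eqxx // h orbT.
Qed.

Lemma child_bounds cs x i : nonzero_classes cs -> satisfies cs x ->
  let z := (children cs x i).2 in
  [/\ satisfies cs z, in_coset a (z - lower cs x i), in_coset b (upper cs x i - z) &
    forall j, (j < i)%N -> in_coset 1 (upper cs x i - lower cs x j)].
Proof.
move=> cs0 sx z; have [h1 h2 h3 h4] := childrenP i cs0 sx.
have a0' : - a != 0 by rewrite oppr_eq0.
have [_ [s [s0 es]]] := nearP h1 h2 a0'; have [h5 h6] := nearP h1 h2 b0.
split=> // [w /h3 /h2 //||j /h4 /h5 //].
by exists s; split=> //; rewrite -opprB es mulNr opprK.
Qed.

(** A child keeps the conditions of its parent, adds its own interval and forgets the auxiliary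
    conditions on its siblings. That upper - y is b times a square is recorded as y - upper being -b
    times a square. *)
Definition child (nd : seq (K * K) * K * (K * K)) i :=
  let: (cs, x, _) := nd in
  ((lower cs x i, a) :: (upper cs x i, - b) :: cs, (children cs x i).2, (lower cs x i, upper cs x i)).

Definition node (s : seq nat) := foldl child ([::], 0, (0, 0)) s.

Lemma childP nd i : nonzero_classes nd.1.1 -> satisfies nd.1.1 nd.1.2 ->
  nonzero_classes (child nd i).1.1 /\ satisfies (child nd i).1.1 (child nd i).1.2.
Proof.
case: nd => -[cs x] cd /= cs0 sx; have [h1 h2 [s [s0 es]] _] := child_bounds i cs0 sx.
split; first by move=> w; rewrite !inE => /orP [/eqP ->|/orP [/eqP ->|/cs0 //]]; rewrite ?oppr_eq0.
apply/satisfies_cons; split=> //; apply/satisfies_cons; split=> //=.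
by exists s; split=> //; rewrite -opprB es mulNr.
Qed.

Lemma nodeP s : nonzero_classes (node s).1.1 /\ satisfies (node s).1.1 (node s).1.2.
Proof.
by elim/last_ind: s => // s i [h1 h2]; rewrite /node foldl_rcons; apply: childP.
Qed.

Lemma node_subset s t : {subset (node s).1.1 <= (node (s ++ t)).1.1}.
Proof.
elim/last_ind: t => [|t i IH]; first by rewrite cats0.
rewrite -rcons_cat {2}/node foldl_rcons -/(node _) => w /IH.
by case: (node (s ++ t)) => -[cs x] cd /= hw; rewrite !inE hw !orbT.
Qed.

Lemma node_rcons s i : (node (rcons s i)).2 =
  (lower (node s).1.1 (node s).1.2 i, upper (node s).1.1 (node s).1.2 i).
Proof. by rewrite /node foldl_rcons -/(node s); case: (node s) => -[cs x] cd. Qed.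

Lemma node_interval s i y : satisfies (node (rcons s i)).1.1 y ->
  in_coset a (y - (node (rcons s i)).2.1) /\ in_coset b ((node (rcons s i)).2.2 - y).
Proof.
rewrite /node foldl_rcons -/(node s); case: (node s) => -[cs x] cd /=.
move=> /satisfies_cons [h1 /satisfies_cons [[s' [s0 es]] _]]; split=> //.
by exists s'; split=> //; rewrite -opprB es mulNr opprK.
Qed.

Lemma interval_tree_property : tree_property K interval_formula.
Proof.
exists 2%N, (fun s => [tuple (node s).2.1; (node s).2.2; a; b]); split=> // [s I|sigma N].
  move=> uI sI [A hA].
  have eA : A = [:: tnth A ord0] :> seq K.
    by case: A {hA} => -[|x [|]] //= hA; congr [:: _]; rewrite (tnth_nth 0).
  have key i j : i \in I -> j \in I -> (i < j)%N -> False.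
    move=> hi hj ij.
    have [h1 h2] := (interval_formulaP eA (erefl _)).1 (hA i hi).
    have [h3 h4] := (interval_formulaP eA (erefl _)).1 (hA j hj).
    apply: (disjoint_intervals _ h1 h2 h3 h4); rewrite !node_rcons /=.
    have [n1 n2] := nodeP s; have [_ _ _ h] := child_bounds j n1 n2; exact: h.
  case: I uI sI hA key => [|i [|j [|]]] //= + _ _ key.
  rewrite inE andbT; case: (ltngtP i j) => // h _.
    by apply: (key i j) => //; rewrite !inE eqxx ?orbT.
  by apply: (key j i) => //; rewrite !inE eqxx ?orbT.
exists [tuple (node (mkseq sigma N)).1.2] => i iN.
apply/interval_formulaP; [by []|by []|].
have e : mkseq sigma i.+1 = rcons (mkseq sigma i) (sigma i) by rewrite /mkseq -addn1 iotaD map_cat cats1.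
rewrite e; apply: node_interval; rewrite -e.
have [_ h] := nodeP (mkseq sigma N); move=> w hw; apply: h.
have -> : mkseq sigma N = mkseq sigma i.+1 ++ [seq sigma k | k <- iota i.+1 (N - i.+1)].
  by rewrite /mkseq -map_cat -iotaD subnKC.
exact: node_subset.
Qed.

End Tree.
End TwoSquares.

Lemma simple_large_two_squares (K : fieldType) : 2%:R != 0 :> K -> large_field K -> simple_field K ->
  forall a b : K, a != 0 -> b != 0 -> exists x y, a * x ^+ 2 + b * y ^+ 2 = 1.
Proof.
move=> two large simple a b a0 b0; apply: NNPP => hn.
have refl : elem_equiv K K by [].
exact: (simple K refl 1%N 4%N _ (interval_tree_property two large a0 b0 hn)).
Qed.

(** * Conics *)

Lemma smooth_rank (K : fieldType) (C : proj_curve K) : smooth_curve C ->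
  forall (L : fieldType) (kappa : {rmorphism K -> L}) (y : 'I_(pc_n C).+1 -> L),
  (exists j, y j != 0) -> (forall p, p \in pc_eqns C -> mmap kappa y p = 0) ->
  (\rank (\matrix_(a < size (pc_eqns C), j < (pc_n C).+1) mmap kappa y ((pc_eqns C)`_a)^`M(j))).+1 = pc_n C.
Proof.
move=> smooth L kappa y [j yj] hy; pose x : 'rV[L]_(pc_n C).+1 := \row_j y j.
have ev (p : {mpoly K[(pc_n C).+1]}) : (map_mpoly kappa p).@[x 0] = mmap kappa y p.
  rewrite -[LHS]/(mmap idfun (x 0) (map_mpoly kappa p)) mmap_map_mpoly.
  by apply: eq_mmap => // l; rewrite mxE.
rewrite -[RHS](smooth L kappa x); last first.
- by move=> p /mapP [q hq ->]; rewrite ev hy.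
- by apply: contraNneq yj => /rowP/(_ j); rewrite !mxE => ->.
congr _.+1.
rewrite /jacobian (rank_matrix_of (fun i j => ((pc_ext C kappa)`_i)^`M(j).@[x 0]) (size_map _ _)).
congr (\rank _); apply/matrixP => a l; rewrite !mxE /pc_ext nth_map0 /=.
by rewrite mderiv_map_mpoly ev.
Qed.

Lemma conic_point (K : fieldType) (C : proj_curve K) : 2%:R != 0 :> K -> large_field K ->
  simple_field K -> conic C -> exists x : 'rV[K]_(pc_n C).+1, x != 0 /\ zero_at (pc_eqns C) x.
Proof.
move=> two large simple [smooth [r [hp [_ hh e]]]].
(* Genus 0 means hp(0) = 1, whatever the sign (-1)^r. *)
have hp0 : hp.[0] = 1.
  apply/eqP; rewrite -subr_eq0; move/esym/eqP: e.
  by rewrite mulf_eq0 expf_eq0 oppr_eq0 oner_eq0 andbF.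
have [D [N0 [D0 hb]]] := conic_hilbert_fun (pc_prime C) (pc_dim1 C) hh hp0.
have ex d : {b : 'I_(D * d + 1) -> {mpoly K[(pc_n C).+1]} |
    (N0 <= d)%N -> graded_basis (ideal_gen (pc_eqns C)) d b}.
  apply: constructive_indefinite_description.
  by case: (leqP N0 d) => [/hb [b hb']|_]; [exists b|exists (fun=> 0)].
have [z [[j zj] hz]] := descended_point D0 (@pc_homog _ C) (fun d => svalP (ex d))
  (smooth_rank smooth) (pc_prime C) (pc_dim1 C).1 two
  (ternary_isotropic two (simple_large_two_squares two large simple)).
exists (\row_j z j); split; first by apply: contraNneq zj => /rowP/(_ j); rewrite !mxE => ->.
move=> p hp'; rewrite -[RHS](hz p hp'); apply: eq_mmap => // l; by rewrite mxE.
Qed.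

Theorem theorem1p6 (K : fieldType) (hlarge : large_field K)
    (hsimple : simple_field K) (hchar : 2%N \notin [pchar K])
    (C : proj_curve K) (hC : conic C) :
  (exists P, curve_point C P) /\ infinite (curve_point C).
Proof.
have two : 2%:R != 0 :> K by apply: contraNneq hchar => h; rewrite inE /= h eqxx.
have [x [x0 hx]] := conic_point two hlarge hsimple hC.
split; first by exists <[x]>%VS, x.
(* The open subset given by the constant 1 is all of C. *)
have n1 y : ~ zero_at [:: 1] y by move/(_ 1 (mem_head _ _))/eqP; rewrite rmorph1 oner_eq0.
have inf : infinite (open_point C [:: 1]).
  apply: hlarge => [p|]; first by rewrite inE => /eqP ->; apply/homogP; exists 0%N; exact: dhomog1.
  exists <[x]>%VS, x; split=> //; apply: hC.1 => // p /mapP [q hq ->].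
  rewrite -[LHS]/(mmap idfun (x 0) (map_mpoly idfun q)) mmap_map_mpoly -[RHS](hx q hq).
  exact: eq_mmap.
move=> s; have [P [[y [y0 hy _ eP]] hP]] := inf s.
by exists P; split=> //; exists y.
Qed.
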